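(* Let $H$ be a single particle Hamiltonian satisfying the spectral assumption (S) and the symmetry assumption (Y) of the context, and let the grid $\mathcal K$ satisfy the grid assumption (G) of the context. Suppose there exists $\mathbf k\in\mathcal K$ such that (1) for some $\mathbf G\in\Gamma^*$, $\operatorname{Im}\operatorname{tr}(A_{\mathbf k}(\mathbf G))\neq 0$; (2) for every non-trivial orthogonal projector $\Pi$ on $\mathbb C^M$ (i.e. $\Pi\neq 0$ and $\Pi\ne I$) there exists $\mathbf G'\in\Gamma^*$ such that $\|(I-\Pi)A_{\mathbf k}(\mathbf G')\Pi\|>0$. Then the two ferromagnetic Slater determinants $|\Psi_+\rangle,|\Psi_-\rangle$ are the unique translation-invariant Hartree-Fock ground states of $\hat H_{FBI}$; that is, up to scalar phases, they are exactly the minimizers of $\langle\psi|\hat H_{FBI}|\psi\rangle/\langle\psi|\psi\rangle$ over $|\psi\rangle\in\mathcal S$.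
   Context: Lattices. $\mathbf v_1=-(\tfrac{2\pi}{\sqrt3},\tfrac{2\pi}{3})^\top$, $\mathbf v_2=(\tfrac{2\pi}{\sqrt3},-\tfrac{2\pi}{3})^\top$, $\Gamma=\mathbb Z\mathbf v_1+\mathbb Z\mathbf v_2$; $\mathbf g_1=-(\tfrac{\sqrt3}{2},\tfrac32)^\top$, $\mathbf g_2=(\tfrac{\sqrt3}{2},-\tfrac32)^\top$, $\Gamma^*=\mathbb Z\mathbf g_1+\mathbb Z\mathbf g_2$. $\Omega$ and $\Omega^*$ are the cells $\{t_1\mathbf v_1+t_2\mathbf v_2\}$, $\{t_1\mathbf g_1+t_2\mathbf g_2\}$, $t_i\in[-\frac12,\frac12)$, identified with $\mathbb R^2/\Gamma$, $\mathbb R^2/\Gamma^*$. Functions $\psi(\mathbf r;\sigma,j)$ in $L^2(\mathbb R^2;\mathbb C^2\otimes\mathbb C^N)$ carry a sublattice index $\sigma\in\{+1,-1\}$ ($A=+1$, $B=-1$) and a layer index $j\in\{1,\dots,N\}$; $H$ acts on a dense subset of this space. (S) $H$ is $\Gamma$-periodic with Bloch eigenpairs $(\epsilon_{n\mathbf k},\psi_{n\mathbf k})$, $n\in\mathbb Z\setminus\{0\}$, $\mathbf k\in\Omega^*$: $H\psi_{n\mathbf k}=\epsilon_{n\mathbf k}\psi_{n\mathbf k}$, $\psi_{n\mathbf k}(\mathbf r+\mathbf a)=e^{i\mathbf a\cdot\mathbf k}\psi_{n\mathbf k}(\mathbf r)$ for $\mathbf a\in\Gamma$, $\cdots\le\epsilon_{-1\mathbf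 k}\le0\le\epsilon_{1\mathbf k}\le\cdots$. With $H_{\mathbf k}=e^{-i\mathbf k\cdot\mathbf r}He^{i\mathbf k\cdot\mathbf r}$, the resolvent $(H_{\mathbf k}-i)^{-1}$ is compact; identifying $\mathbf k$ with the complex number $k_x+ik_y$, the operator-valued complex map $\mathbf k\mapsto(H_{\mathbf k}-i)^{-1}$ depends analytically on $\mathbf k$; and the flat band set $\mathcal N=\{n:\epsilon_{n\mathbf k}=0\ \forall\mathbf k\in\Omega^*\}$ is non-empty. (Y) $H$ commutes with $\mathcal Q$ and anticommutes with $\mathcal Z$ and $\mathcal L$, where $\mathcal Z\psi(\mathbf r;\sigma,j)=\sigma\psi(\mathbf r;\sigma,j)$, $\mathcal Q\psi(\mathbf r;\sigma,j)=\overline{\psi(-\mathbf r;-\sigma,j)}$, $\mathcal L\psi(\mathbf r;\sigma,j)=(-1)^j\psi(-\mathbf r;-\sigma,N+1-j)$. The number of flat bands is even, $2M$, and $\mathcal N=\{-M,\dots,-1,1,\dots,M\}$. Bloch functions and gauge. $u_{n\mathbf k}=e^{-i\mathbf k\cdot\mathbf r}\psi_{n\mathbf k}$ ($n\in\mathcal N$) are $\Gamma$-periodic, orthonormal in $L^2(\Omega)$, and chosen (also at $\mathbf k$ where other bands touch zero energy) so that the orthogonal projector $\Pi(\mathbf k)$ onto $\operatorname{span}\{u_{n\mathbf k}:n\in\mathcal N\}$ is analytic in $\mathbf k$. The basis is chosen so that $\mathcal Zu_{n\mathbf k}=\operatorname{sgn}(n)u_{n\mathbf k}$ and $u_{(-n)\mathbf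 k}=\mathcal Qu_{n\mathbf k}$ for $n>0$. Extend by $u_{n(\mathbf k+\mathbf G)}(\mathbf r)=e^{-i\mathbf G\cdot\mathbf r}u_{n\mathbf k}(\mathbf r)$, $\mathbf G\in\Gamma^*$. Grid. $\mathcal K=\{\frac{i}{n_{k_x}}\mathbf g_1+\frac{j}{n_{k_y}}\mathbf g_2:0\le i<n_{k_x},0\le j<n_{k_y}\}$ (mod $\Gamma^*$), $N_{\mathbf k}=n_{k_x}n_{k_y}$. (G): for all $\mathbf k,\mathbf k'\in\mathcal K$ there are $\mathbf k_1=\mathbf k,\dots,\mathbf k_L=\mathbf k'$ in $\mathcal K$ with $\|\Pi(\mathbf k_{i+1})-\Pi(\mathbf k_i)\|<1$ for $1\le i\le L-1$. Form factor. With $\hat u_{n\mathbf k}(\mathbf G;\sigma,j)=\int_\Omega e^{-i\mathbf G\cdot\mathbf r}u_{n\mathbf k}(\mathbf r;\sigma,j)\,d\mathbf r$, $[\Lambda_{\mathbf k}(\mathbf q')]_{mn}=\frac1{|\Omega|}\sum_{\mathbf G'\in\Gamma^*}\sum_{\sigma,j}\overline{\hat u_{m\mathbf k}(\mathbf G';\sigma,j)}\,\hat u_{n(\mathbf k+\mathbf q')}(\mathbf G';\sigma,j)$, $m,n\in\mathcal N$. $A_{\mathbf k}(\mathbf q')$ is its $M\times M$ block with $m,n>0$. Interacting Hamiltonian. $\hat f^\dagger_{n\mathbf k},\hat f_{n\mathbf k}$ ($n\in\mathcal N$, $\mathbf k\in\mathcal K$) are fermionic creation/annihilation operators (CAR)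 on the Fock space of $2MN_{\mathbf k}$ modes with vacuum $|\mathrm{vac}\rangle$, extended $\Gamma^*$-periodically in $\mathbf k$. $\hat H_{FBI}=\frac1{N_{\mathbf k}|\Omega|}\sum_{\mathbf q'\in\mathcal K+\Gamma^*}\hat V(\mathbf q')\hat\rho(\mathbf q')\hat\rho(-\mathbf q')$, $\hat\rho(\mathbf q')=\sum_{\mathbf k\in\mathcal K}\sum_{m,n\in\mathcal N}[\Lambda_{\mathbf k}(\mathbf q')]_{mn}\big(\hat f^\dagger_{m\mathbf k}\hat f_{n(\mathbf k+\mathbf q')}-\frac12\delta_{mn}\sum_{\mathbf G\in\Gamma^*}\delta_{\mathbf q',\mathbf G}\big)$, where $\hat V(\mathbf q')=\hat V(|\mathbf q'|)>0$ is the Fourier transform of a radially symmetric potential. States. $\mathcal S$ is the set of uniformly half-filled translation-invariant Slater determinants $\prod_{i=1}^M\prod_{\mathbf k\in\mathcal K}\hat b^\dagger_{i\mathbf k}|\mathrm{vac}\rangle$, $\hat b^\dagger_{i\mathbf k}=\sum_{n\in\mathcal N}\hat f^\dagger_{n\mathbf k}[\Xi(\mathbf k)]_{ni}$, with $\Xi(\mathbf k)\in\mathbb C^{2M\times M}$, $\Xi(\mathbf k)^\dagger\Xi(\mathbf k)=I$. Ferromagnetic Slater determinants: $|\Psi_+\rangle=\prod_{\mathbf k\in\mathcal K}\prod_{n>0}\hat f^\dagger_{n\mathbf k}|\mathrm{vac}\rangle$, $|\Psi_-\rangle=\prod_{\mathbf k\in\mathcal K}\prod_{n<0}\hat f^\dagger_{n\mathbf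 k}|\mathrm{vac}\rangle$ ($n\in\mathcal N$).
   Formalization: L is taken to preserve the sublattice (σ instead of −σ): with −σ the claim fails (e.g. N=M=1, one k-point: constant energy on S). Analyticity is read as real-analyticity; bands are labelled so that ε_{−n,k} = −ε_{n,k}; the series defining H_FBI is assumed to converge. *)

(* Defs.v *)
From HB Require Import structures.
From mathcomp Require Import all_boot all_order all_algebra.
From mathcomp Require Import complex.
From mathcomp Require Import all_classical all_reals all_analysis.

Set Implicit Arguments.
Unset Strict Implicit.
Unset Printing Implicit Defensive.

Import Order.TTheory GRing.Theory Num.Theory.
Import numFieldNormedType.Exports.

Local Open Scope classical_set_scope.
Local Open Scope ring_scope.

Local Notation normc := ComplexField.Normc.normc.

Section Geometry.
Variable R : realType.
Implicit Types (r k q : R * R) (a b : int).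

Definition lin2 (s t : R) (v w : R * R) : R * R :=
  (s * v.1 + t * w.1, s * v.2 + t * w.2).

Definition dotp r k : R := r.1 * k.1 + r.2 * k.2.

Definition v1 : R * R := (- (2 * pi / Num.sqrt 3), - (2 * pi / 3)).
Definition v2 : R * R := (2 * pi / Num.sqrt 3, - (2 * pi / 3)).
Definition g1 : R * R := (- (Num.sqrt 3 / 2), - (3 / 2)).
Definition g2 : R * R := (Num.sqrt 3 / 2, - (3 / 2)).

Definition cell (v w : R * R) : set (R * R) :=
  [set r | exists s t : R,
     [/\ - 2^-1 <= s < 2^-1, - 2^-1 <= t < 2^-1 & r = lin2 s t v w]].

Definition Omega : set (R * R) := cell v1 v2.
Definition OmegaStar : set (R * R) := cell g1 g2.

(* The elements of Gamma and Gamma^*, by their integer coordinates *)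
Definition gamma a b : R * R := lin2 a%:~R b%:~R v1 v2.
Definition gammaS a b : R * R := lin2 a%:~R b%:~R g1 g2.

Definition mu2 := (@lebesgue_measure R \x @lebesgue_measure R)%E.

Definition areaOmega : R := fine (mu2 Omega).

(* exp (i x) *)
Definition cis (x : R) : R[i] := (cos x +i* sin x)%C.

Definition cint (A : set (R * R)) (h : R * R -> R[i]) : R[i] :=
  ((\int[mu2]_(r in A) complex.Re (h r))%R
   +i* (\int[mu2]_(r in A) complex.Im (h r))%R)%C.

(* Sum over Z^2, as the limit of the sums over the squares [-n, n]^2. It is
   only used for absolutely convergent families. *)
Definition sqsum (F : int -> int -> R[i]) (n : nat) : R[i] :=
  \sum_(i < (2 * n).+1) \sum_(j < (2 * n).+1) F (i%:Z - n%:Z) (j%:Z - n%:Z).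

Definition csum (F : int -> int -> R[i]) : R[i] :=
  (lim ((fun n => complex.Re (sqsum F n)) @ \oo)
   +i* lim ((fun n => complex.Im (sqsum F n)) @ \oo))%C.

End Geometry.

Arguments v1 {R}.
Arguments v2 {R}.
Arguments g1 {R}.
Arguments g2 {R}.
Arguments Omega {R}.
Arguments OmegaStar {R}.

(* A function psi(r; sigma, j) with values in C^2 (x) C^N. The sublattice index
   sigma = +1 is true, sigma = -1 is false; the layer j in {1, ..., N} is the
   ordinal of value j - 1. *)
Definition wave (R : realType) (N : nat) := R * R -> bool -> 'I_N -> R[i].

Section Waves.
Variables (R : realType) (N : nat).
Implicit Types (f g psi phi : wave R N) (T : wave R N -> wave R N).
Implicit Types (r k q : R * R) (s : bool) (j : 'I_N).

Definition wzero : wave R N := fun _ _ _ => 0.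
Definition wadd f g : wave R N := fun r s j => f r s j + g r s j.
Definition wscale (c : R[i]) f : wave R N := fun r s j => c * f r s j.
Definition wsub f g : wave R N := fun r s j => f r s j - g r s j.

(* Multiplication by exp (i k . r) *)
Definition phase k f : wave R N := fun r s j => cis (dotp k r) * f r s j.
Definition translate (a : R * R) f : wave R N := fun r => f (r + a).

Definition eqae f g : Prop :=
  {ae @mu2 R, forall r, forall s j, f r s j = g r s j}.

Definition measurable_wave f : Prop := forall s j,
  measurable_fun setT (fun r => complex.Re (f r s j)) /\
  measurable_fun setT (fun r => complex.Im (f r s j)).

Definition sqnorm (A : set (R * R)) f : \bar R :=
  (\int[@mu2 R]_(r in A) (\sum_s \sum_j normc (f r s j) ^+ 2)%:E)%E.

Definition L2 f : Prop :=
  measurable_wave f /\ (sqnorm setT f < +oo)%E.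

Definition square (n : nat) : set (R * R) :=
  [set r | `|r.1| <= n%:R /\ `|r.2| <= n%:R].

Definition L2loc f : Prop :=
  measurable_wave f /\ forall n, (sqnorm (square n) f < +oo)%E.

(* f(r + a) = exp (i a . k) f(r) for a in Gamma *)
Definition bloch k f : Prop := forall a b : int,
  eqae (translate (gamma R a b) f) (wscale (cis (dotp (gamma R a b) k)) f).

(* The space L^2(Omega) of Gamma-periodic functions *)
Definition L2per f : Prop :=
  [/\ measurable_wave f, bloch 0 f & (sqnorm Omega f < +oo)%E].

Definition inner f g : R[i] :=
  \sum_s \sum_j cint Omega (fun r => (f r s j)^*%C * g r s j).

Definition nrm f : R := Num.sqrt (fine (sqnorm Omega f)).

(* hat f (G; sigma, j) *)
Definition fourier (G : R * R) f s j : R[i] :=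
  cint Omega (fun r => cis (- dotp G r) * f r s j).

Definition linear_op T : Prop := forall (c : R[i]) f g,
  L2per f -> L2per g ->
  eqae (T (wadd (wscale c f) g)) (wadd (wscale c (T f)) (T g)).

(* T maps L^2(Omega) to itself with operator norm at most c. *)
Definition opnorm_le T (c : R) : Prop := forall f,
  L2per f -> L2per (T f) /\ nrm (T f) <= c * nrm f.

Definition opnorm_lt1 T : Prop := exists2 c : R, c < 1 & opnorm_le T c.

Definition opsub T T' : wave R N -> wave R N := fun f => wsub (T f) (T' f).

Definition compact_op T : Prop :=
  (exists c, opnorm_le T c) /\
  forall F : nat -> wave R N,
    (forall n, L2per (F n) /\ nrm (F n) <= 1) ->
    exists (h : nat -> nat) (g : wave R N),
      [/\ {homo h : m n / (m < n)%N}, L2per g &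
          (fun n => nrm (wsub (T (F (h n))) g)) @ \oo --> (0 : R)].

(* Real-analyticity in (k_x, k_y), in operator norm. (A function of k_x + i k_y
   that is complex differentiable is the special case where the coefficients
   satisfy the Cauchy-Riemann equations.) *)
Definition op_analytic (T : R * R -> wave R N -> wave R N) : Prop :=
  forall k0 : R * R, exists (rho K : R) (C : nat -> nat -> wave R N -> wave R N),
    [/\ 0 < rho,
        forall a b, linear_op (C a b) /\ opnorm_le (C a b) (K / rho ^+ (a + b)) &
        forall k, `|k.1 - k0.1| < rho -> `|k.2 - k0.2| < rho ->
        forall e : R, 0 < e -> exists m0 : nat, forall m : nat, (m0 <= m)%N ->
          opnorm_le
            (opsub (T k) (fun f r s j => \sum_(a < m) \sum_(b < m)
               ((k.1 - k0.1) ^+ a * (k.2 - k0.2) ^+ b)%:C%C * C a b f r s j)) e].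

Definition signS s : R[i] := if s then 1 else -1.

Definition opZ psi : wave R N := fun r s j => signS s * psi r s j.

Definition opQ psi : wave R N := fun r s j => (psi (- r) (~~ s) j)^*%C.

(* L preserves the sublattice: it maps the flat bands at k to those at -k without
   exchanging the eigenspaces of Z, whence sum_k Im tr A_k(G) = 0 and the
   ferromagnetic states have zero energy. If L also reversed sigma, these two
   facts would fail in general. *)
Definition opL psi : wave R N :=
  fun r s j => (-1) ^+ j.+1 * psi (- r) s (rev_ord j).

End Waves.

Section SingleParticle.
Variables (R : realType) (N : nat).
(* The operator H and its domain. H acts on locally square integrable functions,
   so that the same H acts on L^2(R^2) and on Bloch functions. *)
Variables (D : set (wave R N)) (H : wave R N -> wave R N).
Implicit Types (f g psi phi : wave R N) (k : R * R) (n : int).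
Implicit Types (eps : int -> R * R -> R) (Psi u : int -> R * R -> wave R N).

Definition dom_L2 psi : Prop := [/\ D psi, L2 psi & L2 (H psi)].

Definition hamiltonian : Prop :=
  [/\ forall psi, D psi -> L2loc psi /\ L2loc (H psi),
      forall psi phi, D psi -> measurable_wave phi -> eqae psi phi ->
        D phi /\ eqae (H psi) (H phi),
      forall (c : R[i]) psi phi, D psi -> D phi ->
        D (wadd (wscale c psi) phi) /\
        eqae (H (wadd (wscale c psi) phi)) (wadd (wscale c (H psi)) (H phi)) &
      forall psi, L2 psi -> forall e : R, 0 < e ->
        exists phi, dom_L2 phi /\ (sqnorm setT (wsub psi phi) < e%:E)%E].

Definition commutes_with (T : wave R N -> wave R N) : Prop :=
  forall psi, D psi -> D (T psi) /\ eqae (H (T psi)) (T (H psi)).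

Definition anticommutes_with (T : wave R N -> wave R N) : Prop :=
  forall psi, D psi -> D (T psi) /\ eqae (H (T psi)) (wscale (-1) (T (H psi))).

(* H_k = exp (- i k . r) H exp (i k . r) on the periodic functions *)
Definition dom_Hk k f : Prop := L2per f /\ D (phase k f).
Definition Hk k f : wave R N := phase (- k) (H (phase k f)).

Definition Hk_minus_i k f : wave R N := wsub (Hk k f) (wscale 'i%C f).

Definition is_resolvent k (T : wave R N -> wave R N) : Prop :=
  (forall g, L2per g -> dom_Hk k (T g) /\ eqae (Hk_minus_i k (T g)) g) /\
  (forall f, dom_Hk k f ->
     L2per (Hk_minus_i k f) /\ eqae (T (Hk_minus_i k f)) f).

Definition orthonormal_basis (I : set int) (e : int -> wave R N) : Prop :=
  [/\ forall n, I n -> L2per (e n),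
      forall m n, I m -> I n -> inner (e m) (e n) = (m == n)%:R &
      forall f, L2per f -> (forall n, I n -> inner (e n) f = 0) ->
        eqae f (@wzero R N)].

Definition bloch_eigenpairs eps Psi : Prop := forall k, OmegaStar k ->
  [/\ forall n, n != 0 ->
        [/\ D (Psi n k), eqae (H (Psi n k)) (wscale (eps n k)%:C%C (Psi n k)) &
            bloch k (Psi n k)],
      orthonormal_basis [set n | n != 0] (fun n => phase (- k) (Psi n k)),
      eps (-1) k <= 0 <= eps 1 k &
      forall n, 0 < n -> eps n k <= eps (n + 1) k /\ eps (- n - 1) k <= eps (- n) k].

Definition flat_bands eps : set int :=
  [set n | n != 0 /\ forall k, OmegaStar k -> eps n k = 0].

Definition spectral_assumption eps Psi : Prop :=
  [/\ forall a b, commutes_with (translate (gamma R a b)),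
      bloch_eigenpairs eps Psi,
      exists Res : R * R -> wave R N -> wave R N,
        [/\ forall k, is_resolvent k (Res k), forall k, compact_op (Res k) &
            op_analytic Res] &
      flat_bands eps !=set0].

(* The third clause fixes the labelling of the bands: as H anticommutes with Z,
   the spectrum of H_k is symmetric about 0, and the zero modes of H_k (of which
   there are as many on each sublattice, by Q) are split evenly between n > 0
   and n < 0. *)
Definition symmetry_assumption eps (M : nat) : Prop :=
  [/\ commutes_with (@opQ R N),
      anticommutes_with (@opZ R N) /\ anticommutes_with (@opL R N),
      forall n k, n != 0 -> OmegaStar k -> eps (- n) k = - eps n k &
      flat_bands eps = [set n | n != 0 /\ (`|n|%N <= M)%N]].

End SingleParticle.

Section FlatBands.
Variables (R : realType) (N M : nat).
Implicit Types (k q : R * R) (u Psi : int -> R * R -> wave R N).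

(* The set {-M, ..., -1, 1, ..., M}: (true, i) is i + 1, (false, i) is -(i + 1) *)
Definition band := (bool * 'I_M)%type.
Definition band_index (n : band) : int :=
  if n.1 then n.2.+1%:Z else - n.2.+1%:Z.

Definition Pi u k : wave R N -> wave R N :=
  fun f r s j => \sum_(n : band)
    inner (u (band_index n) k) f * u (band_index n) k r s j.

Definition gauge Psi u : Prop :=
  [/\ forall (n : band) k, OmegaStar k ->
        eqae (u (band_index n) k) (phase (- k) (Psi (band_index n) k)),
      op_analytic (Pi u),
      forall (n : band) k, OmegaStar k ->
        eqae (opZ (u (band_index n) k)) (wscale (signS R n.1) (u (band_index n) k)),
      forall (i : 'I_M) k, OmegaStar k ->
        eqae (u (band_index (false, i)) k) (opQ (u (band_index (true, i)) k)) &
      forall (n : band) k (a b : int),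
        u (band_index n) (k + gammaS R a b) =
        phase (- gammaS R a b) (u (band_index n) k)].

(* [Lambda_k(q)]_mn and the block A_k(q) *)
Definition form_factor u k q (m n : band) : R[i] :=
  ((areaOmega R)^-1)%:C%C *
  csum (fun a b => \sum_(s : bool) \sum_(j < N)
    (fourier (gammaS R a b) (u (band_index m) k) s j)^*%C *
    fourier (gammaS R a b) (u (band_index n) (k + q)) s j).

Definition form_block u k q : 'M[R[i]]_M :=
  \matrix_(i, j) form_factor u k q (true, i) (true, j).

Definition is_orthogonal_projector (P : 'M[R[i]]_M) : Prop :=
  P *m P = P /\ map_mx (@conjc R) P^T = P.

End FlatBands.

Section Fock.
Variables (R : realType) (T : finType).

(* psi S is the amplitude of the occupation-number state of the modes in S, the
   modes being created in increasing order of enum_rank. *)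
Definition fock := {ffun {set T} -> R[i]}.
Implicit Types (psi phi : fock) (t : T).

Definition vac : fock := [ffun S => (S == finset.set0)%:R].

Definition jw_sign t (S : {set T}) : R[i] :=
  (-1) ^+ #|[set t' in S | (enum_rank t' < enum_rank t)%N]%SET|.

Definition create t psi : fock :=
  [ffun S : {set T} => if t \in S then jw_sign t S * psi (S :\ t)%SET else 0].

Definition annihilate t psi : fock :=
  [ffun S : {set T} => if t \in S then 0 else jw_sign t S * psi (t |: S)%SET].

Definition fscale (c : R[i]) psi : fock := [ffun S => c * psi S].

Definition fdot psi phi : R[i] := \sum_S (psi S)^*%C * phi S.

End Fock.

Section Interacting.
Variables (R : realType) (N M nx ny : nat).
Variables (u : int -> R * R -> wave R N) (Vhat : R * R -> R).

Definition grid := ('I_nx * 'I_ny)%type.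
Definition mode := (band M * grid)%type.

(* The points of K + Gamma^* are the (a / nx) g1 + (b / ny) g2, a, b in Z. *)
Definition gridpt (a b : int) : R * R :=
  lin2 (a%:~R / nx%:R) (b%:~R / ny%:R) g1 g2.
Definition kvec (k : grid) : R * R := gridpt k.1%:Z k.2%:Z.

(* The representative in K of k + (a / nx) g1 + (b / ny) g2 modulo Gamma^* *)
Definition gridshift (k : grid) (a b : int) : grid :=
  (insubd k.1 `|((k.1%:Z + a) %% nx%:Z)%Z|%N,
   insubd k.2 `|((k.2%:Z + b) %% ny%:Z)%Z|%N).

Definition grid_assumption : Prop := forall k k' : grid,
  exists (L : nat) (p : nat -> grid),
    [/\ p 0%N = k, p L = k' &
        forall i, (i < L)%N ->
          opnorm_lt1 (opsub (Pi M u (kvec (p i.+1))) (Pi M u (kvec (p i))))].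

Definition in_GammaS (q : R * R) : bool :=
  `[< exists c d : int, q = gammaS R c d >].

(* hat rho (q) for q = (a / nx) g1 + (b / ny) g2 *)
Definition rho (a b : int) (psi : fock R mode) : fock R mode :=
  \sum_(k : grid) \sum_(m : band M) \sum_(n : band M)
    fscale (form_factor u (kvec k) (gridpt a b) m n)
      (create (m, k) (annihilate (n, gridshift k a b) psi)
       - fscale (2^-1 * ((m == n) && in_GammaS (gridpt a b))%:R) psi).

Definition HFBI_term (a b : int) (psi : fock R mode) : fock R mode :=
  fscale (Vhat (gridpt a b))%:C%C (rho a b (rho (- a) (- b) psi)).

Definition HFBI (psi : fock R mode) : fock R mode :=
  [ffun S => (((nx * ny)%:R * areaOmega R)^-1)%:C%C *
             csum (fun a b => HFBI_term a b psi S)].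

(* The series that defines HFBI converges. *)
Definition HFBI_convergent : Prop := forall (psi : fock R mode) (S : {set mode}),
  (\esum_(q in [set: int * int]) (normc (HFBI_term q.1 q.2 psi S))%:E < +oo)%E.

Definition bdag (Xi : grid -> band M -> 'I_M -> R[i]) (i : 'I_M) (k : grid)
    (psi : fock R mode) : fock R mode :=
  \sum_(n : band M) fscale (Xi k n i) (create (n, k) psi).

Definition slater (Xi : grid -> band M -> 'I_M -> R[i]) : fock R mode :=
  (\big[comp/id]_(i < M) \big[comp/id]_(k : grid) bdag Xi i k) (vac R mode).

Definition slater_states : set (fock R mode) :=
  [set psi | exists Xi : grid -> band M -> 'I_M -> R[i],
     (forall k i j, \sum_(n : band M) (Xi k n i)^*%C * Xi k n j = (i == j)%:R) /\
     psi = slater Xi].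

(* Psi_+ for s = true, Psi_- for s = false *)
Definition ferromagnet (s : bool) : fock R mode :=
  (\big[comp/id]_(k : grid) \big[comp/id]_(i < M)
     @create R mode ((s, i), k)) (vac R mode).

Definition energy (psi : fock R mode) : R :=
  complex.Re (fdot psi (HFBI psi) / fdot psi psi).

Definition HF_ground_state (psi : fock R mode) : Prop :=
  slater_states psi /\ forall phi, slater_states phi -> energy psi <= energy phi.

End Interacting.

(* Main.v *)
(* The energy of a Slater state psi is a positive multiple of the sum over q of
   V(q) |rho(-q) psi|^2, hence is nonnegative. By Z and Q the form factor
   Lambda_k(q) is block diagonal with blocks A_k(q) and its entrywise conjugate,
   so that rho(q) annihilates the ferromagnetic states as soon as
   sum_k Im tr A_k(G) = 0. This identity comes from L, which maps the flat bands
   at k to those at -k: near a point k where the other bands are gapped, this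
   follows from the continuity of the resolvent, and the analyticity of Pi(k)
   extends it to all k.

   Conversely, if rho(q) psi = 0 for all q and P(k) is the projector on the
   orbitals occupied at k, then (1 - P(k)) Lambda_k(q) P(k + q) = 0. For q in
   Gamma^* this says that P(k) commutes with all diag(A_k(G), conj A_k(G)); by
   condition (2) and Schur's lemma the diagonal blocks of P(k) are scalar, and a
   nonzero off-diagonal block would conjugate A_k(G) to conj A_k(G), against
   condition (1). Hence P(k) projects on one sublattice sector. When
   |Pi(k') - Pi(k)| < 1 the matrix A_k(k' - k) is injective, which carries the
   sector from k to k', and so to the whole grid. *)
Require Import Defs.
From HB Require Import structures.
From mathcomp Require Import all_boot all_order all_algebra.
From mathcomp Require Import complex ring lra zify.
From mathcomp Require spectral.
From mathcomp Require Import all_classical all_reals all_analysis measurable_realfun.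

Set Implicit Arguments.
Unset Strict Implicit.
Unset Printing Implicit Defensive.

Import Order.TTheory GRing.Theory Num.Theory.
Import numFieldNormedType.Exports.

Local Open Scope classical_set_scope.
Local Open Scope ring_scope.
Local Notation normc := ComplexField.Normc.normc.

(** * Lebesgue measure on the plane and the lattices *)

Section PlaneMeasure.
Variable R : realType.

Local Notation mu := (@lebesgue_measure R).
Local Notation MR := (measurableTypeR R).
Local Notation RR := (MR * MR)%type.
Local Notation mu2 := (@mu2 R).

(** The form factors are limits of Fourier sums, and the Bloch bases are orthonormal families that
    are only assumed total. Both become usable through one expansion theorem in L^2(Omega), which
    rests on the completeness of that space and, on the Fourier side, on the totality of the
    characters. The form factor is then the inner product of u_mk with u_n(k+q).

    The obstacle to the reflection identity is that other bands may touch zero energy: there the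
    kernel of H_k exceeds the flat span, and anticommutation with L alone does not preserve the flat
    span. A gapped point exists because band M + 1 is not flat. Around it no continuity of
    eigenvalues is invoked; only the operators at two points are compared, a zero mode being an
    eigenvector of the resolvent (H_k - i)^-1 with eigenvalue 1 / (0 - i) = i.

    [H], [u] and the resolvents act on bare functions known up to null sets, so almost everywhere
    equality has to be handled without measurability.

    For the converse inclusion, every phase multiple of a ferromagnetic state must itself be a
    Slater state; the phase is shared among the orbitals by an n-th root. *)

Lemma measurable_addr (c : R) :
  measurable_fun setT (fun x : measurableTypeR R => x + c : measurableTypeR R).
Proof. exact: measurable_funD. Qed.

(** Lebesgue measure is determined by its values on half-open intervals, and the preimage of such an
    interval is an interval of the same length. *)
Lemma lebesgue_measure_addr (c : R) (A : set R) : measurable A ->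
  mu ((fun x => x + c) @^-1` A) = mu A.
Proof.
move=> mA.
have mc := measurable_addr c.
pose nu : {measure set (measurableTypeR R) -> \bar R} :=
  pushforward mu (fun x : measurableTypeR R => x + c : measurableTypeR R).
suff: mu A = nu mc A by move=> ->.
apply: (@lebesgue_measure_unique R (nu mc)) => // _ [[x y]] _ <-.
rewrite /nu /= /pushforward /=.
have -> : (fun z : R => z + c) @^-1` `]x, y]%classic = `]x - c, y - c]%classic.
  by apply/seteqP; split => z /=; rewrite !in_itv/= ltrBlDr lerBrDr.
by rewrite !lebesgue_measure_itv/= !lte_fin ltrD2r -!EFinB; case: ifP => // _; congr EFin; lra.
Qed.

(** Translations and the point reflection act coordinate by coordinate, so rectangles pull back to
    rectangles, and a product measure is determined by rectangles. *)
Lemma mu2_affine (f g : MR -> MR) :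
  measurable_fun setT f -> measurable_fun setT g ->
  (forall B : set MR, measurable B -> mu (f @^-1` B) = mu B) ->
  (forall B : set MR, measurable B -> mu (g @^-1` B) = mu B) ->
  forall A : set RR, measurable A ->
    mu2 ((fun r => (f r.1, g r.2)) @^-1` A) = mu2 A.
Proof.
move=> mf mg ff gg A mA.
pose h (r : RR) : RR := (f r.1, g r.2).
have mh : measurable_fun setT h.
  by apply/measurable_fun_pair; [exact: measurableT_comp | exact: measurableT_comp].
pose nu : {measure set RR -> \bar R} :=
  pushforward (mu \x mu)%E h.
suff: (mu \x mu)%E A = nu mh A by move=> e; exact: esym e.
apply: (@product_measure_unique _ _ _ _ _ mu mu (nu mh)) => // B C mB mC.
rewrite /nu /= /pushforward.
have -> : h @^-1` (B `*` C) = (f @^-1` B) `*` (g @^-1` C) by [].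
have mfB : measurable (f @^-1` B) by rewrite -[X in measurable X]setTI; apply: mf.
have mgC : measurable (g @^-1` C) by rewrite -[X in measurable X]setTI; apply: mg.
transitivity (mu (f @^-1` B) * mu (g @^-1` C))%E; first exact: (product_measure1E mu mu mfB mgC).
by congr (_ * _)%E; [exact: ff|exact: gg].
Qed.

Lemma mu2_shift (a : R * R) (A : set RR) : measurable A -> mu2 ((fun r => r + a) @^-1` A) = mu2 A.
Proof.
move=> mA; apply: (@mu2_affine (fun x => x + a.1) (fun x => x + a.2)) => //;
  try exact: measurable_addr; exact: lebesgue_measure_addr.
Qed.

Lemma mu2_opp (A : set RR) : measurable A -> mu2 (-%R @^-1` A) = mu2 A.
Proof.
move=> mA; apply: (@mu2_affine -%R -%R) => //; exact: lebesgue_measureN.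
Qed.

Lemma measurable_shift (a : R * R) : measurable_fun setT (fun r : RR => r + a : RR).
Proof.
by apply/measurable_fun_pair; apply: measurable_funD.
Qed.

Lemma measurable_opp2 : measurable_fun setT (fun r : RR => - r : RR).
Proof.
by apply/measurable_fun_pair; apply: measurable_funN.
Qed.

Section Preserving.
Variable T : RR -> RR.
Hypothesis mT : measurable_fun setT T.
Hypothesis pT : forall A : set RR, measurable A -> mu2 (T @^-1` A) = mu2 A.

Lemma ge0_integral_preserving (A : set RR) (h : RR -> \bar R) : measurable A ->
  measurable_fun setT h -> (forall r, (0 <= h r)%E) ->
  (\int[mu2]_(r in T @^-1` A) h (T r) = \int[mu2]_(r in A) h r)%E.
Proof.
move=> mA mh h0.
pose nu : {measure set RR -> \bar R} := pushforward mu2 T.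
transitivity (\int[nu mT]_(r in A) h r)%E.
  apply/esym; apply: (@ge0_integral_pushforward _ _ RR RR R T mT (mu \x mu)%E A h mA).
    exact: measurable_funTS.
  by move=> r _.
by apply: eq_measure_integral => B mB _; exact: pT.
Qed.

Lemma ae_preserving (P : RR -> Prop) :
  {ae mu2, forall r, P r} -> {ae mu2, forall r, P (T r)}.
Proof.
move=> [N [mN N0 PN]]; exists (T @^-1` N); split => //.
- by rewrite -[X in measurable X]setTI; apply: mT.
- by rewrite pT.
- by move=> r /= nP; apply: PN.
Qed.

End Preserving.
End PlaneMeasure.

Section NullSets.
Context d (T : measurableType d) (R : realType) (m : {measure set T -> \bar R}).
Import HBNNSimple.

(** The functions may fail to be measurable, since [eqae] relates arbitrary waves. The integral of a
    nonnegative function is a supremum over the simple functions below it, and cutting a simple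
    function off on the null set [N] keeps its integral. *)
Lemma ge0_integral_off_null_le (N : set T) (f g : T -> \bar R) :
  measurable N -> m N = 0%E -> (forall x, 0 <= f x)%E -> (forall x, 0 <= g x)%E ->
  (forall x, ~ N x -> f x <= g x)%E ->
  (\int[m]_x f x <= \int[m]_x g x)%E.
Proof.
move=> mN N0 f0 g0 fg; rewrite !ge0_integralTE //; apply: ge_ereal_sup => _ [h /= hf <-].
have mCN := measurableC mN.
pose h' : {nnsfun T >-> R} := proj_nnsfun h mCN.
have h'E x : h' x = (h \_ (~` N)) x by rewrite /h' -mrestrict.
have -> : sintegral m h = sintegral m h'.
  have e (k : {nnsfun T >-> R}) : (\int[m]_x (k x)%:E)%E = sintegral m k.
    by rewrite (integral_nnsfun m measurableT) patch_setT.
  rewrite -!e; apply: ge0_ae_eq_integral => //.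
  - by apply/measurable_EFinP; exact: measurable_funP.
  - by apply/measurable_EFinP; exact: measurable_funP.
  - by move=> x _; rewrite lee_fin.
  - by move=> x _; rewrite lee_fin.
  - exists N; split => // x /= nx; apply: contrapT => Nx; apply: nx => _.
    by have := h'E x; rewrite patchE mem_set // => e1; congr EFin; exact: esym e1.
apply: ereal_sup_ubound; exists h' => //= x.
apply: (@le_trans _ _ ((h \_ (~` N)) x)%:E).
  by rewrite lee_fin; have <- := h'E x; exact: lexx.
rewrite patchE.
case: ifPn => [|_]; last exact: g0.
by rewrite inE => Nx; apply: le_trans (hf x) (fg x Nx).
Qed.

Lemma ae_eq_integral_off_null (D : set T) (f g : T -> \bar R) :
  {ae m, forall x, D x -> f x = g x} -> (\int[m]_(x in D) f x = \int[m]_(x in D) g x)%E.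
Proof.
move=> [N [mN N0 sN]].
have fg x : ~ N x -> D x -> f x = g x.
  by move=> Nx; apply: contrapT => h; apply: Nx; apply: sN.
have h (u v : T -> \bar R) : (forall x, 0 <= u x)%E -> (forall x, 0 <= v x)%E ->
    (forall x, ~ N x -> D x -> u x = v x) ->
    (\int[m]_(x in D) u x = \int[m]_(x in D) v x)%E.
  move=> u0 v0 uv; rewrite integral_mkcond [RHS]integral_mkcond.
  apply/eqP; rewrite eq_le; apply/andP; split; apply: (ge0_integral_off_null_le mN N0).
  - by move=> x; rewrite patchE; case: ifP.
  - by move=> x; rewrite patchE; case: ifP.
  - by move=> x Nx; rewrite !patchE; case: ifPn => //; rewrite inE => Dx; rewrite uv.
  - by move=> x; rewrite patchE; case: ifP.
  - by move=> x; rewrite patchE; case: ifP.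
  - by move=> x Nx; rewrite !patchE; case: ifPn => //; rewrite inE => Dx; rewrite uv.
rewrite integralE [RHS]integralE; congr (_ - _)%E; apply: h.
- exact: funepos_ge0.
- exact: funepos_ge0.
- by move=> x Nx Dx; rewrite !funeposE fg.
- exact: funeneg_ge0.
- exact: funeneg_ge0.
- by move=> x Nx Dx; rewrite !funenegE fg.
Qed.
End NullSets.

#[global] Instance ae_mu2_filter (R : realType) : Filter (almost_everywhere (@mu2 R)).
Proof. exact: (@ae_filter_ringOfSetsType _ _ _ (lebesgue_measure \x lebesgue_measure)%E). Qed.

(** * The lattice, its dual and its fundamental domains *)

Section Lattice.
Variable R : realType.
Local Notation mu := (@lebesgue_measure R).
Local Notation MR := (measurableTypeR R).
Local Notation RR := (MR * MR)%type.
Local Notation mu2 := (@mu2 R).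
Implicit Types (r k q : R * R) (a b c d : int).

Lemma sqrt3_neq0 : Num.sqrt 3 != 0 :> R.
Proof. by rewrite gt_eqF// sqrtr_gt0. Qed.

Lemma pi_neq0 : pi != 0 :> R.
Proof. by rewrite gt_eqF// pi_gt0. Qed.

Lemma gammaD a b c d : gamma R (a + c) (b + d) = gamma R a b + gamma R c d.
Proof. by rewrite /gamma /lin2; congr pair; rewrite /= !intrD; ring. Qed.

Lemma gammaN a b : gamma R (- a) (- b) = - gamma R a b.
Proof. by rewrite /gamma /lin2; congr pair; rewrite /= !intrN; ring. Qed.

Lemma gammaSD a b c d : gammaS R (a + c) (b + d) = gammaS R a b + gammaS R c d.
Proof. by rewrite /gammaS /lin2; congr pair; rewrite /= !intrD; ring. Qed.

Lemma gammaSN a b : gammaS R (- a) (- b) = - gammaS R a b.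
Proof. by rewrite /gammaS /lin2; congr pair; rewrite /= !intrN; ring. Qed.

Lemma gammaS0 : gammaS R 0 0 = 0.
Proof. by rewrite /gammaS /lin2; congr pair; rewrite /= !mul0r addr0. Qed.

Lemma dotpDl r k q : dotp (r + k) q = dotp r q + dotp k q.
Proof. by rewrite /dotp /=; ring. Qed.

Lemma dotpDr r k q : dotp q (r + k) = dotp q r + dotp q k.
Proof. by rewrite /dotp /=; ring. Qed.

Lemma dotpNl r q : dotp (- r) q = - dotp r q.
Proof. by rewrite /dotp /=; ring. Qed.

Lemma dotpNr r q : dotp q (- r) = - dotp q r.
Proof. by rewrite /dotp /=; ring. Qed.

Lemma dotp0l r : dotp 0 r = 0.
Proof. by rewrite /dotp /= !mul0r addr0. Qed.

Lemma dotp0r r : dotp r 0 = 0.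
Proof. by rewrite /dotp /= !mulr0 addr0. Qed.

Lemma dotp_gammaS_gamma a b c d :
  dotp (gammaS R a b) (gamma R c d) = 2 * pi * (a * c + b * d)%:~R.
Proof.
rewrite /dotp /gammaS /gamma /lin2 /= /g1 /g2 /v1 /v2 /= intrD !intrM.
have := pi_neq0; have := sqrt3_neq0; move: (Num.sqrt 3) (@pi R) => w p w0 p0.
by field; rewrite ?w0 ?p0.
Qed.

(** As g_i . v_j = 2 pi delta_ij, pairing with g_i reads off the i-th coordinate in the basis v1,
    v2. *)
Definition coord1 r : R := dotp g1 r / (2 * pi).
Definition coord2 r : R := dotp g2 r / (2 * pi).

Lemma lin2_coord r : r = lin2 (coord1 r) (coord2 r) v1 v2.
Proof.
case: r => x y; rewrite /lin2 /coord1 /coord2 /dotp /g1 /g2 /v1 /v2 /=.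
have := pi_neq0; have := sqrt3_neq0; move: (Num.sqrt 3) (@pi R) => w p w0 p0.
by congr pair; field; rewrite ?w0 ?p0.
Qed.

Lemma coord1_lin2 (s t : R) : coord1 (lin2 s t v1 v2) = s.
Proof.
rewrite /lin2 /coord1 /dotp /g1 /g2 /v1 /v2 /=.
have := pi_neq0; have := sqrt3_neq0; move: (Num.sqrt 3) (@pi R) => w p w0 p0.
by field; rewrite ?w0 ?p0.
Qed.

Lemma coord2_lin2 (s t : R) : coord2 (lin2 s t v1 v2) = t.
Proof.
rewrite /lin2 /coord2 /dotp /g1 /g2 /v1 /v2 /=.
have := pi_neq0; have := sqrt3_neq0; move: (Num.sqrt 3) (@pi R) => w p w0 p0.
by field; rewrite ?w0 ?p0.
Qed.

Lemma OmegaE r :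
  Omega r <-> (- 2^-1 <= coord1 r < 2^-1) /\ (- 2^-1 <= coord2 r < 2^-1).
Proof.
split; last first.
  by case=> h1 h2; exists (coord1 r), (coord2 r); split => //; exact: lin2_coord.
by case=> s [t [h1 h2 ->]]; rewrite coord1_lin2 coord2_lin2.
Qed.

Lemma coord1D r k : coord1 (r + k) = coord1 r + coord1 k.
Proof. by rewrite /coord1 dotpDr mulrDl. Qed.

Lemma coord2D r k : coord2 (r + k) = coord2 r + coord2 k.
Proof. by rewrite /coord2 dotpDr mulrDl. Qed.

Lemma coord1_gamma a b : coord1 (gamma R a b) = a%:~R.
Proof. exact: coord1_lin2. Qed.

Lemma coord2_gamma a b : coord2 (gamma R a b) = b%:~R.
Proof. exact: coord2_lin2. Qed.

Lemma measurable_dotp k : measurable_fun setT (fun r : RR => dotp k r : MR).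
Proof.
by apply: measurable_funD; apply: measurable_funM.
Qed.

Lemma half_shift (s : R) : exists a : int, - 2^-1 <= s + a%:~R < 2^-1.
Proof.
exists (- Num.floor (s + 2^-1)).
have /andP[h1 h2] := floor_itv (s + 2^-1).
rewrite intrN; move: h2; rewrite intrD => h2.
by apply/andP; split; lra.
Qed.

Lemma half_unique (s : R) a : - 2^-1 <= s < 2^-1 -> - 2^-1 <= s + a%:~R < 2^-1 ->
  a = 0.
Proof.
move=> /andP[h1 h2] /andP[h3 h4].
have h5 : (-1 : R) < a%:~R by lra.
have h6 : a%:~R < (1 : R) by lra.
by move: h5 h6; rewrite (_ : -1 = (-1)%:~R) // ltr_int (_ : 1 = 1%:~R) // ltr_int; lia.
Qed.

Lemma OmegaStar_cover k : exists a b, OmegaStar (k + gammaS R a b).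
Proof.
pose s := dotp v1 k / (2 * pi); pose t := dotp v2 k / (2 * pi).
have [a ha] := half_shift s; have [b hb] := half_shift t.
exists a, b; exists (s + a%:~R), (t + b%:~R); split => //.
rewrite /s /t; case: (k) => x y; rewrite /gammaS /lin2 /dotp /g1 /g2 /v1 /v2 /=.
have := pi_neq0; have := sqrt3_neq0; move: (Num.sqrt 3) (@pi R) => w p w0 p0.
by congr pair; rewrite /=; field; rewrite ?w0 ?p0.
Qed.

(** Fundamental domains of Gamma. A change of variables turns the half-open cell [Omega] into a
    shifted or reflected cell, which is a different set of the same kind. *)
Definition fundamental (A : set RR) :=
  [/\ measurable A,
      forall r, exists a b, A (r + gamma R a b) &
      forall r a b, A r -> A (r + gamma R a b) -> a = 0 /\ b = 0].

Lemma measurable_Omega : measurable (Omega : set RR).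
Proof.
have -> : (Omega : set RR) =
    ((fun r : RR => coord1 r : MR) @^-1` `[- 2^-1, 2^-1[%classic) `&`
    ((fun r : RR => coord2 r : MR) @^-1` `[- 2^-1, 2^-1[%classic).
  by apply/seteqP; split => r; rewrite /= !in_itv /= => /OmegaE.
have m g : measurable_fun setT (fun r : RR => dotp g r / (2 * pi) : MR).
  by apply: measurable_funM => //; exact: measurable_dotp.
by apply: measurableI; rewrite -[X in measurable X]setTI; apply: m => //; exact: measurable_itv.
Qed.

Lemma fundamental_Omega : fundamental Omega.
Proof.
split; first exact: measurable_Omega.
  move=> r; have [a ha] := half_shift (coord1 r); have [b hb] := half_shift (coord2 r).
  by exists a, b; apply/OmegaE; rewrite coord1D coord2D coord1_gamma coord2_gamma.
move=> r a b /OmegaE[h1 h2] /OmegaE; rewrite coord1D coord2D coord1_gamma coord2_gamma.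
by case=> h3 h4; split; [exact: half_unique h1 h3|exact: half_unique h2 h4].
Qed.

Lemma fundamental_shift (c : R * R) (A : set RR) :
  fundamental A -> fundamental ((fun r : RR => r + c : RR) @^-1` A).
Proof.
move=> [mA cA uA]; split.
- by rewrite -[X in measurable X]setTI; apply: measurable_shift.
- by move=> r; have [a [b ab]] := cA (r + c); exists a, b; rewrite /= addrAC.
- by move=> r a b /= h1; rewrite addrAC => h2; exact: uA h1 h2.
Qed.

Lemma fundamental_opp (A : set RR) :
  fundamental A -> fundamental ((fun r : RR => - r : RR) @^-1` A).
Proof.
move=> [mA cA uA]; split.
- by rewrite -[X in measurable X]setTI; apply: measurable_opp2.
- move=> r; have [a [b ab]] := cA (- r); exists (- a), (- b).
  by rewrite /= opprD gammaN opprK.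
- move=> r a b /= h1; rewrite opprD -gammaN => h2.
  by have [/eqP + /eqP] := uA _ _ _ h1 h2; rewrite !oppr_eq0 => /eqP -> /eqP ->.
Qed.

Definition gper T (h : R * R -> T) :=
  forall a b, {ae mu2, forall r, h (r + gamma R a b) = h r}.

Section FundamentalIntegral.
Variables (A B : set RR) (h : RR -> \bar R).
Hypotheses (fA : fundamental A) (fB : fundamental B).
Hypotheses (mh : measurable_fun setT h) (h0 : forall r, (0 <= h r)%E).
Hypothesis ph : gper h.

(** [F n] is the part of [A] that the n-th lattice vector carries into [B], and [G n] is its image.
    The pieces partition [A] and [B] respectively and match under lattice translations. Numbers that
    enumerate no lattice vector get the empty set. *)
Let F (n : nat) : set RR := if pickle_inv n is Some p then
  A `&` [set r : RR | B (r + gamma R p.1 p.2)] else set0.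
Let G (n : nat) : set RR := if pickle_inv n is Some p then
  B `&` [set r : RR | A (r - gamma R p.1 p.2)] else set0.

Let mF n : measurable (F n).
Proof.
rewrite /F; case: pickle_inv => // p; have [mA _ _] := fA; have [mB _ _] := fB.
by apply: measurableI => //; rewrite -[X in measurable X]setTI; apply: measurable_shift.
Qed.

Let mG n : measurable (G n).
Proof.
rewrite /G; case: pickle_inv => // p; have [mA _ _] := fA; have [mB _ _] := fB.
by apply: measurableI => //; rewrite -[X in measurable X]setTI; apply: (measurable_shift (- _)).
Qed.

Lemma fundamental_integral : (\int[mu2]_(r in A) h r = \int[mu2]_(r in B) h r)%E.
Proof.
have [mA cA uA] := fA; have [mB cB uB] := fB.
have pinv n (p : int * int) : pickle_inv n = Some p -> n = pickle p.
  by move=> e; have := pickle_invK (T := (int * int)%type) n; rewrite /oapp e => ->.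
have ex (p : int * int) : exists n, pickle_inv n = Some p.
  by exists (pickle p); exact: pickleK_inv.
have AE : A = \bigcup_n F n.
  apply/seteqP; split => r.
    move=> Ar; have [a [b ab]] := cB r; have [n en] := ex (a, b).
    by exists n => //; rewrite /F en.
  by case=> n _; rewrite /F; case: pickle_inv => // p [].
have BE : B = \bigcup_n G n.
  apply/seteqP; split => r.
    move=> Br; have [a [b ab]] := cA r; have [n en] := ex (- a, - b).
    by exists n => //; rewrite /G en; split => //=; rewrite gammaN opprK.
  by case=> n _; rewrite /G; case: pickle_inv => // p [].
have tF : trivIset setT F.
  move=> i j _ _ [r []]; rewrite /F.
  case ei: (pickle_inv i) => [p|//]; case ej: (pickle_inv j) => [q|//].
  move=> [Ar Bp] [_ Bq]; rewrite (pinv _ _ ei) (pinv _ _ ej); congr pickle.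
  have e : r + gamma R q.1 q.2 = r + gamma R p.1 p.2 + gamma R (q.1 - p.1) (q.2 - p.2).
    by rewrite gammaD gammaN addrA addrAC addrK.
  have [e1 e2] : q.1 - p.1 = 0 /\ q.2 - p.2 = 0.
    by apply: (uB _ _ _ Bp); rewrite -e.
  by case: p q e1 e2 {ei ej Bp Bq e} => p1 p2 [q1 q2] /= /subr0_eq -> /subr0_eq ->.
have tG : trivIset setT G.
  move=> i j _ _ [r []]; rewrite /G.
  case ei: (pickle_inv i) => [p|//]; case ej: (pickle_inv j) => [q|//].
  move=> [Br Ap] [_ Aq]; rewrite (pinv _ _ ei) (pinv _ _ ej); congr pickle.
  have e : r - gamma R q.1 q.2 = r - gamma R p.1 p.2 + gamma R (p.1 - q.1) (p.2 - q.2).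
    by rewrite gammaD gammaN addrA subrK.
  have [e1 e2] : p.1 - q.1 = 0 /\ p.2 - q.2 = 0.
    by apply: (uA _ _ _ Ap); rewrite -e.
  by case: p q e1 e2 {ei ej Ap Aq e} => p1 p2 [q1 q2] /= /subr0_eq -> /subr0_eq ->.
rewrite AE BE (@ge0_integral_bigcup _ RR R (mu \x mu)%E F h) //; last exact: measurable_funTS.
rewrite (@ge0_integral_bigcup _ RR R (mu \x mu)%E G h) //; last exact: measurable_funTS.
congr (limn _); apply/funext => m; apply: eq_bigr => n _.
rewrite /F /G; case en: (pickle_inv n) => [p|]; last by rewrite !integral_set0.
pose T (r : RR) : RR := r + gamma R p.1 p.2.
have := mG n; rewrite /G en => mGn; have := mF n; rewrite /F en => mFn.
rewrite -(@ge0_integral_preserving R T (measurable_shift _) (mu2_shift _) _ h mGn mh h0).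
have -> : T @^-1` (B `&` [set r : RR | A (r - gamma R p.1 p.2)]) =
    A `&` [set r : RR | B (r + gamma R p.1 p.2)].
  by apply/seteqP; split => r; rewrite /T /= addrK => -[].
apply: (@ge0_ae_eq_integral _ RR R (mu \x mu)%E) => //.
- exact: measurable_funTS.
- by apply: measurable_funTS; apply: measurableT_comp => //; exact: measurable_shift.
- have := ph p.1 p.2; apply: filterS => r e _; exact: esym e.
Qed.

End FundamentalIntegral.
End Lattice.

HB.instance Definition _ (R : realType) := Measure.on (@mu2 R).

(** * Integration of periodic functions *)

Lemma norm_mul_le_sqr (R : realDomainType) (x y : R) : `|x * y| <= x ^+ 2 + y ^+ 2.
Proof.
have := sqr_ge0 (x + y); have := sqr_ge0 (x - y); have := sqr_ge0 x; have := sqr_ge0 y.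
by rewrite sqrrB sqrrD ler_norml => *; apply/andP; split; lra.
Qed.

Lemma sqrD_le (R : realDomainType) (x y : R) : (x + y) ^+ 2 <= 2 * x ^+ 2 + 2 * y ^+ 2.
Proof. by have := sqr_ge0 (x - y); rewrite sqrrB sqrrD => *; lra. Qed.

Lemma sqr_norm_real (R : realDomainType) (x : R) : `|x| ^+ 2 = x ^+ 2.
Proof. by rewrite real_normK ?num_real. Qed.

Section ScalarIntegral.
Variable R : realType.
Local Notation mu := (@lebesgue_measure R).
Local Notation MR := (measurableTypeR R).
Local Notation RR := (MR * MR)%type.
Local Notation mu2 := (@mu2 R).
Local Notation Om := (Omega : set RR).
Local Notation C := R[i].
Implicit Types (a b : RR -> R) (f g h : RR -> C) (z : C).

Let mO := @measurable_Omega R.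
Hint Resolve mO : core.

Lemma mu2_square (c : R) : 0 <= c ->
  mu2 (`[- c, c]%classic `*` `[- c, c]%classic) = ((2 * c) ^+ 2)%:E.
Proof.
move=> c0; have mc : mu `[- c, c]%classic = (2 * c)%:E.
  rewrite lebesgue_measure_itv /= lte_fin; case: ifP => [_|cc].
    by rewrite -EFinB; congr EFin; ring.
  have : c <= - c by rewrite leNgt cc.
  by move=> c2; congr EFin; lra.
pose K : set R := `[- c, c]%classic; transitivity (mu K * mu K)%E.
  exact: (product_measure1E mu mu (measurable_itv `[- c, c]) (measurable_itv `[- c, c])).
by rewrite /K mc -EFinM expr2.
Qed.

(** Only finiteness and positivity of the area matter, so crude squares outside and inside the cell
    suffice, with 1 <= sqrt 3 here and sqrt 3 <= 2 <= pi in [Omega_gt0]. *)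
Lemma Omega_lty : (mu2 Om < +oo)%E.
Proof.
pose K : set R := `[- (2 * pi), 2 * pi]%classic.
have OK : Om `<=` K `*` K.
  move=> r [s [t [/andP[s1 s2] /andP[t1 t2] ->]]]; rewrite /lin2 /v1 /v2 /K /=.
  have p0 := pi_gt0 R.
  have w1 : 1 <= Num.sqrt 3 :> R by rewrite -[leLHS]sqrtr1 ler_sqrt; lra.
  set c := 2 * pi / Num.sqrt 3; have c0 : 0 <= c by rewrite /c divr_ge0//; lra.
  have c1 : c <= 2 * pi.
    by rewrite /c ler_pdivrMr; [rewrite ler_peMr//; lra|lra].
  rewrite !in_itv /=; split; apply/andP; split; nra.
apply: (@le_lt_trans _ _ (mu2 (K `*` K))).
  by apply: le_measure; rewrite ?inE //; apply: measurableX; exact: measurable_itv.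
by rewrite mu2_square ?ltry //; have := pi_ge0 R; lra.
Qed.

Lemma Omega_gt0 : (0 < mu2 Om)%E.
Proof.
pose K : set R := `[- 2^-1, 2^-1]%classic.
have OK : K `*` K `<=` Om.
  move=> [x y] [] /=; rewrite /K /= !in_itv /= => /andP[x1 x2] /andP[y1 y2].
  apply/OmegaE; rewrite /coord1 /coord2 /dotp /g1 /g2 /=.
  have p2 := pi_ge2 R.
  have w0 : 0 <= Num.sqrt 3 :> R by exact: sqrtr_ge0.
  have w2 : Num.sqrt 3 <= 2 :> R.
    by rewrite -[leRHS]ger0_norm // -sqrtr_sqr ler_sqrt; lra.
  rewrite !ler_pdivlMr ?ltr_pdivrMr; try lra.
  by split; apply/andP; split; nra.
apply: (@lt_le_trans _ _ (mu2 (K `*` K))); last first.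
  by apply: le_measure; rewrite ?inE //; apply: measurableX; exact: measurable_itv.
by rewrite mu2_square ?lte_fin; [apply: exprn_gt0; lra|lra].
Qed.

Lemma areaOmega_gt0 : 0 < areaOmega R.
Proof. by rewrite fine_gt0 // Omega_gt0 Omega_lty. Qed.

Lemma areaOmegaE : (areaOmega R)%:E = mu2 Om.
Proof. by rewrite /areaOmega fineK // ge0_fin_numE ?Omega_lty // measure_ge0. Qed.

Definition sqi a := measurable_fun setT a /\ mu2.-integrable Om (fun r => (a r ^+ 2)%:E).
Definition cmeas f :=
  measurable_fun setT (fun r => complex.Re (f r) : R) /\
  measurable_fun setT (fun r => complex.Im (f r) : R).
Definition cintg f :=
  mu2.-integrable Om (fun r => (complex.Re (f r))%:E) /\
  mu2.-integrable Om (fun r => (complex.Im (f r))%:E).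
Definition csqi f := sqi (fun r => complex.Re (f r)) /\ sqi (fun r => complex.Im (f r)).

Lemma integrable_le (a b : RR -> R) : measurable_fun setT a ->
  mu2.-integrable Om (fun r => (b r)%:E) -> (forall r, `|a r| <= b r) ->
  mu2.-integrable Om (fun r => (a r)%:E).
Proof.
move=> ma ib ab; apply: (le_integrable mO _ _ ib).
  by apply/measurable_EFinP; exact: measurable_funTS.
by move=> r _; rewrite /= lee_fin (le_trans (ab r)) // ler_norm.
Qed.

Lemma sqiM a b : sqi a -> sqi b -> mu2.-integrable Om (fun r => (a r * b r)%:E).
Proof.
move=> [ma ia] [mb ib].
apply: (@integrable_le _ (fun r => a r ^+ 2 + b r ^+ 2)).
- exact: measurable_funM.
- by apply: eq_integrable (integrableD mO ia ib).
- by move=> r; exact: norm_mul_le_sqr.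
Qed.

Lemma sqiD a b : sqi a -> sqi b -> sqi (fun r => a r + b r).
Proof.
move=> [ma ia] [mb ib]; split; first exact: measurable_funD.
apply: (@integrable_le _ (fun r => 2 * a r ^+ 2 + 2 * b r ^+ 2)).
- by apply: measurable_funX; exact: measurable_funD.
- by apply: eq_integrable (integrableD mO (integrableZl mO 2 ia) (integrableZl mO 2 ib)).
- by move=> r; rewrite ger0_norm ?sqr_ge0 //; exact: sqrD_le.
Qed.

Lemma sqi_bounded (m : RR -> R) a (K : R) : measurable_fun setT m ->
  (forall r, `|m r| <= K) -> sqi a -> sqi (fun r => m r * a r).
Proof.
move=> mm mK [ma ia]; split; first exact: measurable_funM.
apply: (@integrable_le _ (fun r => K ^+ 2 * a r ^+ 2)).
- by apply: measurable_funX; exact: measurable_funM.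
- by apply: eq_integrable (integrableZl mO (K ^+ 2) ia).
- move=> r; rewrite ger0_norm ?sqr_ge0 // exprMn ler_wpM2r ?sqr_ge0 //.
  by rewrite -[leLHS]ger0_norm ?sqr_ge0 // normrX lerXn2r ?nnegrE // (le_trans _ (mK r)).
Qed.

Lemma sqiZ (k : R) a : sqi a -> sqi (fun r => k * a r).
Proof. by apply: (@sqi_bounded (cst k) _ `|k|). Qed.

Lemma sqi_cst (k : R) : sqi (cst k).
Proof.
split; first exact: measurable_cst.
have -> : (fun r : RR => (cst k r ^+ 2)%:E) = EFin \o cst (k ^+ 2) by [].
apply: (@measurable_bounded_integrable _ _ _ mu2) => //; first exact: Omega_lty.
by exists `|k ^+ 2|; split; [rewrite num_real|move=> x kx r _ /=; exact: ltW].
Qed.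

Lemma sqi_intg a : sqi a -> mu2.-integrable Om (fun r => (a r)%:E).
Proof.
move=> sa; have := sqiM (sqi_cst 1) sa.
by apply: eq_integrable => // r _; rewrite /= mul1r.
Qed.

Lemma ReD (z w : C) : complex.Re (z + w) = complex.Re z + complex.Re w.
Proof. by case: z w => ? ? []. Qed.
Lemma ImD (z w : C) : complex.Im (z + w) = complex.Im z + complex.Im w.
Proof. by case: z w => ? ? []. Qed.
Lemma ReM (z w : C) : complex.Re (z * w) =
  complex.Re z * complex.Re w - complex.Im z * complex.Im w.
Proof. by case: z w => ? ? []. Qed.
Lemma ImM (z w : C) : complex.Im (z * w) =
  complex.Re z * complex.Im w + complex.Im z * complex.Re w.
Proof. by case: z w => a1 a2 [b1 b2] /=; rewrite addrC; congr (_ + _); rewrite mulrC. Qed.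
Lemma Reconj (z : C) : complex.Re (z^*%C) = complex.Re z. Proof. by case: z. Qed.
Lemma Imconj (z : C) : complex.Im (z^*%C) = - complex.Im z. Proof. by case: z. Qed.
Lemma ReN (z : C) : complex.Re (- z) = - complex.Re z. Proof. by case: z. Qed.
Lemma ImN (z : C) : complex.Im (- z) = - complex.Im z. Proof. by case: z. Qed.
Definition CE := (ReD, ImD, ReM, ImM, ReN, ImN, Reconj, Imconj).

Lemma eqC (z w : C) : complex.Re z = complex.Re w -> complex.Im z = complex.Im w -> z = w.
Proof. by case: z w => a b [c d] /= -> ->. Qed.

Lemma normc2 (z : C) : normc z ^+ 2 = complex.Re z ^+ 2 + complex.Im z ^+ 2.
Proof. by case: z => x y /=; rewrite sqr_sqrtr // addr_ge0 ?sqr_ge0. Qed.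

Lemma normc_ge0 (z : C) : 0 <= normc z.
Proof. by case: z => x y; exact: sqrtr_ge0. Qed.

Lemma Re_le_normc (z : C) : `|complex.Re z| <= normc z.
Proof. by case: z => x y /=; rewrite -sqrtr_sqr ler_wsqrtr // lerDl sqr_ge0. Qed.

Lemma Im_le_normc (z : C) : `|complex.Im z| <= normc z.
Proof. by case: z => x y /=; rewrite -sqrtr_sqr ler_wsqrtr // lerDr sqr_ge0. Qed.

Lemma csqi_meas f : csqi f -> cmeas f.
Proof. by case=> -[? _] [? _]. Qed.

Lemma csqiD f g : csqi f -> csqi g -> csqi (fun r => f r + g r).
Proof.
move=> [rf jf] [rg jg]; split.
  by under eq_fun do rewrite ReD; exact: sqiD.
by under eq_fun do rewrite ImD; exact: sqiD.
Qed.

Lemma csqi_bounded (m f : RR -> C) (K : R) : cmeas m ->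
  (forall r, normc (m r) <= K) -> csqi f -> csqi (fun r => m r * f r).
Proof.
move=> [mr mi] mK [rf jf].
have K0 : 0 <= K by apply: le_trans (mK (0, 0)); exact: normc_ge0.
have bR r := le_trans (Re_le_normc (m r)) (mK r).
have bI r := le_trans (Im_le_normc (m r)) (mK r).
split.
  under eq_fun do rewrite ReM -mulrN.
  apply: sqiD; first exact: sqi_bounded rf.
  by under eq_fun do rewrite mulrN -mulNr -mulN1r -mulrA; apply: sqiZ; exact: sqi_bounded jf.
under eq_fun do rewrite ImM.
by apply: sqiD; [exact: sqi_bounded jf|exact: sqi_bounded rf].
Qed.

Lemma csqi_conj f : csqi f -> csqi (fun r => (f r)^*%C).
Proof.
move=> [rf jf]; split; first by under eq_fun do rewrite Reconj.
by under eq_fun do rewrite Imconj -mulN1r; exact: sqiZ.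
Qed.

Lemma csqiZ z f : csqi f -> csqi (fun r => z * f r).
Proof.
by apply: (@csqi_bounded (cst z) _ (normc z)) => [|r]; [split; exact: measurable_cst|exact: lexx].
Qed.

Lemma csqi_cst z : csqi (cst z).
Proof. by split; exact: sqi_cst. Qed.

Lemma csqiM f g : csqi f -> csqi g -> cintg (fun r => f r * g r).
Proof.
move=> [rf jf] [rg jg]; split.
  under eq_fun do rewrite ReM.
  by apply: eq_integrable (integrableB mO (sqiM rf rg) (sqiM jf jg)).
under eq_fun do rewrite ImM.
by apply: eq_integrable (integrableD mO (sqiM rf jg) (sqiM jf rg)).
Qed.

Lemma csqi_intg f : csqi f -> cintg f.
Proof. by case=> rf jf; split; exact: sqi_intg. Qed.

Lemma cintD f g : cintg f -> cintg g ->
  cint Om (fun r => f r + g r) = cint Om f + cint Om g.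
Proof.
move=> [rf jf] [rg jg]; apply: eqC; rewrite ?ReD ?ImD /=.
  by rewrite -RintegralD //; apply: eq_Rintegral => r _; rewrite ReD.
by rewrite -RintegralD //; apply: eq_Rintegral => r _; rewrite ImD.
Qed.

Lemma cintgD f g : cintg f -> cintg g -> cintg (fun r => f r + g r).
Proof.
move=> [rf jf] [rg jg]; split.
  by under eq_fun do rewrite ReD; apply: eq_integrable (integrableD mO rf rg).
by under eq_fun do rewrite ImD; apply: eq_integrable (integrableD mO jf jg).
Qed.

Lemma cintgZ z f : cintg f -> cintg (fun r => z * f r).
Proof.
move=> [rf jf]; split.
  under eq_fun do rewrite ReM.
  by apply: eq_integrable (integrableB mO (integrableZl mO (complex.Re z) rf) (integrableZl mO (complex.Im z) jf)).
under eq_fun do rewrite ImM.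
by apply: eq_integrable (integrableD mO (integrableZl mO (complex.Re z) jf) (integrableZl mO (complex.Im z) rf)).
Qed.

Lemma cintZ z f : cintg f -> cint Om (fun r => z * f r) = z * cint Om f.
Proof.
move=> [rf jf]; apply: eqC; rewrite ?ReM ?ImM /=.
  rewrite -!RintegralZl // -RintegralB //.
  - by apply: eq_Rintegral => r _; rewrite ReM.
  - exact: (integrableZl mO (complex.Re z) rf).
  - exact: (integrableZl mO (complex.Im z) jf).
rewrite -!RintegralZl // -RintegralD //.
- by apply: eq_Rintegral => r _; rewrite ImM.
- exact: (integrableZl mO (complex.Re z) jf).
- exact: (integrableZl mO (complex.Im z) rf).
Qed.

Lemma cint_conj f : cintg f -> cint Om (fun r => (f r)^*%C) = (cint Om f)^*%C.
Proof.
move=> [rf jf]; rewrite /cint /=; congr Complex.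
  by apply: eq_Rintegral => r _; rewrite Reconj.
rewrite /Rintegral; under eq_integral do rewrite Imconj EFinN.
by rewrite integralN ?fineN //; exact: integrable_add_def.
Qed.
End ScalarIntegral.

Section PeriodicIntegral.
Variable R : realType.
Local Notation MR := (measurableTypeR R).
Local Notation RR := (MR * MR)%type.
Local Notation mu2 := (@mu2 R).
Local Notation Om := (Omega : set RR).
Local Notation C := R[i].
Implicit Types (a b : RR -> R) (f g h : RR -> C) (z : C).

Let mO := @measurable_Omega R.
Hint Resolve mO : core.

Section Symmetry.
Variables (T : RR -> RR) (A : set RR).
Hypothesis mT : measurable_fun setT T.
Hypothesis pT : forall B : set RR, measurable B -> mu2 (T @^-1` B) = mu2 B.
Hypothesis fA : fundamental A.
Hypothesis AT : T @^-1` A = Om.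

(** The change of variables [T] turns the integral over [Omega], the preimage of [A], into one over
    [A], and all fundamental domains give a periodic function the same integral. *)
Lemma ge0_integral_symmetry (h : RR -> \bar R) : measurable_fun setT h ->
  (forall r, (0 <= h r)%E) -> gper h ->
  (\int[mu2]_(r in Om) h (T r) = \int[mu2]_(r in Om) h r)%E.
Proof.
move=> mh h0 ph; have [mA _ _] := fA.
by rewrite -{1}AT ge0_integral_preserving // (fundamental_integral fA (fundamental_Omega R)).
Qed.

Lemma integral_symmetry (h : RR -> \bar R) : measurable_fun setT h -> gper h ->
  (\int[mu2]_(r in Om) h (T r) = \int[mu2]_(r in Om) h r)%E.
Proof.
move=> mh ph; rewrite integralE [RHS]integralE; congr (_ - _)%E.
- have -> : (fun r => h (T r))^\+%E = (fun r => h^\+ (T r))%E by exact: funepos_comp.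
  apply: (@ge0_integral_symmetry (h^\+)%E (measurable_funepos mh)) => //.
  by move=> a b; have := ph a b; apply: filterS => r e; rewrite !funeposE e.
- have -> : (fun r => h (T r))^\-%E = (fun r => h^\- (T r))%E by exact: funeneg_comp.
  apply: (@ge0_integral_symmetry (h^\-)%E (measurable_funeneg mh)) => //.
  by move=> a b; have := ph a b; apply: filterS => r e; rewrite !funenegE e.
Qed.

Lemma cint_symmetry h : cmeas h -> gper h ->
  cint Om (fun r => h (T r)) = cint Om h.
Proof.
move=> [mr mi] ph; rewrite /cint /Rintegral; congr Complex; congr fine.
  apply: (integral_symmetry (h := fun r => (complex.Re (h r))%:E)); first exact/measurable_EFinP.
  by move=> a b; have := ph a b; apply: filterS => r e; rewrite e.
apply: (integral_symmetry (h := fun r => (complex.Im (h r))%:E)); first exact/measurable_EFinP.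
by move=> a b; have := ph a b; apply: filterS => r e; rewrite e.
Qed.

Lemma sqi_symmetry (a : RR -> R) : sqi a -> gper a -> sqi (fun r => a (T r)).
Proof.
move=> [ma ia] pa; have mTa : measurable_fun setT (fun r => a (T r)) by exact: measurableT_comp.
split => //; apply/integrableP; split.
  by apply/measurable_EFinP; apply: measurable_funTS; exact: measurable_funX.
have /integrableP[_ fa] := ia; apply: le_lt_trans fa.
rewrite (ge0_integral_symmetry (h := fun r => `|(a r ^+ 2)%:E|%E)) //.
  by apply: measurableT_comp => //; apply/measurable_EFinP; exact: measurable_funX.
by move=> c d; have := pa c d; apply: filterS => r e; rewrite e.
Qed.

Lemma csqi_symmetry f : csqi f -> gper f -> csqi (fun r => f (T r)).
Proof.
move=> [rf jf] pf; split.
  by apply: (sqi_symmetry rf) => a b; have := pf a b; apply: filterS => r e; rewrite e.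
by apply: (sqi_symmetry jf) => a b; have := pf a b; apply: filterS => r e; rewrite e.
Qed.
End Symmetry.

Lemma cint_shift (c : R * R) h : cmeas h -> gper h ->
  cint Om (fun r => h (r + c)) = cint Om h.
Proof.
apply: (@cint_symmetry (fun r => r + c) ((fun r : RR => r - c : RR) @^-1` Om)).
- exact: measurable_shift.
- exact: mu2_shift.
- exact: (fundamental_shift (- c) (fundamental_Omega R)).
- by apply/seteqP; split => r; rewrite /= addrK.
Qed.

Lemma oppr_preimage_Omega : (fun r : RR => - r : RR) @^-1` ((fun r : RR => - r : RR) @^-1` Om) = Om.
Proof. by apply/seteqP; split => r; rewrite /= opprK. Qed.

Lemma cint_opp h : cmeas h -> gper h -> cint Om (fun r => h (- r)) = cint Om h.
Proof.
exact: (cint_symmetry (@measurable_opp2 R) (@mu2_opp R)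
  (fundamental_opp (fundamental_Omega R)) oppr_preimage_Omega).
Qed.

Lemma csqi_opp f : csqi f -> gper f -> csqi (fun r => f (- r)).
Proof.
exact: (csqi_symmetry (@measurable_opp2 R) (@mu2_opp R)
  (fundamental_opp (fundamental_Omega R)) oppr_preimage_Omega).
Qed.

Lemma cint_ae f g : {ae mu2, forall r, Om r -> f r = g r} -> cint Om f = cint Om g.
Proof.
move=> fg; rewrite /cint /Rintegral; congr Complex; congr fine;
  apply: (@ae_eq_integral_off_null _ RR R mu2);
  by apply: filterS fg => r h /h ->.
Qed.

Lemma cmeasM f g : cmeas f -> cmeas g -> cmeas (fun r => f r * g r).
Proof.
move=> [rf jf] [rg jg]; split.
  by under eq_fun do rewrite /= ReM; apply: measurable_funB; exact: measurable_funM.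
by under eq_fun do rewrite /= ImM; apply: measurable_funD; exact: measurable_funM.
Qed.

Lemma cmeas_conj f : cmeas f -> cmeas (fun r => (f r)^*%C).
Proof.
move=> [rf jf]; split; first by under eq_fun do rewrite /= Reconj.
by under eq_fun do rewrite /= Imconj; exact: measurable_funN.
Qed.

Lemma cisD (x y : R) : cis (x + y) = cis x * cis y.
Proof. by apply: eqC; rewrite ?ReM ?ImM /= ?cosD ?sinD // addrC. Qed.

Lemma cis0 : cis (0 : R) = 1.
Proof. by rewrite /cis cos0 sin0. Qed.

Lemma cisN (x : R) : cis (- x) = (cis x)^*%C.
Proof. by rewrite /cis cosN sinN. Qed.

Lemma normc_cis (x : R) : normc (cis x) = 1.
Proof. by rewrite /cis /= cos2Dsin2 sqrtr1. Qed.

Lemma cisNK (x : R) : cis (- x) * cis x = 1.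
Proof. by rewrite -cisD addNr cis0. Qed.

Lemma cis_2pi_nat (n : nat) : cis (2 * pi * n%:R : R) = 1.
Proof.
elim: n => [|n IHn]; first by rewrite mulr0 cis0.
rewrite -[n.+1%:R]natr1 mulrDr mulr1 cisD IHn mul1r /cis.
by rewrite mulr_natl cos2pi sin2pi.
Qed.

Lemma cis_2pi (n : int) : cis (2 * pi * n%:~R : R) = 1.
Proof.
case: n => n; first exact: cis_2pi_nat.
by rewrite NegzE intrN mulrN cisN cis_2pi_nat conjc1.
Qed.

Lemma cis_gamma (a b c d : int) (r : R * R) :
  cis (dotp (gammaS R a b) (r + gamma R c d)) = cis (dotp (gammaS R a b) r).
Proof. by rewrite dotpDr cisD dotp_gammaS_gamma cis_2pi mulr1. Qed.

Lemma measurable_cos : measurable_fun setT (cos : MR -> MR).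
Proof. by apply: continuous_measurable_fun => x; exact: continuous_cos. Qed.

Lemma measurable_sin : measurable_fun setT (sin : MR -> MR).
Proof. by apply: continuous_measurable_fun => x; exact: continuous_sin. Qed.

Lemma cmeas_cis (k : R * R) : cmeas (fun r => cis (dotp k r)).
Proof.
split; rewrite /cis /=.
  exact: (measurableT_comp measurable_cos (measurable_dotp k)).
exact: (measurableT_comp measurable_sin (measurable_dotp k)).
Qed.

Lemma csqi_cis (k : R * R) f : csqi f -> csqi (fun r => cis (dotp k r) * f r).
Proof. by apply: (@csqi_bounded R _ _ 1) => [|r]; [exact: cmeas_cis|rewrite normc_cis]. Qed.

(* Shifting the integration variable by c multiplies the integral by cis (G . c). *)
Lemma cint_cis (a b : int) : cint Om (fun r => cis (dotp (gammaS R a b) r)) =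
  if (a == 0) && (b == 0) then (areaOmega R)%:C%C else 0.
Proof.
have cc : csqi (fun r => cis (dotp (gammaS R a b) r)).
  by have := csqi_cis (gammaS R a b) (csqi_cst 1); under eq_fun do rewrite mulr1.
case: ifPn => [/andP[/eqP -> /eqP ->]|ab].
  rewrite /cint; congr Complex.
    under eq_Rintegral do rewrite gammaS0 dotp0l cis0 /=.
    by rewrite Rintegral_cst // mul1r.
  under eq_Rintegral do rewrite gammaS0 dotp0l cis0 /=.
  by rewrite Rintegral_cst // mul0r.
(* Chosen so that G . c = pi: the shift by [c] then changes the sign of the character, and its
   integral equals its own opposite. *)
pose c : R * R := lin2 (a%:~R / 2 / (a * a + b * b)%:~R) (b%:~R / 2 / (a * a + b * b)%:~R) v1 v2.
have n0 : (a * a + b * b)%:~R != 0 :> R.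
  rewrite intr_eq0; move: ab; rewrite negb_and => /orP[|] h; apply/eqP; nia.
have cE : cis (dotp (gammaS R a b) c) = -1.
  have -> : dotp (gammaS R a b) c = pi.
    rewrite /c /gammaS /dotp /lin2 /g1 /g2 /v1 /v2 /=.
    have := n0; rewrite intrD !intrM; have := pi_neq0 R; have := sqrt3_neq0 R.
    move: (Num.sqrt 3) (@pi R) (a%:~R : R) (b%:~R : R) => w p x y w0 p0 n1.
    by field; rewrite ?w0 ?n1.
  by rewrite /cis cospi sinpi; apply: eqC; rewrite ?ReN ?ImN /= ?oppr0.
have pc : gper (fun r => cis (dotp (gammaS R a b) r)).
  by move=> m n; apply: nearW => r; exact: cis_gamma.
have e : cint Om (fun r => cis (dotp (gammaS R a b) r)) =
    -1 * cint Om (fun r => cis (dotp (gammaS R a b) r)).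
  rewrite -cintZ; last exact: csqi_intg.
  rewrite -(cint_shift c (csqi_meas cc) pc); congr cint; apply/funext => r.
  by rewrite dotpDr cisD cE mulrC.
by move/eqP: e; rewrite mulN1r -addr_eq0 -mulr2n mulrn_eq0 /= => /eqP.
Qed.
End PeriodicIntegral.

(** * The Hilbert space of periodic waves *)

Section PeriodicL2.
Variables (R : realType) (N : nat).
Local Notation MR := (measurableTypeR R).
Local Notation RR := (MR * MR)%type.
Local Notation mu2 := (@mu2 R).
Local Notation Om := (Omega : set RR).
Local Notation C := R[i].
Local Notation W := (wave R N).
Implicit Types (f g h : W) (z : C) (s : bool) (j : 'I_N).

Let mO := @measurable_Omega R.
Hint Resolve mO : core.

Lemma eqae_refl f : eqae f f.
Proof. exact: nearW. Qed.

Lemma eqae_sym f g : eqae f g -> eqae g f.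
Proof. by apply: filterS => r e s j. Qed.

Lemma eqae_trans f g h : eqae f g -> eqae g h -> eqae f h.
Proof. by apply: filterS2 => r e1 e2 s j; rewrite e1. Qed.

Lemma eqaeD f f' g g' : eqae f f' -> eqae g g' -> eqae (wadd f g) (wadd f' g').
Proof. by apply: filterS2 => r e1 e2 s j; rewrite /wadd e1 e2. Qed.

Lemma eqaeB f f' g g' : eqae f f' -> eqae g g' -> eqae (wsub f g) (wsub f' g').
Proof. by apply: filterS2 => r e1 e2 s j; rewrite /wsub e1 e2. Qed.

Lemma eqaeZ z f f' : eqae f f' -> eqae (wscale z f) (wscale z f').
Proof. by apply: filterS => r e s j; rewrite /wscale e. Qed.

Lemma eqae_phase k f f' : eqae f f' -> eqae (phase k f) (phase k f').
Proof. by apply: filterS => r e s j; rewrite /phase e. Qed.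

Lemma ae_forall_int2 (P : int -> int -> R * R -> Prop) :
  (forall a b, {ae mu2, forall r, P a b r}) -> {ae mu2, forall r, forall a b, P a b r}.
Proof.
move=> aP.
have : {ae mu2, forall r n, if pickle_inv n is Some p then P p.1 p.2 r else True}.
  apply: (@ae_foralln _ _ _ mu2 (fun n (r : RR) =>
    if pickle_inv n is Some p then P p.1 p.2 r else True)) => n.
  by case: pickle_inv => [p|]; [exact: aP|exact: nearW].
by apply: filterS => r h a b; have := h (pickle (a, b)); rewrite pickleK_inv.
Qed.

Lemma bloch0P f : bloch 0 f <->
  forall a b, {ae mu2, forall r, forall s j, f (r + gamma R a b) s j = f r s j}.
Proof.
by split=> bf a b; have := bf a b; apply: filterS => r e s j;
  have := e s j; rewrite /translate /wscale dotp0r cis0 mul1r.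
Qed.

Lemma L2per_gper f s j : bloch 0 f -> gper (fun r => f r s j).
Proof. by move=> /bloch0P pf a b; have := pf a b; apply: filterS => r e. Qed.

Definition dens f (r : RR) : R := \sum_s \sum_j normc (f r s j) ^+ 2.

Lemma dens_ge0 f r : 0 <= dens f r.
Proof. by apply: sumr_ge0 => s _; apply: sumr_ge0 => j _; exact: sqr_ge0. Qed.

Lemma normc_dens f r s j : normc (f r s j) ^+ 2 <= dens f r.
Proof.
rewrite /dens (bigD1 s) //= (bigD1 j) //= -addrA lerDl addr_ge0 //.
  by apply: sumr_ge0 => ? _; exact: sqr_ge0.
by apply: sumr_ge0 => ? _; apply: sumr_ge0 => ? _; exact: sqr_ge0.
Qed.

Lemma dens_eq0 f r : dens f r = 0 -> forall s j, f r s j = 0.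
Proof.
move=> d0 s j; have := normc_dens f r s j; rewrite d0 => h.
have : normc (f r s j) ^+ 2 == 0 by rewrite eq_le h sqr_ge0.
by rewrite sqrf_eq0 => /eqP /ComplexField.Normc.eq0_normc.
Qed.

Lemma measurable_dens f : measurable_wave f -> measurable_fun setT (dens f).
Proof.
move=> mf; rewrite /dens; under eq_fun do under eq_bigr do under eq_bigr do rewrite normc2.
apply: measurable_sum => s; apply: measurable_sum => j; have [mr mi] := mf s j.
by apply: measurable_funD; exact: measurable_funX.
Qed.

Lemma sqnormE f : sqnorm Om f = (\int[mu2]_(r in Om) (dens f r)%:E)%E.
Proof. by []. Qed.

Lemma integrable_dens f : measurable_wave f ->
  (sqnorm Om f < +oo)%E <-> mu2.-integrable Om (fun r => (dens f r)%:E).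
Proof.
move=> mf; have e : (\int[mu2]_(r in Om) `|(dens f r)%:E|)%E = sqnorm Om f.
  by rewrite sqnormE; apply: eq_integral => r _; rewrite /= ger0_norm ?dens_ge0.
split; last by move=> /integrableP[_]; rewrite e.
move=> sf; apply/integrableP; split; last by rewrite e.
by apply/measurable_EFinP; apply: measurable_funTS; exact: measurable_dens.
Qed.

Lemma L2perP f : L2per f <-> bloch 0 f /\ forall s j, csqi (fun r => f r s j).
Proof.
split=> [[mf bf /(integrable_dens mf) df]|[bf cf]].
  split=> // s j; have [mr mi] := mf s j; split; split => //.
  - apply: (integrable_le _ df); first exact: measurable_funX.
    move=> r; rewrite ger0_norm ?sqr_ge0 //; apply: le_trans (normc_dens f r s j).
    by rewrite normc2 lerDl sqr_ge0.
  - apply: (integrable_le _ df); first exact: measurable_funX.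
    move=> r; rewrite ger0_norm ?sqr_ge0 //; apply: le_trans (normc_dens f r s j).
    by rewrite normc2 lerDr sqr_ge0.
have mf : measurable_wave f by move=> s j; have [[? _] [? _]] := cf s j.
split=> //; apply/integrable_dens => //.
have -> : (fun r => (dens f r)%:E) = (fun r : RR => \sum_s \sum_j
    (((complex.Re (f r s j)) ^+ 2)%:E + ((complex.Im (f r s j)) ^+ 2)%:E))%E.
  apply/funext => r; rewrite /dens -sumEFin; apply: eq_bigr => s _.
  by rewrite -sumEFin; apply: eq_bigr => j _; rewrite normc2 EFinD.
apply: (integrable_sum mO) => s _; apply: (integrable_sum mO) => j _.
by have [[_ i1] [_ i2]] := cf s j; exact: (integrableD mO i1 i2).
Qed.

Lemma L2per_csqi f s j : L2per f -> csqi (fun r => f r s j).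
Proof. by move=> /L2perP[_]. Qed.

Lemma L2per_zero : L2per (@wzero R N).
Proof.
apply/L2perP; split; last by move=> s j; exact: csqi_cst.
by apply/bloch0P => a b; exact: nearW.
Qed.

Lemma L2perD f g : L2per f -> L2per g -> L2per (wadd f g).
Proof.
move=> /L2perP[/bloch0P bf cf] /L2perP[/bloch0P bg cg]; apply/L2perP; split.
  apply/bloch0P => a b; have := bf a b; have := bg a b.
  by apply: filterS2 => r e1 e2 s j; rewrite /wadd e1 e2.
by move=> s j; exact: csqiD.
Qed.

Lemma L2perZ z f : L2per f -> L2per (wscale z f).
Proof.
move=> /L2perP[/bloch0P bf cf]; apply/L2perP; split.
  apply/bloch0P => a b; have := bf a b.
  by apply: filterS => r e1 s j; rewrite /wscale e1.
by move=> s j; exact: csqiZ.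
Qed.

Lemma wsubE f g : wsub f g = wadd f (wscale (-1) g).
Proof. by apply/funext => r; apply/funext => s; apply/funext => j;
  rewrite /wsub /wadd /wscale mulN1r. Qed.

Lemma L2perB f g : L2per f -> L2per g -> L2per (wsub f g).
Proof. by move=> pf pg; rewrite wsubE; apply: L2perD => //; exact: L2perZ. Qed.

Definition wsum (I : Type) (l : seq I) (c : I -> C) (e : I -> W) : W :=
  fun r s j => \sum_(i <- l) c i * e i r s j.

Lemma wsum_nil I (c : I -> C) e : wsum [::] c e = @wzero R N.
Proof. by apply/funext => r; apply/funext => s; apply/funext => j; rewrite /wsum big_nil. Qed.

Lemma wsum_cons I i (l : seq I) (c : I -> C) e :
  wsum (i :: l) c e = wadd (wscale (c i) (e i)) (wsum l c e).
Proof. by apply/funext => r; apply/funext => s; apply/funext => j; rewrite /wsum big_cons. Qed.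

Lemma L2per_wsum (I : eqType) (l : seq I) (c : I -> C) e :
  (forall i, i \in l -> L2per (e i)) -> L2per (wsum l c e).
Proof.
elim: l => [|i l IHl] pe; first by rewrite wsum_nil; exact: L2per_zero.
rewrite wsum_cons; apply: L2perD; first by apply: L2perZ; apply: pe; rewrite mem_head.
by apply: IHl => k kl; apply: pe; rewrite in_cons kl orbT.
Qed.

Lemma inner_intg f g s j : L2per f -> L2per g ->
  cintg (fun r => (f r s j)^*%C * g r s j).
Proof. by move=> /L2perP[_ cf] /L2perP[_ cg]; apply: csqiM => //; exact: csqi_conj. Qed.

Lemma innerDr f g h : L2per f -> L2per g -> L2per h ->
  inner f (wadd g h) = inner f g + inner f h.
Proof.
move=> pf pg ph; rewrite /inner -big_split; apply: eq_bigr => s _.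
rewrite -big_split; apply: eq_bigr => j _ /=.
by rewrite -cintD; try exact: inner_intg; congr cint; apply/funext => r; rewrite mulrDr.
Qed.

Lemma innerZr z f g : L2per f -> L2per g -> inner f (wscale z g) = z * inner f g.
Proof.
move=> pf pg; rewrite /inner mulr_sumr; apply: eq_bigr => s _.
rewrite mulr_sumr; apply: eq_bigr => j _ /=.
by rewrite -cintZ; try exact: inner_intg; congr cint; apply/funext => r; rewrite mulrCA.
Qed.

Lemma inner_conj f g : L2per f -> L2per g -> inner g f = (inner f g)^*%C.
Proof.
move=> pf pg; rewrite /inner rmorph_sum; apply: eq_bigr => s _.
rewrite rmorph_sum; apply: eq_bigr => j _.
apply: etrans; last exact: (cint_conj (inner_intg s j pf pg)).
congr cint; apply/funext => r.
by rewrite rmorphM /= conjcK mulrC.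
Qed.

Lemma innerDl f g h : L2per f -> L2per g -> L2per h ->
  inner (wadd f g) h = inner f h + inner g h.
Proof.
move=> pf pg ph; rewrite (inner_conj ph (L2perD pf pg)) innerDr // rmorphD /=.
by rewrite -(inner_conj ph pf) -(inner_conj ph pg).
Qed.

Lemma innerZl z f g : L2per f -> L2per g -> inner (wscale z f) g = z^*%C * inner f g.
Proof.
move=> pf pg; rewrite (inner_conj pg (L2perZ z pf)) innerZr // rmorphM /=.
by rewrite -(inner_conj pg pf).
Qed.

Lemma innerBr f g h : L2per f -> L2per g -> L2per h ->
  inner f (wsub g h) = inner f g - inner f h.
Proof.
by move=> pf pg ph; rewrite wsubE innerDr ?innerZr ?mulN1r //; exact: L2perZ.
Qed.

Lemma innerBl f g h : L2per f -> L2per g -> L2per h ->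
  inner (wsub f g) h = inner f h - inner g h.
Proof.
move=> pf pg ph; have m1 : (-1 : C)^*%C = -1 by rewrite rmorphN1.
by rewrite wsubE innerDl ?innerZl ?m1 ?mulN1r //; exact: L2perZ.
Qed.

Lemma inner0r f : L2per f -> inner f (@wzero R N) = 0.
Proof.
move=> pf; have -> : @wzero R N = wscale 0 (@wzero R N).
  by apply/funext => r; apply/funext => s; apply/funext => j; rewrite /wscale mul0r.
by rewrite innerZr ?mul0r //; exact: L2per_zero.
Qed.

Lemma inner_wsumr (I : eqType) (l : seq I) (c : I -> C) e f : L2per f ->
  (forall i, i \in l -> L2per (e i)) ->
  inner f (wsum l c e) = \sum_(i <- l) c i * inner f (e i).
Proof.
move=> pf; elim: l => [|i l IHl] pe; first by rewrite wsum_nil big_nil inner0r.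
have pl k : k \in l -> L2per (e k) by move=> kl; apply: pe; rewrite in_cons kl orbT.
have pi : L2per (e i) by apply: pe; rewrite mem_head.
rewrite wsum_cons big_cons innerDr ?innerZr ?IHl //; first exact: L2perZ.
exact: L2per_wsum.
Qed.

Lemma inner_wsuml (I : eqType) (l : seq I) (c : I -> C) e f : L2per f ->
  (forall i, i \in l -> L2per (e i)) ->
  inner (wsum l c e) f = \sum_(i <- l) (c i)^*%C * inner (e i) f.
Proof.
move=> pf pe; rewrite (inner_conj pf (L2per_wsum c pe)) inner_wsumr // rmorph_sum /=.
rewrite [LHS]big_seq [RHS]big_seq; apply: eq_bigr => i il.
by rewrite rmorphM /= -(inner_conj pf (pe i il)).
Qed.

Lemma inner_ae (f f' g g' : W) : eqae f f' -> eqae g g' -> inner f g = inner f' g'.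
Proof.
move=> ef eg; rewrite /inner; apply: eq_bigr => s _; apply: eq_bigr => j _.
rewrite /cint /Rintegral; congr Complex; congr fine;
  apply: (@ae_eq_integral_off_null _ RR R mu2); move: ef eg;
  by apply: filterS2 => r e1 e2 _; rewrite e1 e2.
Qed.

Lemma nrm_ge0 f : 0 <= nrm f.
Proof. exact: sqrtr_ge0. Qed.

Lemma inner_nrm f : L2per f -> inner f f = (nrm f ^+ 2)%:C%C.
Proof.
move=> pf; have [mf bf sf] := pf; have df := (integrable_dens mf).1 sf.
have s0 : (0 <= sqnorm Om f)%E by apply: integral_ge0 => r _; rewrite lee_fin dens_ge0.
rewrite /nrm sqr_sqrtr ?fine_ge0 //.
have cf s j := L2per_csqi s j pf.
have i1 s j : mu2.-integrable Om (fun r =>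
  ((complex.Re (f r s j)) ^+ 2 + (complex.Im (f r s j)) ^+ 2)%:E).
  by have [[_ a1] [_ a2]] := cf s j; apply: eq_integrable (integrableD mO a1 a2).
have -> : inner f f = \sum_s \sum_j (\int[mu2]_(r in Om) ((complex.Re (f r s j)) ^+ 2 +
  (complex.Im (f r s j)) ^+ 2))%:C%C.
  rewrite /inner; apply: eq_bigr => s _; apply: eq_bigr => j _; rewrite /cint /real_complex_def.
  congr Complex.
    by apply: eq_Rintegral => r _; rewrite ReM Reconj Imconj mulNr opprK !expr2.
  under eq_Rintegral do rewrite ImM Reconj Imconj mulNr mulrC subrr.
  by rewrite Rintegral_cst // mul0r.
transitivity ((\sum_s \sum_j (\int[mu2]_(r in Om) ((complex.Re (f r s j)) ^+ 2 +
  (complex.Im (f r s j)) ^+ 2))) %:C%C).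
  by rewrite rmorph_sum; apply: eq_bigr => s _; rewrite rmorph_sum.
congr (_ %:C%C); rewrite sqnormE.
have -> : (fun r => (dens f r)%:E) = (fun r : RR => \sum_s \sum_j
    (((complex.Re (f r s j)) ^+ 2) + ((complex.Im (f r s j)) ^+ 2))%:E)%E.
  apply/funext => r; rewrite /dens -sumEFin; apply: eq_bigr => s _.
  by rewrite -sumEFin; apply: eq_bigr => j _; rewrite normc2.
have i2 s : mu2.-integrable Om (fun r =>
  \sum_j ((complex.Re (f r s j)) ^+ 2 + (complex.Im (f r s j)) ^+ 2)%:E)%E.
  by apply: (integrable_sum mO) => j _; exact: i1.
rewrite (integral_sum mO i2).
rewrite (eq_bigr _ (fun s _ => integral_sum mO (i1 s) _ _)).
have i3 s j := integrable_fin_num mO (i1 s j).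
rewrite -sum_fine; last first.
  by move=> s _; rewrite sum_fin_num; apply/allP => x /mapP[j _ ->]; exact: i3.
by apply: eq_bigr => s _; rewrite -sum_fine // => j _; exact: i3.
Qed.

(** The norm only sees the cell. Vanishing spreads to the plane through periodicity, the countably
    many lattice vectors contributing a single null set. *)
Lemma nrm_eq0 f : L2per f -> nrm f = 0 -> eqae f (@wzero R N).
Proof.
move=> pf n0; have [mf bf sf] := pf; have df := (integrable_dens mf).1 sf.
have s0 : (0 <= sqnorm Om f)%E by apply: integral_ge0 => r _; rewrite lee_fin dens_ge0.
have z0 : sqnorm Om f = 0%E.
  move/eqP: n0; rewrite sqrtr_eq0 => n0.
  by apply/eqP; rewrite eq_le s0 andbT -(fineK (x := sqnorm Om f)) ?lee_fin // ge0_fin_numE.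
have : ae_eq mu2 Om (fun r => (dens f r)%:E) (cst 0%E).
  apply: (ae_eq_integral_abs mu2 mO _).1 => //.
    by apply: measurable_funTS; apply/measurable_EFinP; exact: measurable_dens.
  by rewrite -z0 sqnormE; apply: eq_integral => r _; rewrite /= ger0_norm ?dens_ge0.
move=> aed.
have a1 : forall a b : int, {ae mu2, forall r : R * R,
    Om (r + gamma R a b) -> forall s j, f (r + gamma R a b) s j = 0}.
  move=> a b; have := ae_preserving (measurable_shift (gamma R a b)) (mu2_shift (gamma R a b)) aed.
  by apply: filterS => r /= h Or s j; apply: dens_eq0; have [] := h Or.
have := ae_forall_int2 a1; have := ae_forall_int2 ((bloch0P f).1 bf).
apply: filterS2 => r h1 h2 s j; have [_ /(_ r)[a [b ab]] _] := fundamental_Omega R.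
by rewrite -(h1 a b) h2.
Qed.

Lemma nrm_ae (f g : W) : eqae f g -> nrm f = nrm g.
Proof.
move=> fg; rewrite /nrm !sqnormE; congr (Num.sqrt (fine _)).
apply: (@ae_eq_integral_off_null _ RR R mu2); move: fg.
apply: filterS => r e _; congr EFin; rewrite /dens.
by apply: eq_bigr => s _; apply: eq_bigr => j _; rewrite e.
Qed.

Lemma nrm_wzero : nrm (@wzero R N) = 0.
Proof.
have := inner_nrm L2per_zero; rewrite inner0r; last exact: L2per_zero.
by move=> [/esym/eqP]; rewrite sqrf_eq0 => /eqP.
Qed.

Lemma nrmZ z f : L2per f -> nrm (wscale z f) = normc z * nrm f.
Proof.
move=> pf; apply/eqP; rewrite -(eqrXn2 (n := 2)) ?nrm_ge0 ?mulr_ge0 ?normc_ge0 ?nrm_ge0 //.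
apply/eqP; apply: complexI; rewrite -inner_nrm; last exact: L2perZ.
rewrite innerZl ?innerZr ?inner_nrm //; last exact: L2perZ.
rewrite mulrA exprMn; transitivity ((normc z ^+ 2)%:C%C * (nrm f ^+ 2)%:C%C);
  last by rewrite -rmorphM.
congr (_ * _).
by case: z => x y; apply: eqC; rewrite ?ReM ?ImM /= ?sqr_sqrtr ?addr_ge0 ?sqr_ge0 //; ring.
Qed.

Lemma cauchy_schwarz f g : L2per f -> L2per g -> normc (inner f g) <= nrm f * nrm g.
Proof.
move=> pf pg.
have [g0|g0] := eqVneq (nrm g) 0.
  have -> : inner f g = 0.
    rewrite -(inner0r pf); apply: inner_ae; first exact: eqae_refl.
    exact: nrm_eq0.
  by rewrite ComplexField.Normc.normc0 mulr_ge0 ?nrm_ge0.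
(* [wscale w g] is the orthogonal projection of [f] on the line of [g]; the inequality expresses
   that the residue has a nonnegative square norm. *)
set b := inner f g; pose w := b^*%C / (nrm g ^+ 2)%:C%C.
have pwg : L2per (wscale w g) by exact: L2perZ.
have n2 : (nrm g ^+ 2)%:C%C != 0 :> C by rewrite eq_complex /= eqxx andbT expf_neq0.
have : inner (wsub f (wscale w g)) (wsub f (wscale w g)) =
    ((nrm f ^+ 2)%:C%C - b * b^*%C / (nrm g ^+ 2)%:C%C).
  rewrite innerBr ?innerBl //; try exact: L2perB.
  rewrite !innerZr // !innerZl // (inner_conj pf pg) !inner_nrm // -/b /w.
  have -> : (b^*%C / (nrm g ^+ 2)%:C%C)^*%C = b / (nrm g ^+ 2)%:C%C.
    by rewrite rmorphM fmorphV /= conjcK oppr0.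
  clear pwg w; clearbody b.
  move: b (b^*%C) ((nrm f ^+ 2)%:C%C) ((nrm g ^+ 2)%:C%C) n2 => b c A B B0.
  by field.
rewrite inner_nrm; last exact: L2perB.
have -> : b * b^*%C = (normc b ^+ 2)%:C%C.
  by rewrite normc2; case: (b) => x y; apply: eqC; rewrite ?ReM ?ImM /=; ring.
rewrite -fmorphV -rmorphM -rmorphB => /complexI e.
have : 0 <= nrm f ^+ 2 - normc b ^+ 2 / nrm g ^+ 2 by rewrite -e sqr_ge0.
rewrite subr_ge0 ler_pdivrMr; last by rewrite exprn_gt0 // lt0r g0 nrm_ge0.
by rewrite -exprMn ler_pXn2r // nnegrE ?mulr_ge0 ?nrm_ge0 ?normc_ge0.
Qed.

Lemma nrmD f g : L2per f -> L2per g -> nrm (wadd f g) <= nrm f + nrm g.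
Proof.
move=> pf pg; rewrite -(ler_pXn2r (n := 2)) ?nnegrE ?addr_ge0 ?nrm_ge0 //.
rewrite -lecR -inner_nrm; last exact: L2perD.
rewrite innerDr ?innerDl //; try exact: L2perD.
rewrite (inner_conj pf pg) !inner_nrm // lecE !CE /=.
have := cauchy_schwarz pf pg; have := Re_le_normc (inner f g).
rewrite ler_norml => /andP[_ h1] h2; apply/andP; split; first by apply/eqP; ring.
by rewrite sqrrD; lra.
Qed.

Lemma nrm_opp f : L2per f -> nrm (wscale (-1) f) = nrm f.
Proof. by move=> pf; rewrite nrmZ //= oppr0 sqrrN expr1n expr0n addr0 sqrtr1 mul1r. Qed.

Lemma nrm_subC f g : L2per f -> L2per g -> nrm (wsub f g) = nrm (wsub g f).
Proof.
move=> pf pg; rewrite -(nrm_opp (L2perB pg pf)); congr nrm.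
by apply/funext => r; apply/funext => s; apply/funext => j; rewrite /wscale /wsub mulN1r opprB.
Qed.

Lemma nrm_triangle f g h : L2per f -> L2per g -> L2per h ->
  nrm (wsub f h) <= nrm (wsub f g) + nrm (wsub g h).
Proof.
move=> pf pg ph; have -> : wsub f h = wadd (wsub f g) (wsub g h).
  by apply/funext => r; apply/funext => s; apply/funext => j; rewrite /wsub /wadd addrA subrK.
by apply: nrmD; exact: L2perB.
Qed.

Lemma nrm_subr0 f g : L2per f -> L2per g -> nrm (wsub f g) = 0 -> eqae f g.
Proof.
move=> pf pg /(nrm_eq0 (L2perB pf pg)); apply: filterS => r e s j.
by have /eqP := e s j; rewrite subr_eq0 => /eqP.
Qed.
End PeriodicL2.

Lemma cvgn_sum (R : realType) (I : Type) (l : seq I) (u : I -> R^nat) (a : I -> R) :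
  (forall i, u i @ \oo --> a i) ->
  (fun n => \sum_(i <- l) u i n) @ \oo --> \sum_(i <- l) a i.
Proof.
move=> ua; elim: l => [|i l IHl].
  by rewrite big_nil; under eq_fun do rewrite big_nil; exact: cvg_cst.
by rewrite big_cons; under eq_fun do rewrite big_cons; exact: cvgD.
Qed.

Lemma sum_geometric_le (R : realFieldType) (n : nat) : \sum_(0 <= k < n) (2^-1 : R) ^+ k <= 2.
Proof.
suff -> : \sum_(0 <= k < n) (2^-1 : R) ^+ k = 2 - 2 * 2^-1 ^+ n.
  by rewrite gerBl mulr_ge0 // exprn_ge0 // invr_ge0.
elim: n => [|n IHn]; first by rewrite big_geq // expr0; lra.
by rewrite big_nat_recr //= IHn exprS; lra.
Qed.

Lemma cvgn_series_dominated (R : realType) (v G : R^nat) :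
  (forall k, `|v k| <= G k) -> (\sum_(0 <= k <oo) (G k)%:E < +oo)%E ->
  cvgn (series v).
Proof.
move=> vG Goo; have G0 k : 0 <= G k by exact: le_trans (vG k).
apply: normed_cvg; apply: nondecreasing_is_cvgn.
  by apply: nondecreasing_series => k _ _; exact: normr_ge0.
exists (fine (\sum_(0 <= k <oo) (G k)%:E)%E) => _ [n _ <-].
have s0 : (0 <= \sum_(0 <= k <oo) (G k)%:E)%E by apply: nneseries_ge0 => k _ _; rewrite lee_fin.
rewrite -lee_fin fineK ?ge0_fin_numE //.
apply: (@le_trans _ _ (\sum_(0 <= k < n) (G k)%:E)%E).
  by rewrite sumEFin lee_fin /=; apply: ler_sum => k _; exact: vG.
by apply: nneseries_lim_ge => k _ _; rewrite lee_fin.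
Qed.

(** * Completeness of the space of periodic waves (Riesz-Fischer) *)

Section Completeness.
Variables (R : realType) (N : nat).
Local Notation MR := (measurableTypeR R).
Local Notation RR := (MR * MR)%type.
Local Notation mu2 := (@mu2 R).
Local Notation Om := (Omega : set RR).
Local Notation C := R[i].
Local Notation W := (wave R N).

Let mO := @measurable_Omega R.
Hint Resolve mO : core.

Lemma fatou_le (h_ : nat -> RR -> R) (h : RR -> R) (c : R) :
  (forall k, measurable_fun setT (h_ k)) -> (forall k r, 0 <= h_ k r) ->
  measurable_fun setT h -> (forall r, 0 <= h r) ->
  {ae mu2, forall r, Om r -> h_ ^~ r @ \oo --> h r} ->
  (\forall k \near \oo, (\int[mu2]_(r in Om) (h_ k r)%:E <= c%:E)%E) ->
  (\int[mu2]_(r in Om) (h r)%:E <= c%:E)%E.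
Proof.
move=> mh_ h_0 mh h0 ae_h hc.
pose f (k : nat) (r : RR) : \bar R := (h_ k r)%:E.
have mf k : measurable_fun Om (f k).
  by apply: measurable_funTS; apply/measurable_EFinP; exact: mh_.
have f0 k r : Om r -> (0 <= f k r)%E by move=> _; rewrite lee_fin.
have e0 r : (0 <= limn_einf (f ^~ r))%E.
  rewrite limn_einf_lim; apply: lime_ge; first exact: is_cvg_einfs.
  by apply: nearW => n; apply: le_ereal_inf_tmp => _ [k _ <-]; rewrite lee_fin.
have -> : (\int[mu2]_(r in Om) (h r)%:E = \int[mu2]_(r in Om) limn_einf (f ^~ r))%E.
  apply: (@ge0_ae_eq_integral _ _ _ mu2) => //.
  - by apply: measurable_funTS; apply/measurable_EFinP.
  - have mfN n : measurable_fun Om (fun r => - f n r)%E.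
      by apply: (measurableT_comp (f := -%E)) => //; exact: oppe_measurable.
    have := measurable_fun_limn_esup mfN.
    move=> m.
    have m' : measurable_fun Om (-%E \o (fun r => limn_esup (fun n => - f n r)%E)).
      by apply: (measurableT_comp (f := -%E)) => //; exact: oppe_measurable.
    have -> : (fun r : RR => limn_einf (f ^~ r)) = -%E \o (fun r => limn_esup (fun n =>
      - f n r)%E) by [].
    exact: m'.
  - by move=> r _; rewrite lee_fin.
  - move: ae_h; apply: filterS => r hr Or.
    have cf : f ^~ r @ \oo --> (h r)%:E by apply: cvg_EFin; [exact: nearW|exact: hr].
    by rewrite (cvg_limn_einf_sup cf).1.
apply: (le_trans (@fatou _ _ _ mu2 Om mO f mf f0)).
rewrite limn_einf_lim; apply: lime_le; first exact: is_cvg_einfs.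
have [k0 _ hk0] := hc; apply: nearW => n.
apply: (le_trans (y := (\int[mu2]_(r in Om) f (maxn n k0) r)%E)).
  by apply: ereal_inf_lbound; exists (maxn n k0) => //=; exact: leq_maxl.
by apply: hk0; exact: leq_maxr.
Qed.

(** The integrals add up to at most 2 K, so by monotone convergence the sum of the series is
    integrable, hence finite almost everywhere. *)
Lemma ae_nneseries_lty (d : nat -> RR -> R) (K : R) :
  (forall k, measurable_fun setT (d k)) -> (forall k r, 0 <= d k r) ->
  (forall k, (\int[mu2]_(r in Om) (d k r)%:E <= (K * 2^-1 ^+ k)%:E)%E) ->
  {ae mu2, forall r, Om r -> (\sum_(0 <= k <oo) (d k r)%:E < +oo)%E}.
Proof.
move=> md d0 dK.
have K0 : 0 <= K.
  have := dK 0%N; rewrite expr0 mulr1 -lee_fin; apply: le_trans.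
  by apply: integral_ge0 => r _; rewrite lee_fin.
have md' k : measurable_fun Om (fun r => (d k r)%:E).
  by apply: measurable_funTS; apply/measurable_EFinP.
have d0' k r : Om r -> (0 <= (d k r)%:E)%E by move=> _; rewrite lee_fin.
have i : mu2.-integrable Om (fun r => \sum_(0 <= k <oo) (d k r)%:E)%E.
  apply/integrableP; split; first by apply: ge0_emeasurable_sum => // k r Or _; exact: d0'.
  have -> : (\int[mu2]_(r in Om) `|\sum_(0 <= k <oo) (d k r)%:E| =
      \int[mu2]_(r in Om) \sum_(0 <= k <oo) (d k r)%:E)%E.
    by apply: eq_integral => r _; rewrite gee0_abs // nneseries_ge0 // => k _ _; rewrite lee_fin.
  rewrite (@integral_nneseries _ _ _ mu2 Om mO _ md' d0').
  apply: (@le_lt_trans _ _ (K * 2)%:E); last exact: ltry.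
  apply: lime_le; first by apply: is_cvg_nneseries => k _ _; apply: integral_ge0; exact: d0'.
  apply: nearW => n; apply: (@le_trans _ _ (\sum_(0 <= k < n) (K * 2^-1 ^+ k)%:E)%E).
    by apply: lee_sum => k _; exact: dK.
  by rewrite sumEFin lee_fin -mulr_sumr ler_wpM2l // sum_geometric_le.
have := integrable_ae mO i; apply: filterS => r h Or.
by have := h Or; rewrite ge0_fin_numE // nneseries_ge0 // => k _ _; rewrite lee_fin.
Qed.

Lemma nrm_le_int (f : W) (c : R) : 0 <= c ->
  (\int[mu2]_(r in Om) (dens f r)%:E <= (c ^+ 2)%:E)%E -> nrm f <= c.
Proof.
move=> c0 h; rewrite /nrm sqnormE -(ger0_norm c0) -sqrtr_sqr ler_wsqrtr //.
rewrite -lee_fin fineK // ge0_fin_numE; first exact: le_lt_trans h (ltry _).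
by apply: integral_ge0 => r _; rewrite lee_fin dens_ge0.
Qed.

Lemma int_dens (f : W) : L2per f ->
  (\int[mu2]_(r in Om) (dens f r)%:E = (nrm f ^+ 2)%:E)%E.
Proof.
move=> [mf bf sf].
have s0 : (0 <= sqnorm Om f)%E by apply: integral_ge0 => r _; rewrite lee_fin dens_ge0.
by rewrite -sqnormE /nrm sqr_sqrtr ?fine_ge0 // fineK // ge0_fin_numE.
Qed.

Section CauchySequence.
Variable F : nat -> W.
Hypothesis pF : forall n, L2per (F n).
Hypothesis cauchyF : forall e : R, 0 < e -> exists n0, forall m n,
  (n0 <= m)%N -> (n0 <= n)%N -> nrm (wsub (F m) (F n)) <= e.

Lemma fast_subsequence : exists psi : nat -> nat,
  (forall k, (k <= psi k)%N) /\
  (forall k, nrm (wsub (F (psi k.+1)) (F (psi k))) <= (2^-1 ^+ k) ^+ 2).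
Proof.
have [phi phiP] : exists phi : nat -> nat, forall k m n, (phi k <= m)%N -> (phi k <= n)%N ->
    nrm (wsub (F m) (F n)) <= (2^-1 ^+ k) ^+ 2.
  have h k : exists n0, forall m n, (n0 <= m)%N -> (n0 <= n)%N ->
      nrm (wsub (F m) (F n)) <= (2^-1 ^+ k) ^+ 2.
    by apply: cauchyF; rewrite exprn_gt0 // exprn_gt0 // invr_gt0.
  by exists (fun k => projT1 (cid (h k))) => k; exact: projT2 (cid (h k)).
(* The sum puts both [psi k] and [psi k.+1] beyond the Cauchy threshold [phi k]; the summand [k]
   makes the indices tend to infinity. *)
pose psi k := (k + \sum_(i < k.+1) phi i)%N; exists psi; split=> [k|k]; first exact: leq_addr.
by apply: phiP; rewrite /psi !big_ord_recr /=; lia.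
Qed.

Lemma L2per_complete : exists g : W, L2per g /\
  forall e : R, 0 < e -> exists n0, forall n, (n0 <= n)%N -> nrm (wsub (F n) g) <= e.
Proof.
have [psi [psik psiF]] := fast_subsequence.
pose E k := F (psi k).
have pE k : L2per (E k) by exact: pF.
have mE k : measurable_wave (E k) by have [] := pE k.
pose D k r := dens (wsub (E k.+1) (E k)) r.
pose t k : R := 2^-1 ^+ k.
have t0 k : 0 < t k by rewrite exprn_gt0 // invr_gt0.
have t1 k : t k <= 1 by rewrite exprn_ile1 ?invr_ge0 // invf_le1 ?ler1n.
(* From x <= t + x^2 / t: [G k] dominates the pointwise increments although it involves only their
   squares, whose integrals are the norms under control. With t = 2^-k these majorants have summable
   integrals. *)
pose G k r := t k + D k r / t k.
have mD k : measurable_fun setT (D k) by apply: measurable_dens; have [] := L2perB (pE k.+1) (pE k).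
have D0 k r : 0 <= D k r by exact: dens_ge0.
have aeG : {ae mu2, forall r, Om r -> (\sum_(0 <= k <oo) (G k r)%:E < +oo)%E}.
  apply: (@ae_nneseries_lty G (areaOmega R + 1)).
  - move=> k; apply: measurable_funD => //; apply: measurable_funM => //.
  - by move=> k r; rewrite addr_ge0 ?divr_ge0 // ltW.
  - move=> k; rewrite /G; under eq_integral do rewrite EFinD EFinM.
    have mDE : measurable_fun Om (fun r => (D k r)%:E).
      by apply: measurable_funTS; apply/measurable_EFinP; exact: mD.
    have ti0 : (0 <= ((t k)^-1)%:E)%E by rewrite lee_fin invr_ge0 ltW.
    have D0E r : Om r -> (0 <= (D k r)%:E)%E by rewrite lee_fin.
    rewrite ge0_integralD //; last 3 first.
      by move=> r _; rewrite lee_fin ltW.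
      by move=> r Or; rewrite mule_ge0 // D0E.
      by under eq_fun do rewrite -EFinM; apply: measurable_funTS; apply/measurable_EFinP;
        apply: measurable_funM.
    rewrite (ge0_integralZr mu2 mO mDE D0E ti0) integral_cst //.
    rewrite (int_dens (L2perB (pE k.+1) (pE k))).
    rewrite [X in (_ * X + _)%E](_ : _ = (areaOmega R)%:E); last exact: esym (areaOmegaE R).
    rewrite -!EFinM -EFinD lee_fin mulrDl mul1r mulrC lerD2l.
    rewrite ler_pdivrMr // -expr2 lerXn2r ?nnegrE ?nrm_ge0 ?(ltW (t0 k)) //.
    by apply: le_trans (psiF k) _; rewrite -/(t k) expr2 ler_piMl // ltW.
(* An upper limit is measurable without any convergence, and [fine] supplies a value on the null set
   where the sequence may diverge. *)
pose g : W := fun r s j =>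
  (fine (limn_esup (fun k => (complex.Re (E k r s j))%:E))
   +i* fine (limn_esup (fun k => (complex.Im (E k r s j))%:E)))%C.
have mg : measurable_wave g.
  move=> s j; split; apply: (measurableT_comp (fine_measurable measurableT)) => //;
    apply: measurable_fun_limn_esup => k; apply/measurable_EFinP; by have [] := mE k s j.
have bg : bloch 0 g.
  apply/bloch0P => a b.
  have : {ae mu2, forall r k, forall s j, E k (r + gamma R a b) s j = E k r s j}.
    apply: (@ae_foralln _ _ _ mu2 (fun k (r : RR) =>
      forall s j, E k (r + gamma R a b) s j = E k r s j)).
    by move=> k; have [_ /bloch0P/(_ a b)] := pE k.
  by apply: filterS => r h s j; rewrite /g; congr Complex; congr fine; congr limn_esup;
    apply/funext => k; rewrite h.
have small k r s j : normc (E k.+1 r s j - E k r s j) <= G k r.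
  have := normc_dens (wsub (E k.+1) (E k)) r s j; rewrite -/(D k r) /wsub.
  move: (normc _) (normc_ge0 (E k.+1 r s j - E k r s j)) => x x0 xD.
  rewrite /G -(ler_pM2r (t0 k)) mulrDl divfK ?gt_eqF //.
  apply: le_trans (lerD (lexx _) xD); have := sqr_ge0 (t k - x).
  have := mulr_ge0 x0 (ltW (t0 k)).
  by rewrite sqrrB -!expr2 => *; lra.
have cvg_part (P : C -> R) : {morph P : x y / x - y >-> x - y} ->
    (forall z, `|P z| <= normc z) ->
    forall r s j, (\sum_(0 <= k <oo) (G k r)%:E < +oo)%E ->
    (fun k => P (E k r s j)) @ \oo --> fine (limn_esup (fun k => (P (E k r s j))%:E)).
  move=> PB Ple r s j Goo.
  have : cvgn (series (telescope (fun k => P (E k r s j)))).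
    apply: (cvgn_series_dominated (G := G ^~ r)) => // k.
    by rewrite /telescope /= -PB; apply: le_trans (Ple _) (small k r s j).
  rewrite telescopeK => cv; have {}cv : cvgn (fun k => P (E k r s j)).
    have -> : (fun k => P (E k r s j)) = (fun k =>
      (P (E k r s j) - P (E 0%N r s j)) + P (E 0%N r s j)).
      by apply/funext => k; rewrite subrK.
    by apply: is_cvgD => //; exact: is_cvg_cst.
  have /cvg_ex[l hl] := cv.
  have hE : (fun k => (P (E k r s j))%:E) @ \oo --> l%:E by apply: cvg_EFin => //; exact: nearW.
  by have [_ ->] := cvg_limn_einf_sup hE.
have aeE : {ae mu2, forall r, Om r -> forall s j,
    ((fun k => complex.Re (E k r s j)) @ \oo --> complex.Re (g r s j)) /\
    ((fun k => complex.Im (E k r s j)) @ \oo --> complex.Im (g r s j))}.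
  move: aeG; apply: filterS => r h Or s j; split.
    apply: (cvg_part (@complex.Re R)) (h Or) => [x y|z]; [by rewrite ReD ReN|exact: Re_le_normc].
  apply: (cvg_part (@complex.Im R)) (h Or) => [x y|z]; [by rewrite ImD ImN|exact: Im_le_normc].
have mFg n : measurable_wave (wsub (F n) g).
  move=> s j; have [mf _ _] := pF n; have [m1 m2] := mf s j; have [m3 m4] := mg s j.
  split; rewrite /wsub.
    by under eq_fun do rewrite ReD ReN; exact: measurable_funB.
  by under eq_fun do rewrite ImD ImN; exact: measurable_funB.
(* Fatou along the subsequence [E] turns a Cauchy bound into a bound on the distance to [g]. *)
have lim_le n n0 e : 0 <= e -> (forall m, (n0 <= m)%N -> nrm (wsub (F n) (F m)) <= e) ->
    (\int[mu2]_(r in Om) (dens (wsub (F n) g) r)%:E <= (e ^+ 2)%:E)%E.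
  move=> e0 he; apply: (@fatou_le (fun k => dens (wsub (F n) (E k)))).
  - by move=> k; apply: measurable_dens; have [] := L2perB (pF n) (pE k).
  - by move=> k r; exact: dens_ge0.
  - by apply: measurable_dens; exact: mFg.
  - by move=> r; exact: dens_ge0.
  - move: aeE; apply: filterS => r h Or; rewrite /dens.
    apply: cvgn_sum => s; apply: cvgn_sum => j; have [h1 h2] := h Or s j.
    have ew (w : W) : normc (wsub (F n) w r s j) ^+ 2 =
        (complex.Re (F n r s j) - complex.Re (w r s j)) * (complex.Re (F n r s j) - complex.Re (w r s j)) +
        (complex.Im (F n r s j) - complex.Im (w r s j)) * (complex.Im (F n r s j) - complex.Im (w r s j)).
      by rewrite normc2 /wsub ReD ImD ReN ImN !expr2.
    rewrite ew; under eq_fun do rewrite ew.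
    by apply: cvgD; apply: cvgM; apply: cvgB => //; exact: cvg_cst.
  - exists n0 => // k /= nk; rewrite int_dens; last exact: L2perB.
    rewrite lee_fin lerXn2r ?nnegrE ?nrm_ge0 //.
    by apply: he; exact: leq_trans (psik k).
have pg : L2per g.
  have [n0 hn0] := cauchyF ltr01.
  have := lim_le n0 n0 1 ler01 (hn0 n0 ^~ (leqnn _)).
  move=> h; have pFg : L2per (wsub (F n0) g).
    split; [exact: mFg| |by apply: le_lt_trans h (ltry _)].
    have [_ /bloch0P b1 _] := pF n0; apply/bloch0P => a b.
    have := b1 a b; have := (bloch0P g).1 bg a b.
    by apply: filterS2 => r e1 e2 s j; rewrite /wsub e1 e2.
  have -> : g = wsub (F n0) (wsub (F n0) g); last exact: L2perB.
  by apply/funext => r; apply/funext => s; apply/funext => j; rewrite /wsub opprB addrC subrK.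
exists g; split=> // e e0; have [n0 hn0] := cauchyF e0.
exists n0 => n nn; apply: nrm_le_int; first exact: ltW.
by apply: (lim_le n n0); [exact: ltW|move=> m nm; exact: hn0].
Qed.
End CauchySequence.
End Completeness.

(** * Bessel, expansion and Parseval for a total orthonormal family *)

Section OrthonormalBasis.
Variables (R : realType) (N : nat).
Local Notation C := R[i].
Local Notation W := (wave R N).
Implicit Types f g : W.

Lemma normc_sqr_conj (z : C) : z^*%C * z = (normc z ^+ 2)%:C%C.
Proof. by rewrite normc2; case: z => x y; apply: eqC; rewrite ?ReM ?ImM /=; ring. Qed.

Lemma complex_real_le_eps (x : R) : (forall e, 0 < e -> x <= e) -> x <= 0.
Proof. by move=> h; rewrite leNgt; apply/negP => x0; have := h (x / 2); lra. Qed.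

Lemma normc_le_eps (z : C) (K : R) : (forall e, 0 < e -> normc z <= K * e) -> z = 0.
Proof.
move=> h; apply: ComplexField.Normc.eq0_normc; apply/eqP; rewrite eq_le normc_ge0 andbT.
apply: complex_real_le_eps => e e0; have K1 : 0 < `|K| + 1 by rewrite ltr_pwDr.
apply: le_trans (h (e / (`|K| + 1)) _) _; first exact: divr_gt0.
rewrite mulrCA ger_pMr // ler_pdivrMr // mul1r.
by rewrite (le_trans (ler_norm K)) // lerDl.
Qed.

Lemma pythagoras f g : L2per f -> L2per g -> inner f g = 0 ->
  nrm (wadd f g) ^+ 2 = nrm f ^+ 2 + nrm g ^+ 2.
Proof.
move=> pf pg fg; apply: complexI; rewrite rmorphD -!inner_nrm //; last exact: L2perD.
rewrite innerDl ?innerDr //; try exact: L2perD.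
by rewrite (inner_conj pf pg) fg conjc0 addr0 add0r !inner_nrm.
Qed.

Variables (I : eqType) (A : set I) (l : nat -> seq I) (e : I -> W).
Hypothesis lu : forall n, uniq (l n).
Hypothesis lS : forall m n, (m <= n)%N -> {subset l m <= l n}.
Hypothesis lA : forall n i, i \in l n -> A i.
Hypothesis Al : forall i, A i -> exists n, i \in l n.
Hypothesis pe : forall i, A i -> L2per (e i).
Hypothesis oe : forall i j, A i -> A j -> inner (e i) (e j) = (i == j)%:R.

(** The increasing lists [l n] exhaust the index set and fix an order of summation. They are
    instantiated twice: by squares of frequencies for the plane waves, and by intervals of nonzero
    integers for the Bloch basis. *)
Definition partial (n : nat) f : W := wsum (l n) (fun i => inner (e i) f) e.

Lemma L2per_partial n f : L2per (partial n f).
Proof. by apply: L2per_wsum => i il; apply: pe; exact: lA il. Qed.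

Lemma inner_partial n i f : i \in l n -> inner (e i) (partial n f) = inner (e i) f.
Proof.
move=> il; have Ai := lA il; rewrite inner_wsumr; last 2 first.
- exact: pe.
- by move=> k kl; apply: pe; exact: lA kl.
rewrite (bigD1_seq i) //= oe // eqxx mulr1 big_seq_cond big1 ?addr0 // => k /andP[kl ki].
by rewrite oe //; [rewrite eq_sym (negbTE ki) mulr0|exact: lA kl].
Qed.

Lemma inner_residue n i f : L2per f -> i \in l n -> inner (e i) (wsub f (partial n f)) = 0.
Proof.
move=> pf il; rewrite innerBr ?inner_partial ?subrr //.
- by apply: pe; exact: lA il.
- exact: L2per_partial.
Qed.

Lemma inner_wsum_residue n m (c : I -> C) f : (n <= m)%N -> L2per f ->
  inner (wsum (l n) c e) (wsub f (partial m f)) = 0.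
Proof.
move=> nm pf; have pr : L2per (wsub f (partial m f)) by apply: L2perB => //; exact: L2per_partial.
rewrite inner_wsuml //; last by move=> i il; apply: pe; exact: lA il.
rewrite big_seq big1 // => i il; rewrite inner_residue ?mulr0 //.
exact: lS il.
Qed.

Lemma nrm_partial n f : nrm (partial n f) ^+ 2 = \sum_(i <- l n) normc (inner (e i) f) ^+ 2.
Proof.
apply: complexI; rewrite -inner_nrm; last exact: L2per_partial.
rewrite rmorph_sum {1}/partial inner_wsuml; last 2 first.
- exact: L2per_partial.
- by move=> i il; apply: pe; exact: lA il.
rewrite [LHS]big_seq [RHS]big_seq; apply: eq_bigr => i il.
by rewrite inner_partial // normc_sqr_conj.
Qed.

Lemma nrm_residue n f : L2per f ->
  nrm f ^+ 2 = nrm (partial n f) ^+ 2 + nrm (wsub f (partial n f)) ^+ 2.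
Proof.
move=> pf; rewrite -pythagoras.
- congr (nrm _ ^+ 2); apply/funext => r; apply/funext => s; apply/funext => j.
  by rewrite /wadd /wsub addrC subrK.
- exact: L2per_partial.
- by apply: L2perB => //; exact: L2per_partial.
- exact: inner_wsum_residue.
Qed.

Lemma bessel n f : L2per f -> \sum_(i <- l n) normc (inner (e i) f) ^+ 2 <= nrm f ^+ 2.
Proof. by move=> pf; rewrite (nrm_residue n pf) nrm_partial lerDl sqr_ge0. Qed.

Lemma nrm_partial_sub n m f : (n <= m)%N -> L2per f ->
  nrm (wsub (partial m f) (partial n f)) ^+ 2 =
  nrm (partial m f) ^+ 2 - nrm (partial n f) ^+ 2.
Proof.
move=> nm pf; have pm := L2per_partial m f; have pn := L2per_partial n f.
have e1 : nrm (wsub f (partial n f)) ^+ 2 =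
    nrm (wsub (partial m f) (partial n f)) ^+ 2 + nrm (wsub f (partial m f)) ^+ 2.
  rewrite -pythagoras; try exact: L2perB.
    congr (nrm _ ^+ 2); apply/funext => r; apply/funext => s; apply/funext => j.
    by rewrite /wadd /wsub; ring.
  rewrite innerBl //; last exact: L2perB.
  by rewrite inner_wsum_residue // inner_wsum_residue // subrr.
have := nrm_residue n pf; have := nrm_residue m pf; rewrite e1; lra.
Qed.

Hypothesis te : forall f, L2per f -> (forall i, A i -> inner (e i) f = 0) -> eqae f (@wzero R N).

(** The square norms of the partial sums increase and are bounded by Bessel, so the partial sums are
    Cauchy. Their limit has the same coefficients as [f], and totality identifies the two. *)
Lemma partial_cvg f : L2per f -> forall eps, 0 < eps ->
  exists n0, forall n, (n0 <= n)%N -> nrm (wsub f (partial n f)) <= eps.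
Proof.
move=> pf.
have pp n := L2per_partial n f.
pose a n := nrm (partial n f) ^+ 2.
have a_nd : nondecreasing_seq a.
  by move=> n m nm; rewrite -subr_ge0 -(nrm_partial_sub nm pf) sqr_ge0.
have a_ub : has_ubound (range a).
  by exists (nrm f ^+ 2) => _ [n _ <-]; rewrite /a nrm_partial; exact: bessel.
have a_cvg := nondecreasing_is_cvgn a_nd a_ub.
have a_cauchy eps : 0 < eps -> exists n0, forall n m, (n0 <= n)%N -> (n <= m)%N ->
    a m - a n <= eps.
  move=> e0; have /cvgrPdist_le/(_ (eps / 2) (divr_gt0 e0 (ltr0Sn _ 1)))[n0 _ hn0] := a_cvg.
  exists n0 => n m nn nm.
  have := hn0 n nn; have := hn0 m (leq_trans nn nm).
  rewrite !ler_norml => /andP[h1 h2] /andP[h3 h4]; move: (limn _) h1 h2 h3 h4 => L h1 h2 h3 h4; lra.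
have cau eps : 0 < eps -> exists n0, forall m n, (n0 <= m)%N -> (n0 <= n)%N ->
    nrm (wsub (partial m f) (partial n f)) <= eps.
  move=> e0; have [n0 hn0] := a_cauchy (eps ^+ 2) (exprn_gt0 2 e0).
  have main m n : (n0 <= n)%N -> (n <= m)%N -> nrm (wsub (partial m f) (partial n f)) <= eps.
    move=> nn nm; rewrite -(ler_pXn2r (n := 2)) ?nnegrE ?nrm_ge0 ?(ltW e0) //.
    by rewrite nrm_partial_sub //; exact: hn0.
  exists n0 => m n mm nn; have [nm|/ltnW mn] := leqP n m; first exact: main.
  rewrite nrm_subC //.
  exact: main.
have [g [pg hg]] := L2per_complete (L2per_partial ^~ f) cau.
have fg : eqae f g.
  apply: nrm_subr0 => //.
  have pfg := L2perB pf pg.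
  rewrite (nrm_ae (g := @wzero R N)) ?nrm_wzero //.
  apply: te => // i Ai; have pi := pe Ai.
  apply: (@normc_le_eps _ (nrm (e i))) => eps e0.
  have [n0 hn0] := hg eps e0; have [n1 il] := Al Ai.
  pose n := maxn n0 n1.
  have -> : inner (e i) (wsub f g) = inner (e i) (wsub (partial n f) g).
    rewrite !innerBr // inner_partial //.
    by apply: (lS _ il); exact: leq_maxr.
  apply: le_trans (cauchy_schwarz pi (L2perB (pp n) pg)) _.
  by rewrite ler_wpM2l ?nrm_ge0 //; apply: hn0; exact: leq_maxl.
move=> eps e0; have [n0 hn0] := hg eps e0; exists n0 => n nn.
have -> : nrm (wsub f (partial n f)) = nrm (wsub (partial n f) g); last exact: hn0.
rewrite (nrm_ae (g := wscale (-1) (wsub (partial n f) g))).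
  by rewrite nrm_opp //; exact: L2perB.
by move: fg; apply: filterS => r h s j; rewrite /wsub /wscale h mulN1r opprB.
Qed.

Lemma parseval f g : L2per f -> L2per g -> forall eps, 0 < eps ->
  exists n0, forall n, (n0 <= n)%N ->
  normc (inner f g - \sum_(i <- l n) (inner (e i) f)^*%C * inner (e i) g) <= eps.
Proof.
move=> pf pg eps e0; have K0 : 0 < nrm f + 1 by rewrite ltr_pwDr // nrm_ge0.
have [n0 hn0] := partial_cvg pg (divr_gt0 e0 K0).
exists n0 => n nn; have pn := L2per_partial n g.
have -> : \sum_(i <- l n) (inner (e i) f)^*%C * inner (e i) g = inner f (partial n g).
  rewrite inner_wsumr //; last by move=> i il; apply: pe; exact: lA il.
  rewrite [LHS]big_seq [RHS]big_seq; apply: eq_bigr => i il.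
  by rewrite mulrC (inner_conj (pe (lA il)) pf).
rewrite -innerBr //; apply: le_trans (cauchy_schwarz pf (L2perB pg pn)) _.
apply: le_trans (ler_wpM2l (nrm_ge0 f) (hn0 n nn)) _.
by rewrite mulrCA ger_pMr // ler_pdivrMr // mul1r lerDl.
Qed.

Section DiagonalOperator.
Variables (T : W -> W) (K : R) (lam : I -> C).
Hypothesis linT : linear_op T.
Hypothesis bT : opnorm_le T K.
Hypothesis eT : forall i, A i -> eqae (T (e i)) (wscale (lam i) (e i)).

Lemma linear_op_sub f g : L2per f -> L2per g ->
  eqae (T (wsub f g)) (wsub (T f) (T g)).
Proof.
move=> pf pg; have := linT (-1) pg pf.
have -> : wadd (wscale (-1) g) f = wsub f g.
  by apply/funext => r; apply/funext => s; apply/funext => j;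
    rewrite /wadd /wscale /wsub mulN1r addrC.
move=> h; apply: (eqae_trans h); apply: nearW => r s j.
by rewrite /wadd /wscale /wsub mulN1r addrC.
Qed.

(** No adjoint of [T] is at hand to be applied to [e i]. The identity is checked on the partial sums
    of [f] and passes to the limit because [T] is bounded. *)
Lemma inner_diagonal i f : A i -> L2per f -> inner (e i) (T f) = lam i * inner (e i) f.
Proof.
move=> Ai pf; have pi := pe Ai.
have pT g : L2per g -> L2per (T g) by move=> /bT[].
apply: subr0_eq; apply: (@normc_le_eps _ (nrm (e i) * `|K|)) => eps e0.
have [n0 hn0] := partial_cvg pf e0; have [n1 il1] := Al Ai.
pose n := maxn n0 n1; have pn := L2per_partial n f.
have il : i \in l n by apply: (lS _ il1); exact: leq_maxr.
have TS (s : seq I) (c : I -> C) : {in s, forall k, A k} ->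
    eqae (T (wsum s c e)) (wsum s (fun k => c k * lam k) e).
  elim: s => [|k s IHs] sA.
    have z0 : eqae (T (@wzero R N)) (wsub (T (@wzero R N)) (T (@wzero R N))).
      have := linear_op_sub (L2per_zero R N) (L2per_zero R N).
      have -> : wsub (@wzero R N) (@wzero R N) = @wzero R N; last by [].
      by apply/funext => r; apply/funext => ss; apply/funext => j; rewrite /wsub subrr.
    rewrite !wsum_nil; apply: (eqae_trans z0); apply: nearW => r ss j.
    by rewrite /wsub subrr.
  have Ak : A k by apply: sA; rewrite mem_head.
  have As : {in s, forall k, A k} by move=> q qs; apply: sA; rewrite in_cons qs orbT.
  rewrite !wsum_cons; apply: (eqae_trans (linT _ (pe Ak) _)).
    by apply: L2per_wsum => q qs; apply: pe; exact: As.
  apply: eqaeD; last exact: IHs.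
  apply: (eqae_trans (eqaeZ _ (eT Ak))); apply: nearW => r ss j.
  by rewrite /wscale mulrA.
have -> : inner (e i) (T f) - lam i * inner (e i) f = inner (e i) (T (wsub f (partial n f))).
  rewrite (inner_ae (eqae_refl _) (linear_op_sub pf pn)).
  rewrite innerBr //; try exact: pT.
  congr (_ - _).
  have pl : L2per (wsum (l n) (fun k => inner (e k) f * lam k) e).
    by apply: L2per_wsum => k kl; apply: pe; exact: lA kl.
  rewrite (inner_ae (eqae_refl _) (TS _ _ _)); last by move=> k; exact: lA.
  rewrite inner_wsumr //; last by move=> k kl; apply: pe; exact: lA kl.
  rewrite (bigD1_seq i) //= oe // eqxx mulr1 big_seq_cond big1 ?addr0; first by rewrite mulrC.
  move=> k /andP[kl ki]; rewrite oe //; [by rewrite eq_sym (negbTE ki) mulr0|exact: lA kl].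
apply: le_trans (cauchy_schwarz pi (pT _ (L2perB pf pn))) _.
rewrite -mulrA ler_wpM2l ?nrm_ge0 //.
have [_ h] := bT (L2perB pf pn).
have h2 : nrm (wsub f (partial n f)) <= eps by apply: hn0; exact: leq_maxl.
apply: le_trans h _.
apply: (@le_trans _ _ (`|K| * nrm (wsub f (partial n f)))).
  by rewrite ler_wpM2r ?nrm_ge0 // ler_norm.
by rewrite ler_wpM2l.
Qed.
End DiagonalOperator.
End OrthonormalBasis.

Lemma cvgn_le (R : realType) (u : R^nat) (l K : R) :
  u @ \oo --> l -> (forall n, u n <= K) -> l <= K.
Proof. by move=> ul uK; apply: (cvgr_to_le ul); exact: nearW. Qed.

Lemma cvgn_ge (R : realType) (u : R^nat) (l K : R) :
  u @ \oo --> l -> (forall n, K <= u n) -> K <= l.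
Proof. by move=> ul uK; apply: (cvgr_to_ge ul); exact: nearW. Qed.

(** * Completeness of the Fourier basis *)

Section FourierUniqueness.
Variable R : realType.
Local Notation MR := (measurableTypeR R).
Local Notation RR := (MR * MR)%type.
Local Notation mu2 := (@mu2 R).
Local Notation Om := (Omega : set RR).
Implicit Types (u v m : RR -> R) (r : RR) (a b : int).

Let mO := @measurable_Omega R.
Hint Resolve mO : core.

Definition bm v := measurable_fun setT v /\ exists K : R, forall r, `|v r| <= K.

Lemma bmM u v : bm u -> bm v -> bm (fun r => u r * v r).
Proof.
move=> [mu [K uK]] [mv [L vL]]; split; first exact: measurable_funM.
by exists (K * L) => r; rewrite normrM ler_pM.
Qed.

Lemma bmD u v : bm u -> bm v -> bm (fun r => u r + v r).
Proof.
move=> [mu [K uK]] [mv [L vL]]; split; first exact: measurable_funD.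
by exists (K + L) => r; rewrite (le_trans (ler_normD _ _)) // lerD.
Qed.

Lemma bm_cst (c : R) : bm (cst c).
Proof. by split; [exact: measurable_cst|exists `|c|]. Qed.

Lemma bmZ (c : R) v : bm v -> bm (fun r => c * v r).
Proof. exact: bmM (bm_cst c). Qed.

Definition cosG a b r : R := cos (dotp (gammaS R a b) r).
Definition sinG a b r : R := sin (dotp (gammaS R a b) r).

Lemma bm_cosG a b : bm (cosG a b).
Proof.
split; first exact: (measurableT_comp (@measurable_cos R) (measurable_dotp _)).
by exists 1 => r; exact: cos_max.
Qed.

Lemma bm_sinG a b : bm (sinG a b).
Proof.
split; first exact: (measurableT_comp (@measurable_sin R) (measurable_dotp _)).
by exists 1 => r; rewrite ler_norml sin_geN1 sin_le1.
Qed.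

Variable f : RR -> R.
Hypothesis fi : mu2.-integrable Om (fun r => (f r)%:E).
Hypothesis mf : measurable_fun setT f.

Definition J v : R := \int[mu2]_(r in Om) (f r * v r).

Lemma J_intg v : bm v -> mu2.-integrable Om (fun r => (f r * v r)%:E).
Proof.
move=> [mv [K vK]]; apply: (@integrable_le _ _ (fun r => K * `|f r|)).
- exact: measurable_funM.
- by apply: eq_integrable (integrableZl mO K (integrable_norm fi)).
- by move=> r; rewrite normrM mulrC ler_wpM2r.
Qed.

Lemma JD u v : bm u -> bm v -> J (fun r => u r + v r) = J u + J v.
Proof.
move=> bu bv; rewrite /J -RintegralD //; try exact: J_intg.
by apply: eq_Rintegral => r _; rewrite mulrDr.
Qed.

Lemma JZ (c : R) v : bm v -> J (fun r => c * v r) = c * J v.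
Proof.
move=> bv; rewrite /J -RintegralZl //; last exact: J_intg.
by apply: eq_Rintegral => r _; rewrite mulrCA.
Qed.

Definition orthoG v := forall a b,
  J (fun r => v r * cosG a b r) = 0 /\ J (fun r => v r * sinG a b r) = 0.

(* The functions m such that multiplication by m preserves orthogonality of f v
   to all the characters. They form an algebra that contains the characters and
   is closed under bounded pointwise limits, hence all indicators. *)
Definition multiplier m := bm m /\ forall v, bm v -> orthoG v -> orthoG (fun r => m r * v r).

Lemma multiplierM m1 m2 : multiplier m1 -> multiplier m2 -> multiplier (fun r => m1 r * m2 r).
Proof.
move=> [b1 h1] [b2 h2]; split; first exact: bmM.
move=> v bv ov; under eq_fun do rewrite -mulrA.
by apply: h1; [exact: bmM|exact: h2].
Qed.

Lemma multiplierD m1 m2 : multiplier m1 -> multiplier m2 -> multiplier (fun r => m1 r + m2 r).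
Proof.
move=> [b1 h1] [b2 h2]; split; first exact: bmD.
move=> v bv ov a b; have [c1 s1] := h1 v bv ov a b; have [c2 s2] := h2 v bv ov a b.
have bc := bm_cosG a b; have bs := bm_sinG a b.
split; under eq_fun do rewrite mulrDl mulrDl.
  by rewrite (JD (bmM (bmM b1 bv) bc) (bmM (bmM b2 bv) bc)) c1 c2 addr0.
by rewrite (JD (bmM (bmM b1 bv) bs) (bmM (bmM b2 bv) bs)) s1 s2 addr0.
Qed.

Lemma multiplier_cst (c : R) : multiplier (cst c).
Proof.
split; first exact: bm_cst.
move=> v bv ov a b; have [h1 h2] := ov a b.
split; under eq_fun do rewrite /= -mulrA.
  by rewrite (JZ c (bmM bv (bm_cosG a b))) h1 mulr0.
by rewrite (JZ c (bmM bv (bm_sinG a b))) h2 mulr0.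
Qed.

Lemma multiplierZ (c : R) m : multiplier m -> multiplier (fun r => c * m r).
Proof. by move=> hm; apply: multiplierM => //; exact: multiplier_cst. Qed.

Lemma multiplierB m1 m2 : multiplier m1 -> multiplier m2 -> multiplier (fun r => m1 r - m2 r).
Proof.
move=> h1 h2; under eq_fun do rewrite -mulN1r.
by apply: multiplierD => //; exact: multiplierZ.
Qed.

Lemma cosGD a b c d r : cosG (a + c) (b + d) r = cosG a b r * cosG c d r - sinG a b r * sinG c d r.
Proof. by rewrite /cosG /sinG gammaSD dotpDl cosD. Qed.
Lemma sinGD a b c d r : sinG (a + c) (b + d) r = sinG a b r * cosG c d r + cosG a b r * sinG c d r.
Proof. by rewrite /cosG /sinG gammaSD dotpDl sinD. Qed.
Lemma cosGN a b r : cosG (- a) (- b) r = cosG a b r.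
Proof. by rewrite /cosG gammaSN dotpNl cosN. Qed.
Lemma sinGN a b r : sinG (- a) (- b) r = - sinG a b r.
Proof. by rewrite /sinG gammaSN dotpNl sinN. Qed.

(** By the product-to-sum formulas, multiplication by a character only shifts the frequencies
    tested. *)
Lemma multiplier_cosG c d : multiplier (cosG c d).
Proof.
split; first exact: bm_cosG.
move=> v bv ov a b; have [c1 s1] := ov (a + c) (b + d); have [c2 s2] := ov (a - c) (b - d).
have B1 := bmM bv (bm_cosG (a + c) (b + d)); have B2 := bmM bv (bm_cosG (a - c) (b - d)).
have B3 := bmM bv (bm_sinG (a + c) (b + d)); have B4 := bmM bv (bm_sinG (a - c) (b - d)).
split.
  have -> : (fun r => cosG c d r * v r * cosG a b r) =
      (fun r => 2^-1 * (v r * cosG (a + c) (b + d) r + v r * cosG (a - c) (b - d) r)).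
    by apply/funext => r; rewrite !cosGD cosGN sinGN; field.
  by rewrite JZ ?JD ?c1 ?c2 ?addr0 ?mulr0 //; exact: bmD.
have -> : (fun r => cosG c d r * v r * sinG a b r) =
    (fun r => 2^-1 * (v r * sinG (a + c) (b + d) r + v r * sinG (a - c) (b - d) r)).
  by apply/funext => r; rewrite !sinGD cosGN sinGN; field.
by rewrite JZ ?JD ?s1 ?s2 ?addr0 ?mulr0 //; exact: bmD.
Qed.

Lemma multiplier_sinG c d : multiplier (sinG c d).
Proof.
split; first exact: bm_sinG.
move=> v bv ov a b; have [c1 s1] := ov (a + c) (b + d); have [c2 s2] := ov (a - c) (b - d).
have B1 := bmM bv (bm_cosG (a + c) (b + d)); have B2 := bmM bv (bm_cosG (a - c) (b - d)).
have B3 := bmM bv (bm_sinG (a + c) (b + d)); have B4 := bmM bv (bm_sinG (a - c) (b - d)).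
split.
  have -> : (fun r => sinG c d r * v r * cosG a b r) =
      (fun r => 2^-1 * (v r * sinG (a + c) (b + d) r + (-1) * (v r * sinG (a - c) (b - d) r))).
    by apply/funext => r; rewrite !sinGD cosGN sinGN; field.
  by rewrite (JZ _ (bmD B3 (bmZ (-1) B4))) (JD B3 (bmZ (-1) B4)) (JZ (-1) B4) s1 s2 mulr0 addr0 mulr0.
have -> : (fun r => sinG c d r * v r * sinG a b r) =
    (fun r => 2^-1 * (v r * cosG (a - c) (b - d) r + (-1) * (v r * cosG (a + c) (b + d) r))).
  by apply/funext => r; rewrite !cosGD cosGN sinGN; field.
by rewrite (JZ _ (bmD B2 (bmZ (-1) B1))) (JD B2 (bmZ (-1) B1)) (JZ (-1) B1) c1 c2 mulr0 addr0 mulr0.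
Qed.

Lemma J_lim (v_ : nat -> RR -> R) v (K : R) : (forall n, measurable_fun setT (v_ n)) ->
  measurable_fun setT v -> (forall n r, `|v_ n r| <= K) -> (forall r, v_ ^~ r @ \oo --> v r) ->
  (forall n, J (v_ n) = 0) -> J v = 0.
Proof.
move=> mv_ mv vK vv J0.
have b_ n : bm (v_ n) by split => //; exists K.
pose F n r := (f r * v_ n r)%:E.
have mF n : measurable_fun Om (F n).
  by apply: measurable_funTS; apply/measurable_EFinP; exact: measurable_funM.
have mG : measurable_fun Om (fun r => (f r * v r)%:E).
  by apply: measurable_funTS; apply/measurable_EFinP; exact: measurable_funM.
have cF : {ae mu2, forall r, Om r -> F ^~ r @ \oo --> (f r * v r)%:E}.
  apply: nearW => r _; apply: cvg_EFin; first exact: nearW.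
  by apply: cvgM; [exact: cvg_cst|exact: vv].
have ig : mu2.-integrable Om (fun r => (K * `|f r|)%:E).
  by apply: eq_integrable (integrableZl mO K (integrable_norm fi)).
have dF : {ae mu2, forall r n, Om r -> (`|F n r| <= (K * `|f r|)%:E)%E}.
  by apply: nearW => r n _; rewrite lee_fin normrM mulrC ler_wpM2r.
have [i1 _ i2] := @dominated_convergence _ _ _ mu2 Om mO F _ _ mF mG cF ig dF.
have F0 n : (\int[mu2]_(r in Om) F n r = 0)%E.
  have := J0 n; rewrite /J /Rintegral => e.
  by rewrite -[LHS]fineK ?e //; apply: (integrable_fin_num mO); exact: J_intg.
rewrite /J /Rintegral.
have : (\int[mu2]_(r in Om) (f r * v r)%:E = 0)%E.
  apply: (cvg_unique _ i2) => //=.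
  by under eq_fun do rewrite F0; exact: cvg_cst.
by move=> ->.
Qed.

Lemma multiplier_lim (m_ : nat -> RR -> R) m (K : R) : (forall n, multiplier (m_ n)) ->
  (forall n r, `|m_ n r| <= K) -> (forall r, m_ ^~ r @ \oo --> m r) -> multiplier m.
Proof.
move=> hm mK mm.
have Mm : measurable_fun setT m.
  apply: (@measurable_fun_cvg _ _ _ _ m_) => [n|r _]; last exact: mm.
  by have [[]] := hm n.
split.
  split=> //; exists K => r; exact: (cvgn_le (cvg_norm (mm r)) (fun n => mK n r)).
move=> v [mv [L vL]] ov a b.
have bv : bm v by split => //; exists L.
have lim (w : RR -> R) : bm w -> (forall n, J (fun r => m_ n r * v r * w r) = 0) ->
    J (fun r => m r * v r * w r) = 0.
  move=> [mw [L' wL]] J0; apply: (@J_lim (fun n r => m_ n r * v r * w r) _ (K * L * L')) => //.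
  - by move=> n; have [[m1 _] _] := hm n; apply: measurable_funM => //; exact: measurable_funM.
  - by apply: measurable_funM => //; exact: measurable_funM.
  - by move=> n r; rewrite !normrM ler_pM // ?mulr_ge0 // ler_pM.
  - by move=> r; apply: cvgM; [apply: cvgM; [exact: mm|exact: cvg_cst]|exact: cvg_cst].
split; apply: lim; [exact: bm_cosG| |exact: bm_sinG|];
  by move=> n; have [_ /(_ v bv ov a b)[]] := hm n.
Qed.

(* The iteration p <- p + (x^2 - p^2) / 2 increases to |x|. *)
Fixpoint abs_iter (n : nat) (x : R) : R :=
  if n is n'.+1 then abs_iter n' x + (x ^+ 2 - abs_iter n' x ^+ 2) / 2 else 0.

Lemma abs_iter_bound n x : `|x| <= 1 -> 0 <= abs_iter n x <= `|x|.
Proof.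
move=> x1; elim: n => [|n /andP[h1 h2]] /=; first by rewrite lexx normr_ge0.
rewrite -(sqr_norm_real x); move: (abs_iter n x) h1 h2 => p p0; move: (`|x|) x1 => y y1 py.
by apply/andP; split; nra.
Qed.

Lemma abs_iter_cvg x : `|x| <= 1 -> abs_iter ^~ x @ \oo --> `|x|.
Proof.
move=> x1.
have nd : nondecreasing_seq (abs_iter ^~ x).
  apply/nondecreasing_seqP => n /=; have /andP[h1 h2] := abs_iter_bound n x1.
  by rewrite lerDl divr_ge0 // subr_ge0 -(sqr_norm_real x) lerXn2r ?nnegrE.
have ub : has_ubound (range (abs_iter ^~ x)).
  by exists `|x| => _ [n _ <-]; have /andP[] := abs_iter_bound n x1.
have /cvg_ex[l hl] := nondecreasing_is_cvgn nd ub; rewrite -[nbhs _]/(nbhs _).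
have l0 : 0 <= l by apply: (cvgn_ge hl) => n; have /andP[] := abs_iter_bound n x1.
(* The limit is a nonnegative fixed point of the iteration, that is a nonnegative square root of
   x^2. *)
have hl2 : (fun n => abs_iter n.+1 x) @ \oo --> l + (x ^+ 2 - l * l) / 2.
  apply: cvgD => //; apply: cvgM; last exact: cvg_cst.
  by apply: cvgB; [exact: cvg_cst|under eq_fun do rewrite expr2; exact: cvgM].
have hl3 : (fun n => abs_iter n.+1 x) @ \oo --> l by move: hl;
  rewrite -(cvg_shiftS (abs_iter ^~ x)).
have e : l = l + (x ^+ 2 - l * l) / 2 by apply: (cvg_unique _ hl3 hl2).
have : `|x| ^+ 2 = l ^+ 2 by rewrite sqr_norm_real expr2; lra.
by move/eqP; rewrite eqrXn2 // => /eqP ->.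
Qed.

Lemma multiplier_abs m : multiplier m -> multiplier (fun r => `|m r|).
Proof.
move=> hm; have [[_ [K mK]] _] := hm.
pose L := `|K| + 1; have L0 : 0 < L by rewrite ltr_pwDr.
have mL r : `|m r / L| <= 1.
  rewrite normrM normfV (gtr0_norm L0) ler_pdivrMr // mul1r (le_trans (mK r)) //.
  by rewrite (le_trans (ler_norm K)) // lerDl.
have -> : (fun r => `|m r|) = (fun r => L * `|m r / L|).
  apply/funext => r; rewrite normrM normfV (gtr0_norm L0).
  by rewrite mulrCA mulfV ?mulr1 // gt_eqF.
apply: multiplierZ.
apply: (@multiplier_lim (fun n r => abs_iter n (m r / L)) _ 1).
- have hmL : multiplier (fun r => m r / L).
    by under eq_fun do rewrite mulrC; exact: multiplierZ.
  elim=> [|n IHn] /=; first exact: multiplier_cst.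
  apply: multiplierD => //; under eq_fun do rewrite mulrC !expr2.
  by apply: multiplierZ; apply: multiplierB; exact: multiplierM.
- move=> n r; have /andP[h1 h2] := abs_iter_bound n (mL r).
  by rewrite ger0_norm // (le_trans h2).
- by move=> r; apply: abs_iter_cvg.
Qed.

Definition msets : set (set RR) := [set A | multiplier (\1_A)].

Lemma msets_pos m : multiplier m -> msets [set r | 0 < m r].
Proof.
(* [p] is the positive part of [m] and [q n] is the minimum of 1 and n p, both written with absolute
   values; [q n] tends to the indicator of 0 < m. *)
move=> hm; pose p r := 2^-1 * (m r + `|m r|).
have hp : multiplier p by apply: multiplierZ; apply: multiplierD => //; exact: multiplier_abs.
pose q (n : nat) r := 2^-1 * ((1 + n%:R * p r) - `|1 - n%:R * p r|).
have hq n : multiplier (q n).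
  apply: multiplierZ; apply: multiplierB.
    by apply: multiplierD; [exact: multiplier_cst|exact: multiplierZ].
  by apply: multiplier_abs; apply: multiplierB; [exact: multiplier_cst|exact: multiplierZ].
have p0 r : 0 <= p r by rewrite /p mulr_ge0 // -lerBlDl add0r -normrN ler_norm.
apply: (@multiplier_lim q _ 1) => // [n r|r].
  rewrite /q; have := mulr_ge0 (ler0n R n) (p0 r); move: (_ * p r) => x x0.
  by have [h|h] := leP 0 (1 - x); [rewrite (ger0_norm h)|rewrite (ltr0_norm h)];
    rewrite ger0_norm; lra.
rewrite indicE; have [|] := boolP (r \in _); rewrite ?notin_setE ?inE /= => h.
  have pE : p r = m r by rewrite /p gtr0_norm //; lra.
  apply: cvg_near_cst; have [n0 hn0] : exists n0 : nat, (m r)^-1 <= n0%:R.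
    by exists (Num.bound (m r)^-1); rewrite ltW // archi_boundP // invr_ge0 ltW.
  exists n0 => // n /= nn; rewrite /q pE.
  have h1 : 1 <= n%:R * m r.
    have h0 : n0%:R <= n%:R :> R by rewrite ler_nat.
    have := ler_wpM2r (ltW h) (le_trans hn0 h0).
    by rewrite mulVf // lt0r_neq0.
  by rewrite ler0_norm; lra.
have pE : p r = 0 by rewrite /p ler0_norm ?subrr ?mulr0 // leNgt; exact/negP.
have -> : q ^~ r = cst 0.
  by apply/funext => n; rewrite /q pE mulr0 addr0 subr0 normr1 subrr mulr0.
exact: cvg_cst.
Qed.

Lemma msetsI A B : msets A -> msets B -> msets (A `&` B).
Proof.
move=> hA hB; rewrite /msets /=; have -> : \1_(A `&` B) = (fun r => \1_A r * \1_B r) :> (RR -> R).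
  by apply/funext => r; rewrite !indicE in_setI; case: (_ \in A); case: (_ \in B);
    rewrite /= ?mulr1 ?mulr0.
exact: multiplierM.
Qed.

Lemma msetsC A : msets A -> msets (~` A).
Proof.
move=> hA; rewrite /msets /=; have -> : \1_(~` A) = (fun r => 1 - \1_A r) :> (RR -> R).
  by apply/funext => r; rewrite !indicE in_setC; case: (_ \in A); rewrite /= ?subr0 ?subrr.
by apply: multiplierB => //; exact: multiplier_cst.
Qed.

Lemma msets0 : msets set0.
Proof. by rewrite /msets /= indic0; exact: multiplier_cst. Qed.

Lemma msets_bigcup (F : (set RR)^nat) : (forall n, msets (F n)) -> msets (\bigcup_n F n).
Proof.
move=> hF; pose G n := \bigcup_(k in [set k | (k < n)%N]) F k.
have hG n : msets (G n).
  elim: n => [|n IHn].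
    have -> : G 0%N = set0 by apply/seteqP; split => r // -[].
    exact: msets0.
  have -> : G n.+1 = ~` (~` G n `&` ~` F n).
    rewrite setCI !setCK; apply/seteqP; split => r.
      by case=> k /= kn Fk; move: kn; rewrite ltnS leq_eqVlt => /orP[/eqP <-|kn];
        [right|left; exists k].
    by case=> [[k /= kn Fk]|Fn]; [exists k => //=; exact: ltnW|exists n => /=].
  by apply: msetsC; apply: msetsI; apply: msetsC.
apply: (@multiplier_lim (fun n => \1_(G n)) _ 1) => // [n r|r].
  by rewrite indicE; case: (_ \in _); rewrite /= ?normr1 ?normr0.
rewrite indicE; have [|] := boolP (r \in _); rewrite ?notin_setE ?inE /= => h.
  have [k _ Fk] := h; apply: cvg_near_cst; exists k.+1 => // n /= kn.
  by rewrite indicE mem_set //; exists k.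
have -> : (fun n => \1_(G n) r) = cst (0 : R); last exact: cvg_cst.
apply/funext => n; rewrite indicE memNset // => -[k _ Fk]; apply: h; by exists k.
Qed.

Lemma msets_Omega : msets Om.
Proof.
have bO : bm (\1_Om : RR -> R).
  split; first exact: measurable_indic.
  by exists 1 => r; rewrite indicE; case: (_ \in _); rewrite /= ?normr1 ?normr0.
split=> // v bv ov a b; have JO w : J (fun r => \1_Om r * v r * w r) = J (fun r => v r * w r).
  by apply: eq_Rintegral => r rO; rewrite indicE rO mul1r.
by rewrite !JO.
Qed.

(** Modulo 1, the condition c < s describes an arc centred at (c + 1/2) / 2 of half-width (1/2 - c)
    / 2, and an arc is the set where a cosine exceeds a constant. This makes the rays of a cell
    coordinate positivity sets of trigonometric polynomials. *)
Lemma cos_arc (c s : R) : - 2^-1 <= c < 2^-1 -> - 2^-1 <= s < 2^-1 ->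
  (c < s) = (cos (2 * pi * ((2^-1 - c) / 2)) < cos (2 * pi * (s - (c + 2^-1) / 2))).
Proof.
move=> /andP[c1 c2] /andP[s1 s2]; have p0 := pi_gt0 R.
have t0 : 0 < 2 * pi :> R by lra.
set m := (c + 2^-1) / 2; set h := (2^-1 - c) / 2.
have I (x : R) : 0 <= x -> x <= 2^-1 -> 2 * pi * x \in `[0, pi].
  move=> x0 x1; have a1 := mulr_ge0 (ltW p0) x0; have a2 := ler_wpM2l (ltW p0) x1.
  by rewrite in_itv /= -mulrA; apply/andP; split; lra.
have Ih : 2 * pi * h \in `[0, pi] by apply: I; rewrite /h; lra.
have [cs|sc] := ltP c s.
  apply/esym; rewrite -(cos_norm (2 * pi * (s - m))) normrM (ger0_norm (ltW t0)).
  have h1 : `|s - m| < h by rewrite ltr_norml /m /h; apply/andP; split; lra.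
  have Is : 2 * pi * `|s - m| \in `[0, pi] by apply: I => //; move: h1; rewrite /h; lra.
  by rewrite (ltr_cos Is Ih) ltr_pM2l.
apply/esym/negbTE; rewrite -leNgt.
have -> : 2 * pi * (s - m) = - (2 * pi * (m - s)) by ring.
rewrite cosN; have [ms|ms] := leP (m - s) 2^-1.
  have Is : 2 * pi * (m - s) \in `[0, pi] by apply: I => //; rewrite /m; lra.
  by rewrite leNgt (ltr_cos Is Ih) ltr_pM2l // -leNgt /m /h; lra.
(* When m - s exceeds one half, the shorter way around the circle has length 1 - (m - s). *)
have -> : cos (2 * pi * (m - s)) = cos (2 * pi * (1 - (m - s))).
  rewrite -cosN -(cosD2pi (- _)); congr cos; rewrite mulr2n; ring.
have Is : 2 * pi * (1 - (m - s)) \in `[0, pi] by apply: I; move: ms; rewrite /m; lra.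
by rewrite leNgt (ltr_cos Is Ih) ltr_pM2l // -leNgt /m /h; lra.
Qed.

Lemma multiplier_cos_shift a b (t : R) : multiplier (fun r => cos (dotp (gammaS R a b) r - t)).
Proof.
under eq_fun do rewrite cosB mulrC [X in _ + X]mulrC.
apply: multiplierD; apply: multiplierZ; [exact: multiplier_cosG|exact: multiplier_sinG].
Qed.

Lemma msets_ray (x : RR -> R) a b : (forall r, dotp (gammaS R a b) r = 2 * pi * x r) ->
  (forall r, Om r -> - 2^-1 <= x r < 2^-1) ->
  forall c, msets (Om `&` [set r | c < x r]).
Proof.
move=> xE xO c.
have [c2|c2] := leP 2^-1 c.
  have -> : Om `&` [set r | c < x r] = set0; last exact: msets0.
  by apply/seteqP; split => r // -[/xO /andP[_ h1] /= h2]; lra.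
have [c1|c1] := ltP c (- 2^-1).
  have -> : Om `&` [set r | c < x r] = Om; last exact: msets_Omega.
  apply/seteqP; split => r; first by case.
  by move=> rO; split => //=; have /andP[h _] := xO r rO; lra.
have -> : Om `&` [set r | c < x r] = Om `&` [set r : RR |
    0 < cos (dotp (gammaS R a b) r - 2 * pi * ((c + 2^-1) / 2)) - cos (2 * pi * ((2^-1 - c) / 2))].
  apply/seteqP; split => r /= [rO h]; split => //; move: h;
    rewrite subr_gt0 xE -mulrBr -cos_arc ?c1 ?c2 //; exact: xO.
apply: msetsI; first exact: msets_Omega.
by apply: msets_pos; apply: multiplierB; [exact: multiplier_cos_shift|exact: multiplier_cst].
Qed.

(** The sets whose trace on the cell has a multiplier as indicator form a sigma-algebra [S]. Both
    cell coordinates are [S]-measurable, hence so is the identity of the plane, and [S] contains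
    every measurable set. *)
Lemma msets_measurable (A : set RR) : measurable A -> msets (Om `&` A).
Proof.
pose S : set (set RR) := [set A | msets (Om `&` A)].
have sS : sigma_algebra setT S.
  split; first by rewrite /S /= setI0; exact: msets0.
    move=> B hB; rewrite setTD /S /=.
    have -> : Om `&` ~` B = Om `&` ~` (Om `&` B).
      by rewrite setCI setIUr setICr set0U.
    by apply: msetsI; [exact: msets_Omega|exact: msetsC].
  move=> F hF; rewrite /S /= setI_bigcupr; exact: msets_bigcup.
pose T := g_sigma_algebraType S.
have TE (B : set T) : measurable B -> S B by rewrite /measurable /= sigma_algebra_id.
have ray (x : T -> MR) : (forall c, S [set r | c < x r]) -> measurable_fun setT x.
  move=> hx; apply: (measurability _ (RGenOInfty.measurableE R)) => //.
  move=> _ [_ [c ->] <-]; rewrite setTI; apply: sub_gen_smallest.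
  by have := hx c; congr S; apply/seteqP; split => r; rewrite /= in_itv /= andbT.
have m1 : measurable_fun setT (@coord1 R : T -> MR).
  apply: ray => c; apply: (@msets_ray (@coord1 R) 1 0).
    move=> r; rewrite /coord1 mulrC divfK; last by rewrite mulf_neq0 // pi_neq0.
    by congr dotp; rewrite /gammaS /lin2 !mul1r !mul0r !addr0; case: g1.
  by move=> r /OmegaE[].
have m2 : measurable_fun setT (@coord2 R : T -> MR).
  apply: ray => c; apply: (@msets_ray (@coord2 R) 0 1).
    move=> r; rewrite /coord2 mulrC divfK; last by rewrite mulf_neq0 // pi_neq0.
    by congr dotp; rewrite /gammaS /lin2 !mul1r !mul0r !add0r; case: g2.
  by move=> r /OmegaE[].
have mid : measurable_fun setT (fun r : T => r : RR).
  have -> : (fun r : T => r : RR) = (fun r : T =>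
      (coord1 r * (@v1 R).1 + coord2 r * (@v2 R).1,
        coord1 r * (@v1 R).2 + coord2 r * (@v2 R).2) : RR).
    by apply/funext => r; exact: lin2_coord.
  by apply/measurable_fun_pair; apply: measurable_funD; apply: measurable_funM.
move=> mA; have := mid measurableT A mA; rewrite setTI => /TE.
by [].
Qed.

(** All indicators are now orthogonal to [f], in particular 2 1_P - 1 with P the set where [f] is
    positive; the pairing with this function is the integral of |f|. *)
Lemma fourier_unique_real : orthoG (cst 1) -> ae_eq mu2 Om (fun r => (f r)%:E) (cst 0%E).
Proof.
move=> o1; have JA (A : set RR) : measurable A -> J \1_A = 0.
  move=> mA; have [_ h] := msets_measurable mA.
  have [e _] := h _ (bm_cst 1) o1 0 0; rewrite -e.
  apply: eq_Rintegral => r rO.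
  by rewrite /cosG gammaS0 dotp0l cos0 !mulr1 !indicE in_setI rO.
pose P : set RR := [set r | 0 < f r].
have mP : measurable P.
  have := mf measurableT (measurable_itv `]0, +oo[).
  by rewrite setTI; congr measurable; apply/seteqP; split => r; rewrite /= in_itv /= andbT.
have bP : bm (\1_P : RR -> R).
  split; first exact: measurable_indic.
  by exists 1 => r; rewrite indicE; case: (_ \in _); rewrite /= ?normr1 ?normr0.
have b1 : bm (\1_(setT : set RR) : RR -> R).
  split; first exact: measurable_indic.
  by exists 1 => r; rewrite indicE; case: (_ \in _); rewrite /= ?normr1 ?normr0.
have e : \int[mu2]_(r in Om) `|f r| = 0.
  transitivity (J (fun r => 2 * \1_P r + (-1) * \1_(setT : set RR) r)).
    apply: eq_Rintegral => r _; rewrite !indicE in_setT mulr1 /=.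
    have [|] := boolP (r \in P); rewrite ?notin_setE ?inE /P /= => h.
      by rewrite gtr0_norm //; ring.
    by rewrite ler0_norm; [ring|rewrite leNgt; exact/negP].
  rewrite JD ?JZ ?JA ?mulr0 ?addr0 //.
    exact: bmZ.
  exact: bmZ.
apply: (ae_eq_integral_abs mu2 mO _).1.
  by apply: measurable_funTS; apply/measurable_EFinP.
rewrite -[LHS]fineK; first by congr EFin.
by apply: (integrable_fin_num mO); exact: (integrable_norm fi).
Qed.
End FourierUniqueness.

Section FourierBasis.
Variables (R : realType) (N : nat).
Local Notation MR := (measurableTypeR R).
Local Notation RR := (MR * MR)%type.
Local Notation mu2 := (@mu2 R).
Local Notation Om := (Omega : set RR).
Local Notation C := R[i].
Local Notation W := (wave R N).
Implicit Types f g : W.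

Let mO := @measurable_Omega R.
Hint Resolve mO : core.

(** The frequencies G and -G combine into cosines and sines; these are real, so the real and
    imaginary parts of [h] satisfy the hypothesis separately. *)
Lemma csqi_fourier_unique (h : RR -> C) : csqi h ->
  (forall a b, cint Om (fun r => cis (- dotp (gammaS R a b) r) * h r) = 0) ->
  {ae mu2, forall r, Om r -> h r = 0}.
Proof.
move=> ch h0.
have cG a b : cintg (fun r => cis (- dotp (gammaS R a b) r) * h r).
  have := csqi_intg (csqi_cis (gammaS R (- a) (- b)) ch).
  by congr cintg; apply/funext => r; rewrite gammaSN dotpNl.
have hG a b : cint Om (fun r => cis (dotp (gammaS R a b) r) * h r) = 0.
  rewrite -(h0 (- a) (- b)); congr cint; apply/funext => r.
  by rewrite gammaSN dotpNl opprK.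
have cG' a b : cintg (fun r => cis (dotp (gammaS R a b) r) * h r).
  exact: csqi_intg (csqi_cis (gammaS R a b) ch).
have c0 a b : cint Om (fun r => (cosG a b r)%:C%C * h r) = 0.
  have := cintD (cG a b) (cG' a b); rewrite h0 hG addr0 => e.
  have ci : cintg (fun r => (cosG a b r)%:C%C * h r).
    have := cintgZ (2^-1) (cintgD (cG a b) (cG' a b)).
    congr cintg; apply/funext => r; rewrite /cosG cisN.
    by apply: eqC; rewrite !CE /cis /=; field.
  have : 2 * cint Om (fun r => (cosG a b r)%:C%C * h r) = 0.
    rewrite -cintZ // -[RHS]e; congr cint; apply/funext => r; rewrite /cosG cisN.
    by apply: eqC; rewrite !CE /cis /=; ring.
  by move/eqP; rewrite mulf_eq0 pnatr_eq0 /= => /eqP.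
have s0 a b : cint Om (fun r => (sinG a b r)%:C%C * h r) = 0.
  have := cintD (cG' a b) (cintgZ (-1) (cG a b)); rewrite cintZ // h0 hG mulr0 addr0 => e.
  have ci : cintg (fun r => (sinG a b r)%:C%C * h r).
    have := cintgZ ((2 * 'i%C)^-1) (cintgD (cG' a b) (cintgZ (-1) (cG a b))).
    congr cintg; apply/funext => r; rewrite /sinG cisN.
    have i0 : 2 * 'i%C != 0 :> C by rewrite mulf_neq0 ?pnatr_eq0 // eq_complex /= oner_eq0 andbF.
    apply: (mulfI i0); rewrite mulVKf //.
    by apply: eqC; rewrite !CE /cis /=; ring.
  have : (2 * 'i%C) * cint Om (fun r => (sinG a b r)%:C%C * h r) = 0.
    rewrite -cintZ // -[RHS]e; congr cint; apply/funext => r; rewrite /sinG cisN.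
    by apply: eqC; rewrite !CE /cis /=; ring.
  by move/eqP; rewrite mulf_eq0 mulf_eq0 pnatr_eq0 /= eq_complex /= oner_eq0 andbF /= => /eqP.
have [[mr _] [mi _]] := ch; have [ir ii] := csqi_intg ch.
have or : orthoG (fun r => complex.Re (h r)) (cst 1).
  move=> a b; rewrite /J; split.
    transitivity (complex.Re (cint Om (fun r => (cosG a b r)%:C%C * h r))); last by rewrite c0.
    by apply: eq_Rintegral => r _; rewrite ReM /=; ring.
  transitivity (complex.Re (cint Om (fun r => (sinG a b r)%:C%C * h r))); last by rewrite s0.
  by apply: eq_Rintegral => r _; rewrite ReM /=; ring.
have oi : orthoG (fun r => complex.Im (h r)) (cst 1).
  move=> a b; rewrite /J; split.
    transitivity (complex.Im (cint Om (fun r => (cosG a b r)%:C%C * h r))); last by rewrite c0.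
    by apply: eq_Rintegral => r _; rewrite ImM /=; ring.
  transitivity (complex.Im (cint Om (fun r => (sinG a b r)%:C%C * h r))); last by rewrite s0.
  by apply: eq_Rintegral => r _; rewrite ImM /=; ring.
have := fourier_unique_real ir mr or; have := fourier_unique_real ii mi oi.
by apply: filterS2 => r h1 h2 Or; have [e1] := h1 Or; have [e2] := h2 Or; exact: eqC.
Qed.

Lemma fourier_unique f : L2per f ->
  (forall a b s j, fourier (gammaS R a b) f s j = 0) -> eqae f (@wzero R N).
Proof.
move=> pf f0; apply: nrm_eq0 => //; apply/eqP; rewrite -(@eqrXn2 _ 2) ?nrm_ge0 // expr0n /=.
apply/eqP; apply: complexI; rewrite -inner_nrm // /inner.
rewrite big1 // => s _; rewrite big1 // => j _.
have cf := L2per_csqi s j pf.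
have ae0 := csqi_fourier_unique cf (fun a b => f0 a b s j).
rewrite (cint_ae (g := fun r => 0 * f r s j)).
  by rewrite cintZ ?mul0r //; exact: csqi_intg.
by move: ae0; apply: filterS => r h Or; rewrite h // mulr0 mul0r.
Qed.

Definition fidx : eqType := ((int * int) * (bool * 'I_N))%type.
Definition rtA : R := Num.sqrt (areaOmega R).
Definition fwave (q : fidx) : W := fun r s j =>
  if (s, j) == q.2 then (rtA^-1)%:C%C * cis (dotp (gammaS R q.1.1 q.1.2) r) else 0.
Definition zrange (n : nat) : seq int := [seq (i%:Z - n%:Z) | i <- iota 0 (2 * n).+1].
Definition frange (n : nat) : seq fidx :=
  [seq (x, p) | x <- [seq (a, b) | a <- zrange n, b <- zrange n], p <- enum {: bool * 'I_N}].

Lemma rtA_gt0 : 0 < rtA. Proof. by rewrite sqrtr_gt0 areaOmega_gt0. Qed.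

Lemma mem_zrange n (a : int) : (a \in zrange n) = (`|a|%N <= n)%N.
Proof.
apply/mapP/idP => [[k]|an]; first by rewrite mem_iota => ? ->; lia.
by exists (absz (a + n%:Z)%R); [rewrite mem_iota; lia|lia].
Qed.

Lemma uniq_zrange n : uniq (zrange n).
Proof. by rewrite map_inj_uniq ?iota_uniq // => i j; lia. Qed.

Lemma mem_frange n (q : fidx) :
  (q \in frange n) = (`|q.1.1| <= n)%N && (`|q.1.2| <= n)%N.
Proof.
case: q => [[a b] p]; apply/idP/idP => /=.
  move/allpairsPdep => [x [p' [xin _ [ex _]]]]; move: xin; rewrite -ex.
  by move/allpairsPdep => [a' [b' [h1 h2 [-> ->]]]]; rewrite -!mem_zrange h1 h2.
case/andP => h1 h2; apply/allpairsPdep; exists (a, b), p; split => //; last by rewrite mem_enum.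
by apply/allpairsPdep; exists a, b; rewrite !mem_zrange h1 h2.
Qed.

Lemma uniq_frange n : uniq (frange n).
Proof.
apply: allpairs_uniq; [|exact: enum_uniq|by case=> ? ? [? ?]].
by apply: allpairs_uniq; [exact: uniq_zrange|exact: uniq_zrange|case=> ? ? [? ?]].
Qed.

Lemma big_zrange n (F : int -> C) :
  \sum_(a <- zrange n) F a = \sum_(i < (2 * n).+1) F (i%:Z - n%:Z).
Proof. by rewrite big_map -[iota _ _]/(index_iota 0 (2 * n).+1) big_mkord. Qed.

Lemma big_frange n (F : fidx -> C) :
  \sum_(q <- frange n) F q =
  sqsum (fun a b => \sum_s \sum_j F ((a, b), (s, j))) n.
Proof.
rewrite big_allpairs big_allpairs /sqsum big_zrange; apply: eq_bigr => i _.
rewrite big_zrange; apply: eq_bigr => j _.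
rewrite big_enum /= (pair_big predT predT (fun s j => F (_, (s, j)))) /=.
by apply: eq_bigr => -[].
Qed.

Lemma L2per_fwave q : L2per (fwave q).
Proof.
apply/L2perP; split.
  apply/bloch0P => a b; apply: nearW => r s j; rewrite /fwave.
  by case: ifP => // _; rewrite cis_gamma.
move=> s j; rewrite /fwave; have [_|_] := boolP ((s, j) == q.2); last exact: csqi_cst.
apply: csqiZ; have := csqi_cis (gammaS R q.1.1 q.1.2) (csqi_cst 1).
by under eq_fun do rewrite mulr1.
Qed.

Lemma inner_fwave q f : L2per f ->
  inner (fwave q) f = (rtA^-1)%:C%C * fourier (gammaS R q.1.1 q.1.2) f q.2.1 q.2.2.
Proof.
case: q => [[a b] [s0 j0]] pf /=; rewrite /inner.
have e s j : cint Om (fun r => (fwave (a, b, (s0, j0)) r s j)^*%C * f r s j) =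
    if (s, j) == (s0, j0) then (rtA^-1)%:C%C * fourier (gammaS R a b) f s j else 0.
  have pfj := L2per_csqi s j pf.
  case: ifPn => sj; last first.
    rewrite [X in cint _ X](_ : _ = (fun r => 0 * f r s j)).
      by rewrite cintZ ?mul0r //; exact: csqi_intg.
    by apply/funext => r; rewrite /fwave /= (negbTE sj) conjc0.
  have ci : cintg (fun r => cis (- dotp (gammaS R a b) r) * f r s j).
    have := csqi_intg (csqi_cis (gammaS R (- a) (- b)) pfj).
    by congr cintg; apply/funext => r; rewrite gammaSN dotpNl.
  rewrite /fourier -cintZ //; congr cint; apply/funext => r.
  by rewrite /fwave /= sj rmorphM /= oppr0 cisN mulrA.
rewrite (eq_bigr _ (fun s _ => eq_bigr _ (fun j _ => e s j))) pair_big /= -big_mkcond.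
by rewrite (big_pred1 (s0, j0)) // => -[s j].
Qed.

Lemma fwave_orthonormal p q : inner (fwave p) (fwave q) = (p == q)%:R.
Proof.
rewrite inner_fwave; last exact: L2per_fwave.
case: p q => [[a b] p] [[c d] q]; rewrite /fourier /fwave /= -surjective_pairing.
rewrite xpair_eqE andbC; have [pq|pq] := eqVneq p q; last first.
  rewrite [X in cint _ X](_ : _ = (fun r => 0 * cst 0 r)); last first.
    by apply/funext => r; rewrite !mulr0.
  by rewrite cintZ ?mul0r ?mulr0 //; apply: csqi_intg; exact: csqi_cst.
have ci : cintg (fun r => cis (dotp (gammaS R (c - a) (d - b)) r)).
  have := csqi_intg (csqi_cis (gammaS R (c - a) (d - b)) (csqi_cst 1)).
  by under eq_fun do rewrite mulr1.
rewrite [X in cint _ X](_ : _ = (fun r =>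
  (rtA^-1)%:C%C * cis (dotp (gammaS R (c - a) (d - b)) r))); last first.
  by apply/funext => r; rewrite mulrCA -cisD gammaSD gammaSN dotpDl dotpNl addrC.
rewrite cintZ // cint_cis !subr_eq0 xpair_eqE eq_sym [d == b]eq_sym.
case: ifP => _ /=; last by rewrite !mulr0.
rewrite -!rmorphM mulrA -invfM /= -expr2 sqr_sqrtr ?ltW ?areaOmega_gt0 //.
by rewrite mulVf // gt_eqF // areaOmega_gt0.
Qed.

Lemma csumE (F : int -> int -> C) z :
  (forall eps, 0 < eps -> exists n0, forall n, (n0 <= n)%N -> normc (z - sqsum F n) <= eps) ->
  csum F = z.
Proof.
move=> h; apply: eqC; rewrite /csum /=; apply: cvg_lim => //; apply/cvgrPdist_le => eps e0;
  have [n0 hn0] := h eps e0; exists n0 => // n /= nn; apply: le_trans (hn0 n nn).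
  by rewrite -ReN -ReD; exact: Re_le_normc.
by rewrite -ImN -ImD; exact: Im_le_normc.
Qed.

(** This identifies the form factor, given by a sum over reciprocal vectors, with an inner product
    of Bloch functions ([form_factorE]). *)
Lemma fourier_parseval f g : L2per f -> L2per g ->
  ((areaOmega R)^-1)%:C%C * csum (fun a b => \sum_(s : bool) \sum_(j < N)
    (fourier (gammaS R a b) f s j)^*%C * fourier (gammaS R a b) g s j) = inner f g.
Proof.
move=> pf pg; have A0 := areaOmega_gt0 R.
rewrite (@csumE _ ((areaOmega R)%:C%C * inner f g)).
  by rewrite mulrA -rmorphM mulVf ?gt_eqF // mul1r.
move=> eps e0.
have lS m n : (m <= n)%N -> {subset frange m <= frange n}.
  move=> mn q; rewrite !mem_frange => /andP[h1 h2].
  by rewrite (leq_trans h1) ?(leq_trans h2).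
have lA n (q : fidx) : q \in frange n -> setT q by [].
have Al (q : fidx) : setT q -> exists n, q \in frange n.
  by case: q => [[a b] p] _; exists (maxn `|a| `|b|); rewrite mem_frange /= leq_maxl leq_maxr.
have pe q : setT q -> L2per (fwave q) by move=> _; exact: L2per_fwave.
have oe p q : setT p -> setT q -> inner (fwave p) (fwave q) = (p == q)%:R.
  by move=> _ _; exact: fwave_orthonormal.
have te h : L2per h -> (forall q, setT q -> inner (fwave q) h = 0) -> eqae h (@wzero R N).
  move=> ph h0; apply: fourier_unique => // a b s j.
  have := h0 ((a, b), (s, j)) I; rewrite inner_fwave // => /eqP.
  rewrite mulf_eq0 => /orP[|/eqP //].
  by rewrite eq_complex /= invr_eq0 gt_eqF // rtA_gt0.
have [n0 hn0] := parseval uniq_frange lS lA Al pe oe te pf pg (divr_gt0 e0 A0).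
exists n0 => n nn; have := hn0 n nn; rewrite big_frange.
have -> : sqsum (fun a b => \sum_s \sum_j (inner (fwave ((a, b), (s, j))) f)^*%C *
    inner (fwave ((a, b), (s, j))) g) n =
    ((areaOmega R)^-1)%:C%C * sqsum (fun a b => \sum_s \sum_j
      (fourier (gammaS R a b) f s j)^*%C * fourier (gammaS R a b) g s j) n.
  rewrite /sqsum mulr_sumr; apply: eq_bigr => i _; rewrite mulr_sumr; apply: eq_bigr => i' _.
  rewrite mulr_sumr; apply: eq_bigr => s _; rewrite mulr_sumr; apply: eq_bigr => j _.
  have cM (x y : C) : (x * y)^*%C = x^*%C * y^*%C by rewrite rmorphM.
  have rr : (rtA^-1)%:C%C * (rtA^-1)%:C%C = ((areaOmega R)^-1)%:C%C :> C.
    by rewrite -rmorphM -invfM -expr2 sqr_sqrtr // ltW.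
  by rewrite !inner_fwave // cM conjc_real mulrACA rr.
set S := sqsum _ _; move=> h.
have -> : (areaOmega R)%:C%C * inner f g - S =
    (areaOmega R)%:C%C * (inner f g - ((areaOmega R)^-1)%:C%C * S).
  by rewrite mulrBr mulrA -rmorphM mulfV ?gt_eqF // mul1r.
rewrite ComplexField.Normc.normcM /= expr0n addr0 sqrtr_sqr gtr0_norm //.
by rewrite mulrC -ler_pdivlMr.
Qed.
End FourierBasis.

(** * Real-analytic functions of k *)

Section AnalyticIdentity.
Variable R : realType.
Implicit Types (f : R -> R) (t : R).

(** The second clause is a Cauchy estimate: it compares tails with geometric series, uniformly on
    half the interval of convergence. *)
Definition power_series_at f t0 (rho K : R) (c : nat -> R) :=
  [/\ 0 < rho, forall a, `|c a| <= K / rho ^+ a &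
      forall t, `|t - t0| < rho -> forall e, 0 < e -> exists m0, forall m, (m0 <= m)%N ->
        `|f t - \sum_(a < m) (t - t0) ^+ a * c a| <= e].

Definition analytic1 f := forall t0, exists rho K c, power_series_at f t0 rho K c.

Lemma sum_geometric_half (x : R) (n m : nat) : 0 <= x <= 2^-1 ->
  \sum_(n <= a < m) x ^+ a <= 2 * x ^+ n.
Proof.
move=> /andP[x0 x1]; have [nm|mn] := leqP n m; last first.
  by rewrite big_geq ?(ltnW mn) // mulr_ge0 // exprn_ge0.
suff : \sum_(n <= a < m) x ^+ a <= 2 * x ^+ n - 2 * x ^+ m.
  by have := exprn_ge0 m x0; lra.
elim: m nm => [|m IHm]; first by rewrite leqn0 => /eqP ->; rewrite big_geq // subrr.
rewrite leq_eqVlt => /orP[/eqP <-|]; first by rewrite big_geq // subrr.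
rewrite ltnS => nm; rewrite big_nat_recr //=; have := IHm nm; have := exprn_ge0 m x0.
move: (x ^+ n) (\sum_(_ <= _ < _) _) => y S p h.
have := ler_wpM2r p x1; rewrite exprS; lra.
Qed.

Lemma series_tail (x : R) (K rho : R) (c : nat -> R) (n m : nat) : 0 < rho ->
  (forall a, `|c a| <= K / rho ^+ a) -> `|x| <= rho / 2 ->
  `|\sum_(n <= a < m) x ^+ a * c a| <= 2 * K * (`|x| / rho) ^+ n.
Proof.
move=> r0 cK xr; apply: le_trans (ler_norm_sum _ _ _) _.
have y1 : 0 <= `|x| / rho <= 2^-1.
  by rewrite divr_ge0 ?(ltW r0) //= ler_pdivrMr // mulrC.
have K0 : 0 <= K by have := cK 0%N; rewrite expr0 divr1; apply: le_trans.
apply: (@le_trans _ _ (\sum_(n <= a < m) K * (`|x| / rho) ^+ a)).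
  apply: ler_sum => a _; rewrite normrM normrX expr_div_n mulrCA.
  by rewrite ler_wpM2l ?exprn_ge0 //; exact: cK.
have h := ler_wpM2l K0 (sum_geometric_half n m y1).
by rewrite -mulr_sumr; apply: le_trans h _; rewrite mulrA [K * 2]mulrC.
Qed.

(** At a zero close to [t0], the first nonvanishing term must be balanced by the tail, which is
    smaller by a factor |t - t0| / rho. *)
Lemma coef_eq0 f t0 rho K c : power_series_at f t0 rho K c ->
  (forall e, 0 < e -> exists t, [/\ 0 < `|t - t0|, `|t - t0| < e & f t = 0]) ->
  forall n, c n = 0.
Proof.
move=> [r0 cK fc] acc n; have [k] := ubnP n; elim: k n => // k IHk n; rewrite ltnS => nk.
have c0 a : (a < n)%N -> c a = 0 by move=> an; apply: IHk; exact: leq_trans nk.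
have K0 : 0 <= K by have := cK 0%N; rewrite expr0 divr1; apply: le_trans.
apply/eqP; rewrite -normr_eq0 eq_le normr_ge0 andbT leNgt; apply/negP => cn.
have w0 : 0 < `|c n| * rho ^+ n / (4 * K + 1).
  by rewrite divr_gt0 ?mulr_gt0 ?exprn_gt0 //; lra.
(* Balancing gives |c n| rho^n <= 2 K y, which fails for every ratio y below [w]; the added 1 keeps
   the denominator positive when K = 0. *)
pose w := `|c n| * rho ^+ n / (4 * K + 1).
have [t [t1 t2 ft]] : exists t, [/\ 0 < `|t - t0|, `|t - t0| < rho * Num.min 2^-1 w & f t = 0].
  by apply: acc; rewrite mulr_gt0 // lt_min invr_gt0 ltr0n.
pose y := `|t - t0| / rho.
have y0 : 0 < y by rewrite divr_gt0.
have yw : y < w.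
  by rewrite ltr_pdivrMr // mulrC (lt_le_trans t2) // ler_pM2l // ge_min lexx orbT.
have y2 : y < 2^-1.
  by rewrite ltr_pdivrMr // mulrC (lt_le_trans t2) // ler_pM2l // ge_min lexx.
have xr : `|t - t0| <= rho / 2 by move: y2; rewrite ltr_pdivrMr // mulrC => /ltW.
have main : `|t - t0| ^+ n * `|c n| <= 2 * K * y ^+ n.+1.
  rewrite leNgt; apply/negP; rewrite -subr_gt0 => gap.
  have tr : `|t - t0| < rho by lra.
  have [m0 hm0] := fc t tr _ (divr_gt0 gap (ltr0Sn R 1)).
  have := hm0 (maxn m0 n.+1) (leq_maxl _ _); rewrite ft sub0r normrN => h1.
  have nm : (n < maxn m0 n.+1)%N by exact: leq_maxr.
  move: h1; rewrite -(big_mkord xpredT (fun a => (t - t0) ^+ a * c a)).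
  rewrite (big_cat_nat (n := n)) //=; last exact: ltnW.
  rewrite big_nat big1 ?add0r; last by move=> a /andP[_ an]; rewrite c0 ?mulr0.
  rewrite big_ltn // => h1.
  have h2 := series_tail n.+1 (maxn m0 n.+1) r0 cK xr.
  have h3 : `|(t - t0) ^+ n * c n| <=
      `|(t - t0) ^+ n * c n + \sum_(n.+1 <= a < maxn m0 n.+1) (t - t0) ^+ a * c a| +
      `|\sum_(n.+1 <= a < maxn m0 n.+1) (t - t0) ^+ a * c a|.
    by rewrite -[X in `|X| <= _](addrK (\sum_(n.+1 <= a < maxn m0 n.+1) (t - t0) ^+ a * c a)) ler_normB.
  move: h3; rewrite {1}normrM normrX; move: h1 h2 gap; rewrite -/y.
  move: (`|t - t0| ^+ n * `|c n|) (2 * K * y ^+ n.+1) => A B.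
  move: (`|_ + _|) (`|\sum_(_ <= _ < _) _|) => P Q *; lra.
have tE : `|t - t0| = y * rho by rewrite /y divfK // gt_eqF.
move: main; rewrite tE exprMn exprS mulrA [2 * K * y]mulrC.
have -> : y ^+ n * rho ^+ n * `|c n| = (`|c n| * rho ^+ n) * y ^+ n by ring.
have -> : y * (2 * K) * y ^+ n = (2 * K * y) * y ^+ n by ring.
rewrite ler_pM2r ?exprn_gt0 // => main.
have wE : w * (4 * K + 1) = `|c n| * rho ^+ n by rewrite /w divfK // gt_eqF; lra.
have h9 : 2 * K * y <= 2 * K * w := ler_wpM2l (mulr_ge0 (ler0n R 2) K0) (ltW yw).
have w1 : 0 < w by exact: w0.
have := mulr_ge0 K0 (ltW w1).
move: main h9 w1; rewrite -wE; lra.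
Qed.

Lemma vanish_near f t0 rho K c : power_series_at f t0 rho K c -> (forall n, c n = 0) ->
  forall t, `|t - t0| < rho -> f t = 0.
Proof.
move=> [r0 _ fc] c0 t tr; apply/eqP; rewrite -normr_eq0 eq_le normr_ge0 andbT leNgt.
apply/negP => ft; have [m0 hm0] := fc t tr _ (divr_gt0 ft (ltr0Sn R 1)).
have := hm0 m0 (leqnn _); rewrite big1 ?subr0; last by move=> a _; rewrite c0 mulr0.
by move: ft; lra.
Qed.

(** At the supremum of the points up to which [f] vanishes, zeros accumulate from the left. The
    series there is null, so [f] vanishes further to the right, which contradicts the supremum. *)
Lemma analytic1_right f (t0 d : R) : analytic1 f -> 0 < d ->
  (forall t, `|t - t0| < d -> f t = 0) -> forall t, t0 <= t -> f t = 0.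
Proof.
move=> fa d0 f0 T tT; apply: contrapT => fT.
pose S : set R := [set s | t0 <= s /\ forall t, t0 <= t <= s -> f t = 0].
have Sub : ubound S T.
  move=> s [s1 s2]; rewrite leNgt; apply/negP => Ts; apply: fT; apply: s2.
  by rewrite tT ltW.
have S0 : S (t0 + d / 2).
  split; first by lra.
  move=> t /andP[t1 t2]; apply: f0; rewrite ger0_norm; lra.
have hS : has_sup S by split; [exists (t0 + d / 2)|exists T].
pose s := sup S.
have sd : t0 + d / 2 <= s by apply: (sup_upper_bound hS).
have [rho [K [c fs]]] := fa s; have [r0 _ _] := fs.
have fbelow t : t0 <= t -> t < s -> f t = 0.
  move=> t1 ts; have st : 0 < s - t by rewrite subr_gt0.
  have [s' [S1 S2] ts'] := sup_adherent st hS.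
  by apply: S2; rewrite t1 /=; move: ts'; rewrite -/s; lra.
have cz : forall n, c n = 0.
  apply: (coef_eq0 fs) => e e0; pose t := s - Num.min (e / 2) (d / 4).
  have m0 : 0 < Num.min (e / 2) (d / 4) by rewrite lt_min; apply/andP; split; lra.
  have m1 : Num.min (e / 2) (d / 4) <= e / 2 by rewrite ge_min lexx.
  have m2 : Num.min (e / 2) (d / 4) <= d / 4 by rewrite ge_min lexx orbT.
  have tE : `|t - s| = Num.min (e / 2) (d / 4).
    by rewrite /t (_ : s - _ - s = - Num.min (e / 2) (d / 4)); [rewrite normrN gtr0_norm|ring].
  exists t; rewrite tE; split => //; first by lra.
  by apply: fbelow; rewrite /t; lra.
have fz := vanish_near fs cz.
have : S (s + rho / 2).
  split; first by lra.
  move=> t /andP[t1 t2]; have [ts|st] := ltP t s; first exact: fbelow.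
  by apply: fz; rewrite ger0_norm; lra.
by move/(sup_upper_bound hS); rewrite -/s; lra.
Qed.

Lemma analytic1_opp f : analytic1 f -> analytic1 (fun t => f (- t)).
Proof.
move=> fa t0; have [rho [K [c [r0 cK fc]]]] := fa (- t0).
exists rho, K, (fun a => (-1) ^+ a * c a); split => //.
  by move=> a; rewrite normrM normrX normrN1 expr1n mul1r.
move=> t tr e e0; have tr' : `|- t - - t0| < rho by rewrite -opprD normrN.
have [m0 hm0] := fc (- t) tr' e e0; exists m0 => m mm; have := hm0 m mm.
congr (`|_ - _| <= _); apply: eq_bigr => a _.
by rewrite mulrA -exprMn; congr (_ ^+ _ * _); ring.
Qed.

Lemma analytic1_eq0 f (t0 d : R) : analytic1 f -> 0 < d ->
  (forall t, `|t - t0| < d -> f t = 0) -> forall t, f t = 0.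
Proof.
move=> fa d0 f0 t; have [tt|/ltW tt] := leP t0 t; first exact: (analytic1_right fa d0 f0).
rewrite -[t]opprK; apply: (analytic1_right (t0 := - t0) (analytic1_opp fa) d0).
  by move=> x; rewrite opprK => xd; apply: f0; rewrite -normrN opprB opprK addrC.
by rewrite lerN2.
Qed.

Definition analytic2 (f : R * R -> R) := forall k0 : R * R, exists rho K c,
  [/\ 0 < rho, forall a b, `|c a b| <= K / rho ^+ (a + b) &
      forall k, `|k.1 - k0.1| < rho -> `|k.2 - k0.2| < rho ->
      forall e, 0 < e -> exists m0, forall m, (m0 <= m)%N ->
        `|f k - \sum_(a < m) \sum_(b < m) (k.1 - k0.1) ^+ a * (k.2 - k0.2) ^+ b * c a b| <= e].

(** Continuation goes one variable at a time: along the horizontal lines that meet the small square,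
    which fills a strip, and then along every vertical line. *)
Lemma analytic2_eq0 (f : R * R -> R) (k0 : R * R) (d : R) : analytic2 f -> 0 < d ->
  (forall k, `|k.1 - k0.1| < d -> `|k.2 - k0.2| < d -> f k = 0) -> forall k, f k = 0.
Proof.
move=> fa d0 f0.
have fx y : analytic1 (fun x => f (x, y)).
  move=> x0; have [rho [K [c [r0 cK fc]]]] := fa (x0, y).
  exists rho, K, (fun a => c a 0%N); split => //.
    by move=> a; have := cK a 0%N; rewrite addn0.
  move=> x xr e e0; have yr : `|y - y| < rho by rewrite subrr normr0.
  (* With m at least 1 the double sum contains the terms b = 0; the other ones vanish because the
     second coordinate is fixed. *)
  have [m0 hm0] := fc (x, y) xr yr e e0; exists m0.+1 => m mm; have := hm0 m (ltnW mm).
  congr (`|_ - _| <= _); apply: eq_bigr => a _; case: m mm a => // m _ a.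
  rewrite big_ord_recl /= expr0 mulr1 big1 ?addr0 // => b _.
  by rewrite subrr expr0n /= mulr0 mul0r.
have fy x : analytic1 (fun y => f (x, y)).
  move=> y0; have [rho [K [c [r0 cK fc]]]] := fa (x, y0).
  exists rho, K, (c 0%N); split => //.
  move=> y yr e e0; have xr : `|x - x| < rho by rewrite subrr normr0.
  have [m0 hm0] := fc (x, y) xr yr e e0; exists m0.+1 => m mm; have := hm0 m (ltnW mm).
  congr (`|_ - _| <= _); case: m mm => // m _.
  rewrite big_ord_recl [X in _ + X]big1 ?addr0 /=.
    by apply: eq_bigr => b _; rewrite expr0 mul1r.
  by move=> a _; rewrite big1 // => b _; rewrite subrr expr0n /= !mul0r.
have f1 y : `|y - k0.2| < d -> forall x, f (x, y) = 0.
  by move=> yd; apply: (analytic1_eq0 (t0 := k0.1) (fx y) d0) => x xd; apply: f0.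
case=> x y; apply: (analytic1_eq0 (t0 := k0.2) (fy x) d0) => y' yd; exact: f1.
Qed.
End AnalyticIdentity.

Lemma conjM (R : realType) (x y : R[i]) : (x * y)^*%C = x^*%C * y^*%C.
Proof. exact: rmorphM. Qed.

(** * Phases and the operators Z, Q, L on periodic waves *)

Section WaveOperators.
Variables (R : realType) (N : nat).
Local Notation C := R[i].
Local Notation W := (wave R N).
Local Notation MR := (measurableTypeR R).
Local Notation RR := (MR * MR)%type.
Local Notation Om := (Omega : set RR).
Implicit Types (f g : W) (k q : R * R).

Lemma waveP f g : (forall r s j, f r s j = g r s j) -> f = g.
Proof. by move=> h; apply/funext => r; apply/funext => s; apply/funext => j. Qed.

Lemma phaseK k f : phase k (phase (- k) f) = f.
Proof. by apply: waveP => r s j; rewrite /phase dotpNl mulrA [cis _ * _]mulrC cisNK mul1r. Qed.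

Lemma phaseD k q f : phase (k + q) f = phase k (phase q f).
Proof. by apply: waveP => r s j; rewrite /phase dotpDl cisD mulrA. Qed.

Lemma phaseZ k c f : phase k (wscale c f) = wscale c (phase k f).
Proof. by apply: waveP => r s j; rewrite /phase /wscale mulrCA. Qed.

Lemma measurable_phase k f : measurable_wave f -> measurable_wave (phase k f).
Proof. by move=> mf s j; apply: cmeasM; [exact: cmeas_cis|exact: mf]. Qed.

Lemma inner_phase k f g : inner (phase k f) (phase k g) = inner f g.
Proof.
rewrite /inner; apply: eq_bigr => s _; apply: eq_bigr => j _; congr cint; apply/funext => r.
by rewrite /phase conjM -cisN mulrACA cisNK mul1r.
Qed.

Lemma inner_phasel k f g : inner (phase k f) g = inner f (phase (- k) g).
Proof. by rewrite -{1}(phaseK k g) inner_phase. Qed.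

Lemma L2per_phase (a b : int) f : L2per f -> L2per (phase (gammaS R a b) f).
Proof.
move=> /L2perP[/bloch0P bf cf]; apply/L2perP; split; last by move=> s j; exact: csqi_cis.
apply/bloch0P => c d; have := bf c d; apply: filterS => r e s j.
by rewrite /phase cis_gamma e.
Qed.

Lemma inner_opZ f g : inner (opZ f) (opZ g) = inner f g.
Proof.
rewrite /inner; apply: eq_bigr => s _; apply: eq_bigr => j _; congr cint; apply/funext => r.
by rewrite /opZ /signS; case: s; rewrite ?mul1r // !mulN1r rmorphN mulrNN.
Qed.

Lemma opQK f : opQ (opQ f) = f.
Proof. by apply: waveP => r s j; rewrite /opQ opprK negbK conjcK. Qed.

Lemma inner_opQ f g : L2per f -> L2per g -> inner (opQ f) (opQ g) = (inner f g)^*%C.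
Proof.
move=> pf pg; rewrite /inner rmorph_sum (reindex_inj (can_inj negbK)); apply: eq_bigr => s _.
rewrite rmorph_sum; apply: eq_bigr => j _.
have [bf _] := (L2perP f).1 pf; have [bg _] := (L2perP g).1 pg.
pose h (r : RR) := ((f r s j)^*%C * g r s j)^*%C.
have gh : gper h.
  move=> a b; have := L2per_gper s j bf a b; have := L2per_gper s j bg a b.
  by apply: filterS2 => r e1 e2; rewrite /h e1 e2.
have mh : cmeas h.
  by apply: cmeas_conj; apply: cmeasM; [apply: cmeas_conj|]; apply: csqi_meas; exact: L2per_csqi.
have e1 : cint Om (fun r => h (- r)) = (cint Om (fun r => (f r s j)^*%C * g r s j))^*%C.
  by rewrite (cint_opp mh gh) /h cint_conj //; exact: inner_intg.
apply: etrans; last exact: e1.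
congr cint; apply/funext => r; by rewrite /opQ /h negbK conjM conjcK.
Qed.

Lemma phase_opQ k f : opQ (phase k f) = phase k (opQ f).
Proof.
by apply: waveP => r s j; rewrite /opQ /phase conjM dotpNr -cisN opprK.
Qed.

Lemma phase_opZ k f : opZ (phase k f) = phase k (opZ f).
Proof. by apply: waveP => r s j; rewrite /opZ /phase mulrCA. Qed.

Lemma phase_opL k f : opL (phase k f) = phase (- k) (opL f).
Proof. by apply: waveP => r s j; rewrite /opL /phase dotpNr dotpNl mulrCA. Qed.

Lemma opZ_opL f : opZ (opL f) = opL (opZ f).
Proof. by apply: waveP => r s j; rewrite /opZ /opL mulrCA. Qed.

Lemma opL_scale (c : C) f : opL (wscale c f) = wscale c (opL f).
Proof. by apply: waveP => r s j; rewrite /opL /wscale mulrCA. Qed.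

Lemma eqae_opL f g : eqae f g -> eqae (opL f) (opL g).
Proof.
move=> h; have := ae_preserving (@measurable_opp2 R) (@mu2_opp R) h.
by apply: filterS => r e s j; rewrite /opL e.
Qed.

Lemma eqae_opQ f g : eqae f g -> eqae (opQ f) (opQ g).
Proof.
move=> h; have := ae_preserving (@measurable_opp2 R) (@mu2_opp R) h.
by apply: filterS => r e s j; rewrite /opQ e.
Qed.

Lemma signC_real (n : nat) : ((-1) ^+ n : C)^*%C = (-1) ^+ n.
Proof. by rewrite rmorphXn rmorphN1. Qed.

(** The signs (-1)^j and (-1)^(N+1-j) of a layer and its mirror image multiply to (-1)^(N+1), so L
    is an involution only up to this sign. *)
Lemma opLK f : opL (opL f) = wscale ((-1) ^+ N.+1) f.
Proof.
apply: waveP => r s j; rewrite /opL /wscale opprK rev_ordK mulrA -exprD.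
have -> : (j.+1 + (rev_ord j).+1 = N.+1)%N by rewrite addnS [nat_of_ord (rev_ord j)]/= subnKC.
by [].
Qed.

Lemma L2per_opL f : L2per f -> L2per (opL f).
Proof.
move=> pf; have [bf cf] := (L2perP f).1 pf; apply/L2perP; split.
  apply/bloch0P => a b;
    have := ae_preserving (@measurable_opp2 R) (@mu2_opp R) (((bloch0P f).1 bf) (- a) (- b)).
  by apply: filterS => r /= e s j; rewrite /opL opprD -gammaN e.
move=> s j; exact: (csqiZ _ (csqi_opp (cf s (rev_ord j)) (L2per_gper s (rev_ord j) bf))).
Qed.

Lemma inner_opL f g : L2per f -> L2per g -> inner (opL f) (opL g) = inner f g.
Proof.
move=> pf pg; rewrite /inner; apply: eq_bigr => s _.
rewrite (reindex_inj (inv_inj (@rev_ordK N))); apply: eq_bigr => j _.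
have [bf _] := (L2perP f).1 pf; have [bg _] := (L2perP g).1 pg.
pose h (r : RR) := (f r s j)^*%C * g r s j.
have gh : gper h.
  move=> a b; have := L2per_gper s j bf a b; have := L2per_gper s j bg a b.
  by apply: filterS2 => r e1 e2; rewrite /h e1 e2.
have mh : cmeas h.
  by apply: cmeasM; [apply: cmeas_conj|]; apply: csqi_meas; exact: L2per_csqi.
apply: etrans; last exact: (cint_opp mh gh).
congr cint; apply/funext => r; rewrite /opL /h rev_ordK conjM signC_real.
by rewrite mulrACA -exprD addnn -mul2n exprM sqrrN expr1n expr1n mul1r.
Qed.

Definition taylor_sum (T : nat -> nat -> W -> W) (x y : R) (m : nat) (f : W) : W :=
  fun r s j => \sum_(a < m) \sum_(b < m) (x ^+ a * y ^+ b)%:C%C * T a b f r s j.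

Lemma taylor_sumE T x y m f : taylor_sum T x y m f =
  wsum (index_enum 'I_m) (fun=> 1) (fun a : 'I_m => wsum (index_enum 'I_m)
    (fun b : 'I_m => (x ^+ a * y ^+ b)%:C%C) (fun b : 'I_m => T a b f)).
Proof.
by apply: waveP => r s j; rewrite /wsum /taylor_sum; apply: eq_bigr => a _; rewrite mul1r.
Qed.

Lemma L2per_taylor_sum (T : nat -> nat -> W -> W) x y m f :
  (forall a b, L2per (T a b f)) -> L2per (taylor_sum T x y m f).
Proof.
by move=> pT; rewrite taylor_sumE; apply: L2per_wsum => a _; apply: L2per_wsum => b _.
Qed.

(** [op_analytic] bounds the coefficients and the remainders; [T k f] is a remainder plus a finite
    Taylor sum, both square integrable. *)
Lemma op_analytic_L2per (T : R * R -> W -> W) : op_analytic T ->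
  forall k f, L2per f -> L2per (T k f).
Proof.
move=> aT k f pf; have [rho [K [CT [r0 CK TC]]]] := aT k.
have k1 : `|k.1 - k.1| < rho by rewrite subrr normr0.
have k2 : `|k.2 - k.2| < rho by rewrite subrr normr0.
have [m0 hm0] := TC k k1 k2 1 ltr01.
have [p1 _] := hm0 m0 (leqnn _) f pf.
have p2 : L2per (taylor_sum CT (k.1 - k.1) (k.2 - k.2) m0 f).
  by apply: L2per_taylor_sum => a b; have [_ /(_ f pf)[]] := CK a b.
have := L2perD p1 p2; congr L2per; apply: waveP => r s j.
by rewrite /opsub /wadd /wsub subrK.
Qed.
End WaveOperators.

Lemma sum_band (M : nat) (V : nmodType) (F : band M -> V) :
  \sum_n F n = \sum_(s : bool) \sum_(l < M) F (s, l).
Proof. by rewrite pair_bigA; apply: eq_bigr => -[]. Qed.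

(** * The flat band basis and its form factors *)

Section FlatBandBasis.
Variables (R : realType) (N M : nat).
Local Notation C := R[i].
Local Notation W := (wave R N).
Variables (D : set W) (H : W -> W) (eps : int -> R * R -> R).
Variables (Psi u : int -> R * R -> W).
Implicit Types (f g : W) (k q : R * R) (m n : band M).
Hypothesis eigenpairs : bloch_eigenpairs D H eps Psi.
Hypothesis Hu : gauge M Psi u.
Local Notation ub n k := (u (band_index n) k).
Local Notation P := (Pi M u).

Lemma band_index_neq0 n : band_index n != 0.
Proof. by case: n => [[] i]; rewrite /band_index /= ?oppr_eq0. Qed.

Lemma band_index_inj : injective (@band_index M).
Proof.
move=> [s a] [s' b]; rewrite /band_index /= => e.
have [ss' ab] : s = s' /\ a = b :> nat by case: s s' e => [] []; lia.
by rewrite ss'; congr (_, _); apply: val_inj.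
Qed.

Lemma band_index_le n : (`|band_index n|%N <= M)%N.
Proof. by case: n => [[] a]; have := ltn_ord a; rewrite /band_index /=; lia. Qed.

Lemma band_indexP (a : int) : a != 0 -> (`|a|%N <= M)%N -> exists n, band_index n = a.
Proof.
case: a => a a0 aM.
  have aM' : (a.-1 < M)%N by move: a0 aM; case: a.
  exists (true, Ordinal aM'); rewrite /band_index /=; congr Posz; move: a0; by case: a {aM aM'}.
have aM' : (a < M)%N by [].
by exists (false, Ordinal aM').
Qed.

Definition negb_band n : band M := (~~ n.1, n.2).

Lemma PiE k f : P k f = wsum (index_enum (band M)) (fun n => inner (ub n k) f) (fun n => ub n k).
Proof. by []. Qed.

Lemma u_shift k (a b : int) n : ub n k = phase (gammaS R a b) (ub n (k + gammaS R a b)).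
Proof. by have [_ _ _ _ ->] := Hu; rewrite phaseK. Qed.

(** The Bloch functions are prescribed on the cell and extended by phases, so a property stable
    under these phases has to be checked on the cell only. *)
Lemma OmegaStar_u (Q : W -> Prop) n :
  (forall f a b, Q f -> Q (phase (gammaS R a b) f)) ->
  (forall k, OmegaStar k -> Q (ub n k)) -> forall k, Q (ub n k).
Proof.
by move=> hQ Q0 k; have [a [b kO]] := OmegaStar_cover k; rewrite (u_shift k a b); apply/hQ/Q0.
Qed.

(** Equality almost everywhere with a Bloch function does not make [u] measurable. But Pi(k) maps
    that Bloch function exactly to [u], its coefficients being inner products, and the values of the
    analytic family Pi are square integrable. *)
Lemma L2per_u n k : L2per (ub n k).
Proof.
move: k; apply: OmegaStar_u => [f a b|k kO]; first exact: L2per_phase.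
have [_ [pe oe _] _ _] := eigenpairs kO; have [ue aP _ _ _] := Hu.
have pf := pe _ (band_index_neq0 n).
have := op_analytic_L2per aP k pf; congr L2per; rewrite PiE; apply: waveP => r s j.
rewrite /wsum (bigD1 n) //= big1 ?addr0 => [|m mn];
  rewrite (inner_ae (ue _ _ kO) (eqae_refl _)) oe; try exact: band_index_neq0.
  by rewrite eqxx mul1r.
by rewrite (inj_eq band_index_inj) (negbTE mn) mul0r.
Qed.

Lemma u_orthonormal m n k : inner (ub m k) (ub n k) = (m == n)%:R.
Proof.
have [a [b kO]] := OmegaStar_cover k; rewrite !(u_shift k a b) inner_phase.
have [_ [pe oe _] _ _] := eigenpairs kO; have [ue _ _ _ _] := Hu.
rewrite (inner_ae (ue _ _ kO) (ue _ _ kO)) oe; try exact: band_index_neq0.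
by rewrite (inj_eq band_index_inj).
Qed.

Lemma opZ_u n k : eqae (opZ (ub n k)) (wscale (signS R n.1) (ub n k)).
Proof.
apply: (OmegaStar_u (Q := fun f => eqae (opZ f) (wscale (signS R n.1) f))).
  move=> f a b; rewrite phase_opZ -phaseZ; exact: eqae_phase.
by move=> k' kO; have [_ _ uZ _ _] := Hu; exact: uZ.
Qed.

Lemma opQ_u n k : eqae (ub (negb_band n) k) (opQ (ub n k)).
Proof.
have [a [b kO]] := OmegaStar_cover k; rewrite !(u_shift k a b) phase_opQ; apply: eqae_phase.
have [_ _ _ uQ _] := Hu; case: n => [[] i]; first exact: uQ.
by apply: eqae_sym; have := eqae_opQ (uQ i _ kO); rewrite opQK.
Qed.

Lemma form_factorE k q m n : form_factor u k q m n = inner (ub m k) (ub n (k + q)).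
Proof. by rewrite -fourier_parseval //; exact: L2per_u. Qed.

Lemma inner_sector (s s' : bool) f g : L2per f -> L2per g ->
  eqae (opZ f) (wscale (signS R s) f) -> eqae (opZ g) (wscale (signS R s') g) ->
  s != s' -> inner f g = 0.
Proof.
move=> pf pg ef eg ss'; have := inner_opZ f g; rewrite (inner_ae ef eg).
rewrite innerZl ?innerZr //; last exact: L2perZ.
set z := inner _ _ => e; suff : z *+ 2 == 0 by rewrite mulrn_eq0 => /eqP.
rewrite mulr2n -{1}e; move: ss'; rewrite /signS.
by case: (s); case: (s') => // _;
  rewrite ?(rmorphN1 (@conjc R)) ?(rmorph1 (@conjc R)) ?mulN1r ?mul1r (addrN, addNr).
Qed.

Lemma inner_u_sector m n k q : m.1 != n.1 -> inner (ub m k) (ub n q) = 0.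
Proof. by apply: inner_sector; rewrite ?L2per_u //; try exact: opZ_u; exact: L2per_u. Qed.

Lemma form_factor_sector k q m n : m.1 != n.1 -> form_factor u k q m n = 0.
Proof. by move=> mn; rewrite form_factorE inner_u_sector. Qed.

Lemma form_factor_negb k q m n :
  form_factor u k q (negb_band m) (negb_band n) = (form_factor u k q m n)^*%C.
Proof.
by rewrite !form_factorE (inner_ae (opQ_u m k) (opQ_u n _)) inner_opQ //; exact: L2per_u.
Qed.

Lemma form_factor_conj k q m n :
  form_factor u (k + q) (- q) n m = (form_factor u k q m n)^*%C.
Proof. by rewrite !form_factorE addrK inner_conj //; exact: L2per_u. Qed.

Lemma form_factor_periodic k q (a b : int) m n :
  form_factor u (k + gammaS R a b) q m n = form_factor u k q m n.
Proof.
have [_ _ _ _ uG] := Hu; rewrite !form_factorE uG -addrA [gammaS R a b + q]addrC addrA uG.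
exact: inner_phase.
Qed.

Lemma L2per_wsum_u (c : band M -> C) k :
  L2per (wsum (index_enum (band M)) c (fun n => ub n k)).
Proof. by apply: L2per_wsum => n _; exact: L2per_u. Qed.

Lemma inner_u_wsum (c : band M -> C) k n :
  inner (ub n k) (wsum (index_enum (band M)) c (fun n => ub n k)) = c n.
Proof.
rewrite inner_wsumr; try by move=> *; exact: L2per_u.
  rewrite (bigD1 n) //= big1 ?addr0 => [|m mn]; rewrite u_orthonormal ?eqxx ?mulr1 //.
  by rewrite eq_sym (negbTE mn) mulr0.
Qed.

Lemma L2per_Pi k f : L2per (P k f). Proof. exact: L2per_wsum_u. Qed.

Lemma inner_Pi k f n : inner (ub n k) (P k f) = inner (ub n k) f.
Proof. by rewrite inner_u_wsum. Qed.

(** A kernel vector yields a function in the range of Pi(k') that Pi(k) kills, overlaps with the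
    other sector being zero. The difference of projectors fixes this function, which must vanish if
    the norm is below 1. *)
Lemma form_factor_injective k k' (s : bool) (x : 'I_M -> C) :
  opnorm_lt1 (opsub (P k') (P k)) ->
  (forall j, \sum_(l < M) form_factor u k (k' - k) (s, j) (s, l) * x l = 0) ->
  forall l, x l = 0.
Proof.
move=> [c c1 hc] hx l.
pose y (n : band M) : C := if n.1 == s then x n.2 else 0.
have sum_sector (F : band M -> C) : \sum_n y n * F n = \sum_(l < M) x l * F (s, l).
  rewrite (eq_bigr (fun n => y (n.1, n.2) * F (n.1, n.2))); last by case.
  rewrite -(pair_bigA _ (fun b l => y (b, l) * F (b, l))) big_bool /y /=.
  case: (s) => /=; [rewrite [X in _ + X]big1 ?addr0 // | rewrite [X in X + _]big1 ?add0r //];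
    by move=> l' _; rewrite mul0r.
pose f := wsum (index_enum (band M)) y (fun n => ub n k').
have pf : L2per f by exact: L2per_wsum_u.
have e1 : P k' f = f.
  by rewrite PiE; apply: waveP => r s' j; apply: eq_bigr => n _; rewrite inner_u_wsum.
have e2 n : inner (ub n k) f = 0.
  rewrite inner_wsumr; try by move=> *; exact: L2per_u.
    case: n => sn j.
    transitivity (\sum_(n : band M) y n * form_factor u k (k' - k) (sn, j) n).
      by apply: eq_bigr => n _; rewrite form_factorE addrC subrK.
    have [->|sns] := eqVneq sn s.
      rewrite -[RHS](hx j) (sum_sector (fun n => form_factor u k (k' - k) (s, j) n)).
      by apply: eq_bigr => l' _; rewrite mulrC.
    rewrite big1 // => -[b l'] _; rewrite /y /=; case: eqP => [->|]; last by rewrite mul0r.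
    by rewrite form_factor_sector ?mulr0.
have [_ +] := hc f pf.
have -> : opsub (P k') (P k) f = f.
  rewrite /opsub e1 PiE; apply: waveP => r s' j; rewrite /wsub /wsum big1 ?subr0 // => n _.
  by rewrite e2 mul0r.
have := nrm_ge0 f; rewrite le0r => /orP[/eqP f0 _|f0];
  last by rewrite -{1}[nrm f]mul1r ler_pM2r // leNgt c1.
have <- : y (s, l) = x l by rewrite /y /= eqxx.
rewrite -[LHS](inner_u_wsum y k' (s, l)) -/f.
rewrite (inner_ae (eqae_refl _) (nrm_eq0 pf f0)) inner0r //; exact: L2per_u.
Qed.
End FlatBandBasis.

Section Analytic2.
Variable R : realType.
Implicit Types f g : R * R -> R.

Lemma analytic2_opp f : analytic2 f -> analytic2 (fun k => f (- k)).
Proof.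
move=> fa k0; have [rho [K [c [r0 cK fc]]]] := fa (- k0).
exists rho, K, (fun a b => (-1) ^+ (a + b) * c a b); split => //.
  by move=> a b; rewrite normrM normrX normrN1 expr1n mul1r.
have oppB (x y : R) : - x - - y = - (x - y) by rewrite opprK opprB addrC.
move=> k k1 k2 e e0; have h1 : `|(- k).1 - (- k0).1| < rho by rewrite oppB normrN.
have h2 : `|(- k).2 - (- k0).2| < rho by rewrite oppB normrN.
have [m0 hm0] := fc (- k) h1 h2 e e0.
exists m0 => m mm; have := hm0 m mm; congr (`|_ - _| <= _).
apply: eq_bigr => a _; apply: eq_bigr => b _.
rewrite !oppB (exprNn (k.1 - k0.1)) (exprNn (k.2 - k0.2)) exprD; ring.
Qed.

Lemma analytic2B f g : analytic2 f -> analytic2 g -> analytic2 (fun k => f k - g k).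
Proof.
move=> fa ga k0; have [r1 [K1 [c1 [r10 cK1 fc1]]]] := fa k0.
have [r2 [K2 [c2 [r20 cK2 fc2]]]] := ga k0.
have r0 : 0 < Num.min r1 r2 by rewrite lt_min r10.
have K10 : 0 <= K1 by have := cK1 0%N 0%N; rewrite expr0 divr1; apply: le_trans.
have K20 : 0 <= K2 by have := cK2 0%N 0%N; rewrite expr0 divr1; apply: le_trans.
have rn n : Num.min r1 r2 ^+ n <= r1 ^+ n /\ Num.min r1 r2 ^+ n <= r2 ^+ n.
  by split; apply: lerXn2r; rewrite ?nnegrE ?ge_min ?lexx ?orbT ?(ltW r0) ?(ltW r10) ?(ltW r20).
exists (Num.min r1 r2), (K1 + K2), (fun a b => c1 a b - c2 a b); split => //.
  move=> a b; have [h1 h2] := rn (a + b)%N.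
  apply: le_trans (ler_normB _ _) _; rewrite mulrDl; apply: lerD.
    by apply: le_trans (cK1 a b) _; rewrite ler_wpM2l // lef_pV2 ?posrE ?exprn_gt0.
  by apply: le_trans (cK2 a b) _; rewrite ler_wpM2l // lef_pV2 ?posrE ?exprn_gt0.
move=> k; rewrite !lt_min => /andP[k11 k12] /andP[k21 k22] e e0.
have e20 : 0 < e / 2 by rewrite divr_gt0.
have [m1 h1] := fc1 k k11 k21 _ e20; have [m2 h2] := fc2 k k12 k22 _ e20.
exists (maxn m1 m2) => m; rewrite geq_max => /andP[/h1 {}h1 /h2 {}h2].
have -> : \sum_(a < m) \sum_(b < m)
    (k.1 - k0.1) ^+ a * (k.2 - k0.2) ^+ b * (c1 a b - c2 a b) =
  \sum_(a < m) \sum_(b < m) (k.1 - k0.1) ^+ a * (k.2 - k0.2) ^+ b * c1 a b -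
  \sum_(a < m) \sum_(b < m) (k.1 - k0.1) ^+ a * (k.2 - k0.2) ^+ b * c2 a b.
  by rewrite -sumrB; apply: eq_bigr => a _; rewrite -sumrB; apply: eq_bigr => b _; rewrite mulrBr.
move: h1 h2; move: (\sum_(a < m) _) (\sum_(a < m) _) => S1 S2 h1 h2.
rewrite [e]splitr; apply: le_trans (lerD h1 h2).
have subACA (x y z w : R) : x - y - (z - w) = x - z - (y - w) by ring.
by rewrite subACA; exact: ler_normB.
Qed.
End Analytic2.

Lemma normc_real (R : realType) (r : R) : normc r%:C%C = `|r|.
Proof. by rewrite /normc /= expr0n addr0 sqrtr_sqr. Qed.

Section AnalyticOperators.
Variables (R : realType) (N : nat).
Local Notation C := R[i].
Local Notation W := (wave R N).
Implicit Types (f g : W) (T : R * R -> W -> W).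

Lemma inner_taylor (CT : nat -> nat -> W -> W) x y m f g :
  L2per f -> (forall a b, L2per (CT a b g)) ->
  inner f (taylor_sum CT x y m g) =
  \sum_(a < m) \sum_(b < m) (x ^+ a * y ^+ b)%:C%C * inner f (CT a b g).
Proof.
move=> pf pT; rewrite taylor_sumE inner_wsumr //; last first.
  by move=> a _; apply: L2per_wsum => b _.
by apply: eq_bigr => a _; rewrite mul1r inner_wsumr.
Qed.

(** The identity theorem is about real functions, so [p] stands for the real or the imaginary
    part. *)
Lemma analytic2_inner T f g (p : C -> R) :
  (forall z w, p (z + w) = p z + p w) -> (forall (r : R) z, p (r%:C%C * z) = r * p z) ->
  (forall z, `|p z| <= normc z) ->
  op_analytic T -> L2per f -> L2per g -> analytic2 (fun k => p (inner f (T k g))).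
Proof.
move=> pD pZ pn aT pf pg k0; have [rho [K [CT [r0 CK TC]]]] := aT k0.
have p0 : p 0 = 0 by rewrite -[0 : C](mul0r 0) (pZ 0) mul0r.
have pN z : p (- z) = - p z by apply/eqP; rewrite -addr_eq0 -pD addNr p0.
have psum (I : finType) (F : I -> C) : p (\sum_i F i) = \sum_i p (F i).
  by elim/big_rec2: _ => // i x y _ <-; rewrite pD.
have pC a b : L2per (CT a b g) by have [_ /(_ g pg)[]] := CK a b.
exists rho, (nrm f * K * nrm g), (fun a b => p (inner f (CT a b g))); split => //.
  move=> a b; apply: le_trans (pn _) _; apply: le_trans (cauchy_schwarz pf (pC a b)) _.
  have [_ /(_ g pg)[_ h]] := CK a b.
  by apply: le_trans (ler_wpM2l (nrm_ge0 f) h) _; rewrite mulrA mulrA [X in X <= _]mulrAC.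
move=> k k1 k2 e e0.
have d0 : 0 < nrm f * nrm g + 1 by rewrite ltr_wpDl // mulr_ge0 ?nrm_ge0.
have [m0 hm0] := TC k k1 k2 _ (divr_gt0 e0 d0); exists m0 => m /hm0/(_ g pg)[pS hS].
have -> : \sum_(a < m) \sum_(b < m) (k.1 - k0.1) ^+ a * (k.2 - k0.2) ^+ b * p (inner f (CT a b g))
  = p (inner f (taylor_sum CT (k.1 - k0.1) (k.2 - k0.2) m g)).
  by rewrite inner_taylor // psum; apply: eq_bigr => a _; rewrite psum; apply: eq_bigr => b _;
    rewrite pZ.
rewrite -pN -pD -innerBr //; last 2 first.
- exact: op_analytic_L2per.
- exact: L2per_taylor_sum.
apply: le_trans (pn _) _; apply: le_trans (cauchy_schwarz pf pS) _.
apply: le_trans (ler_wpM2l (nrm_ge0 f) hS) _.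
rewrite mulrCA mulrAC -mulrA mulrA ler_pdivrMr // ler_pM2l //.
by rewrite ler_wpDr.
Qed.

Lemma nrm_wsum (I : eqType) (l : seq I) (c : I -> C) (e : I -> W) :
  (forall i, L2per (e i)) -> nrm (wsum l c e) <= \sum_(i <- l) normc (c i) * nrm (e i).
Proof.
move=> pe; elim: l => [|i l IHl]; first by rewrite wsum_nil big_nil nrm_wzero.
rewrite wsum_cons big_cons; apply: le_trans (nrmD _ _) _.
- exact: L2perZ.
- by apply: L2per_wsum.
by rewrite nrmZ // lerD2l.
Qed.

(** The product 0^a 0^b is 1 for a = b = 0 and 0 otherwise, so this is the double geometric sum
    without its constant term: at most (1 + 2 t)^2 - 1, which is linear in t for t <= 1/2. *)
Lemma sum_power_sub (x y t : R) (m : nat) : 0 <= t <= 2^-1 ->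
  \sum_(a < m.+1) \sum_(b < m.+1) (t ^+ a * t ^+ b - 0 ^+ a * 0 ^+ b) <= 8 * t.
Proof.
move=> /andP[t0 t1].
have -> : \sum_(a < m.+1) \sum_(b < m.+1) (t ^+ a * t ^+ b - 0 ^+ a * 0 ^+ b) =
   (\sum_(a < m.+1) t ^+ a) ^+ 2 - (\sum_(a < m.+1) 0 ^+ a) ^+ 2.
  by rewrite !expr2 !big_distrlr /= -sumrB; apply: eq_bigr => a _; rewrite -sumrB.
have -> : \sum_(a < m.+1) (0 : R) ^+ a = 1.
  by rewrite big_ord_recl expr0 big1 ?addr0 // => a _; rewrite expr0n.
rewrite big_ord_recl expr0.
have h : \sum_(a < m) t ^+ (lift ord0 a) <= 2 * t.
  rewrite -(big_mkord xpredT (fun a => t ^+ a.+1)) -(big_add1 _ _ 0%N m.+1 xpredT (fun a =>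
    t ^+ a)).
  by have := @sum_geometric_half R t 1 m.+1; rewrite t0 t1 expr1; apply.
have h0 : 0 <= \sum_(a < m) t ^+ (lift ord0 a) by apply: sumr_ge0 => a _; rewrite exprn_ge0.
move: (\sum_(a < m) _) h h0 => S h h0; rewrite expr1n; nra.
Qed.

Lemma op_analytic_continuous T (k0 : R * R) (eta : R) : op_analytic T -> 0 < eta ->
  exists2 d : R, 0 < d & forall k, `|k.1 - k0.1| < d -> `|k.2 - k0.2| < d ->
    forall f, L2per f -> nrm (wsub (T k f) (T k0 f)) <= eta * nrm f.
Proof.
move=> aT eta0; have [rho [K [CT [r0 CK TC]]]] := aT k0.
have K10 : 0 < `|K| + 1 by rewrite ltr_wpDl.
(* Within distance t rho of [k0] the Taylor sums at [k] and [k0] differ by at most 8 t |K| times the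
   norm, which this choice bounds by eta / 2. Each of the two remainders contributes eta / 4. *)
pose t := Num.min 2^-1 (eta / (16 * (`|K| + 1))).
have t0 : 0 < t by rewrite lt_min invr_gt0 ltr0n divr_gt0 ?mulr_gt0.
have t1 : t <= 2^-1 by rewrite ge_min lexx.
have t2 : 8 * t * `|K| <= eta / 2.
  have : t * (16 * (`|K| + 1)) <= eta.
    by rewrite -ler_pdivlMr ?mulr_gt0 // ge_min lexx orbT.
  by have := ltW t0; nra.
have trr : t * rho < rho by rewrite gtr_pMl //; apply: le_lt_trans t1 _; rewrite invf_lt1 // ltr1n.
exists (t * rho) => [|k k1 k2 f pf]; first by rewrite mulr_gt0.
have k1' := lt_trans k1 trr; have k2' := lt_trans k2 trr.
have z1 : `|k0.1 - k0.1| < rho by rewrite subrr normr0.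
have z2 : `|k0.2 - k0.2| < rho by rewrite subrr normr0.
have e0 : 0 < eta / 4 by rewrite divr_gt0.
have [m1 h1] := TC k k1' k2' _ e0; have [m2 h2] := TC k0 z1 z2 _ e0.
pose m := maxn m1 m2.
have [p1 {}h1] := h1 m.+1 (leq_trans (leq_maxl _ _) (leqnSn _)) f pf.
have [p2 {}h2] := h2 m.+1 (leq_trans (leq_maxr _ _) (leqnSn _)) f pf.
pose S x y := taylor_sum CT x y m.+1 f.
have pC a b : L2per (CT a b f) by have [_ /(_ f pf)[]] := CK a b.
have pS x y : L2per (S x y) by exact: L2per_taylor_sum.
set x := k.1 - k0.1 in k1 p1 h1; set y := k.2 - k0.2 in k2 p1 h1.
have hS : nrm (wsub (S x y) (S 0 0)) <= 8 * t * `|K| * nrm f.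
  pose c (q : 'I_m.+1 * 'I_m.+1) : C := (x ^+ q.1 * y ^+ q.2 - 0 ^+ q.1 * 0 ^+ q.2)%:C%C.
  have -> : wsub (S x y) (S 0 0) = wsum (index_enum _) c (fun q => CT q.1 q.2 f).
    apply: waveP => r s j; rewrite /wsub /wsum /S /taylor_sum -sumrB.
    under eq_bigr do rewrite -sumrB.
    rewrite pair_bigA; apply: eq_bigr => -[a b] _ /=.
    by rewrite /c rmorphB mulrBl.
  apply: le_trans (nrm_wsum _ _ _) _ => [q|]; first exact: pC.
  have cb (q : 'I_m.+1 * 'I_m.+1) : normc (c q) * nrm (CT q.1 q.2 f) <=
     (t ^+ q.1 * t ^+ q.2 - 0 ^+ q.1 * 0 ^+ q.2) * (`|K| * nrm f).
    have [_ /(_ f pf)[_ hC]] := CK q.1 q.2.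
    have hC' : nrm (CT q.1 q.2 f) <= (rho ^+ q.1 * rho ^+ q.2)^-1 * (`|K| * nrm f).
      apply: le_trans hC _; rewrite exprD [K / _]mulrC -mulrA.
      rewrite ler_wpM2l ?invr_ge0 ?mulr_ge0 ?exprn_ge0 ?(ltW r0) //.
      by rewrite ler_wpM2r ?nrm_ge0 // ler_norm.
    apply: le_trans (ler_wpM2l (normc_ge0 _) hC') _; rewrite mulrA.
    rewrite ler_wpM2r ?mulr_ge0 ?nrm_ge0 // ler_pdivrMr ?mulr_gt0 ?exprn_gt0 //.
    rewrite /c normc_real.
    have [/eqP e00|ne] := boolP ((q.1 + q.2)%N == 0%N).
      by move/eqP: e00; rewrite addn_eq0 => /andP[/eqP -> /eqP ->];
        rewrite !expr0 !mulr1 subrr normr0.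
    have -> : (0 : R) ^+ q.1 * 0 ^+ q.2 = 0.
      by rewrite -exprD expr0n (negbTE ne).
    rewrite !subr0 normrM !normrX mulrACA -!exprMn.
    apply: ler_pM; rewrite ?exprn_ge0 // lerXn2r ?nnegrE ?mulr_ge0 ?(ltW t0) ?(ltW r0) //;
      exact: ltW.
  apply: le_trans (ler_sum _ (fun q _ => cb q)) _.
  rewrite -mulr_suml -[leRHS]mulrA ler_wpM2r ?mulr_ge0 ?nrm_ge0 //.
  rewrite -(pair_bigA _ (fun a b : 'I_m.+1 => t ^+ a * t ^+ b - 0 ^+ a * 0 ^+ b)) /=.
  by apply: sum_power_sub => //; rewrite (ltW t0).
have h2' : nrm (wsub (T k0 f) (S 0 0)) <= eta / 4 * nrm f.
  by move: h2; rewrite /opsub !subrr.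
have pTk : L2per (T k f) by exact: op_analytic_L2per.
have pTk0 : L2per (T k0 f) by exact: op_analytic_L2per.
have tr1 := nrm_triangle pTk (pS x y) pTk0.
have tr2 := nrm_triangle (pS x y) (pS 0 0) pTk0.
rewrite nrm_subC in h2' => //; rewrite -/(S x y) in h1.
have h3 := ler_wpM2r (nrm_ge0 f) t2.
have h1' : nrm (wsub (T k f) (S x y)) <= eta / 4 * nrm f by exact: h1.
lra.
Qed.
End AnalyticOperators.

(** * The resolvent and the reflection symmetry *)

Section Resolvent.
Variables (R : realType) (N : nat).
Local Notation C := R[i].
Local Notation W := (wave R N).
Variables (D : set W) (H : W -> W).
Hypothesis HH : hamiltonian D H.
Implicit Types (f g : W) (k : R * R).

Lemma Hk_linear k (c : C) f g : dom_Hk D k f -> dom_Hk D k g ->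
  dom_Hk D k (wadd (wscale c f) g) /\
  eqae (Hk H k (wadd (wscale c f) g)) (wadd (wscale c (Hk H k f)) (Hk H k g)).
Proof.
move=> [pf df] [pg dg]; have [_ _ Hlin _] := HH.
have e : phase k (wadd (wscale c f) g) = wadd (wscale c (phase k f)) (phase k g).
  by apply: waveP => r s j; rewrite /phase /wadd /wscale mulrDr mulrCA.
have [dH eH] := Hlin c _ _ df dg; split.
  by split; [apply: L2perD => //; exact: L2perZ|rewrite e].
rewrite /Hk e; apply: eqae_trans (eqae_phase (- k) eH) _.
have -> : phase (- k) (wadd (wscale c (H (phase k f))) (H (phase k g))) =
  wadd (wscale c (phase (- k) (H (phase k f)))) (phase (- k) (H (phase k g))).
  by apply: waveP => r s j; rewrite /phase /wadd /wscale mulrDr mulrCA.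
exact: eqae_refl.
Qed.

Lemma Hk_minus_i_linear k (c : C) f g : dom_Hk D k f -> dom_Hk D k g ->
  eqae (Hk_minus_i H k (wadd (wscale c f) g))
       (wadd (wscale c (Hk_minus_i H k f)) (Hk_minus_i H k g)).
Proof.
move=> df dg; have [_ e] := Hk_linear c df dg.
rewrite /Hk_minus_i; apply: eqae_trans (eqaeB e (eqae_refl _)) _.
suff -> : wsub (wadd (wscale c (Hk H k f)) (Hk H k g)) (wscale 'i%C (wadd (wscale c f) g)) =
  wadd (wscale c (wsub (Hk H k f) (wscale 'i%C f))) (wsub (Hk H k g) (wscale 'i%C g)).
  exact: eqae_refl.
by apply: waveP => r s j; rewrite /wsub /wadd /wscale; ring.
Qed.

Definition zero_mode k f := dom_Hk D k f /\ eqae (Hk H k f) (@wzero R N).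

Lemma zero_mode_linear k (c : C) f g : zero_mode k f -> zero_mode k g ->
  zero_mode k (wadd (wscale c f) g).
Proof.
move=> [df ef] [dg eg]; have [d e] := Hk_linear c df dg; split => //.
apply: eqae_trans e _; apply: eqae_trans (eqaeD (eqaeZ c ef) eg) _.
suff -> : wadd (wscale c (@wzero R N)) (@wzero R N) = @wzero R N by exact: eqae_refl.
by apply: waveP => r s j; rewrite /wadd /wscale /wzero mulr0 addr0.
Qed.

Lemma zero_mode_wsum k (I : Type) (l : seq I) (c : I -> C) (e : I -> W) f :
  zero_mode k f -> (forall i, zero_mode k (e i)) -> zero_mode k (wsub f (wsum l c e)).
Proof.
move=> zf ze; elim: l => [|i l IHl].
  suff -> : wsub f (wsum [::] c e) = f by [].
  by apply: waveP => r s j; rewrite /wsub /wsum big_nil subr0.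
suff -> : wsub f (wsum (i :: l) c e) = wadd (wscale (- c i) (e i)) (wsub f (wsum l c e)).
  exact: zero_mode_linear.
by apply: waveP => r s j; rewrite /wsub /wadd /wscale /wsum big_cons; ring.
Qed.

Variables (k : R * R) (T : W -> W).
Hypotheses (resT : is_resolvent D H k T) (cT : compact_op T).

(** [T] is a bare function, not known to respect almost everywhere equality. Its norm bound replaces
    this: a function of norm zero has an image of norm zero. *)
Lemma Hk_minus_i_injective f : dom_Hk D k f ->
  eqae (Hk_minus_i H k f) (@wzero R N) -> eqae f (@wzero R N).
Proof.
move=> df e0; have [_ Tl] := resT; have [pH eT] := Tl f df; have [[c cT'] _] := cT.
have [pT hT] := cT' _ pH; apply: eqae_trans (eqae_sym eT) _; apply: nrm_eq0 => //.
move: hT; rewrite (nrm_ae e0) nrm_wzero mulr0 => hT.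
by apply/eqP; rewrite eq_le hT nrm_ge0.
Qed.

Lemma resolvent_unique f g : dom_Hk D k f -> L2per g -> eqae (Hk_minus_i H k f) g ->
  eqae (T g) f.
Proof.
move=> df pg e; have [Tr _] := resT; have [dT eT] := Tr g pg.
have h : eqae (wadd (wscale (-1) f) (T g)) (@wzero R N).
  have [d _] := Hk_linear (-1) df dT; apply: Hk_minus_i_injective => //.
  apply: eqae_trans (Hk_minus_i_linear (-1) df dT) _.
  apply: eqae_trans (eqaeD (eqaeZ _ e) eT) _.
  by apply: filterS (eqae_refl f) => r _ s j; rewrite /wadd /wscale /wzero mulN1r addNr.
by apply: filterS h => r + s j => /(_ s j); rewrite /wadd /wscale /wzero mulN1r addrC => /subr0_eq.
Qed.

(** Linearity is inherited from H_k - i, since the preimage under it is unique almost everywhere. *)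
Lemma resolvent_linear : linear_op T.
Proof.
move=> c f g pf pg; have [Tr _] := resT; have [df ef] := Tr f pf; have [dg eg] := Tr g pg.
apply: resolvent_unique.
- by have [] := Hk_linear c df dg.
- by apply: L2perD => //; exact: L2perZ.
- by apply: eqae_trans (Hk_minus_i_linear c df dg) (eqaeD (eqaeZ c ef) eg).
Qed.

Lemma i_real_neq0 (x : R) : x%:C%C - 'i%C != 0.
Proof. by apply/eqP => /(congr1 (@complex.Im R)) /=; lra. Qed.

Lemma resolvent_eigen (x : R) f : dom_Hk D k f -> eqae (Hk H k f) (wscale x%:C%C f) ->
  eqae (T f) (wscale (x%:C%C - 'i%C)^-1 f).
Proof.
move=> df ef; have pf := df.1; pose z := (x%:C%C - 'i%C)^-1.
have [Tr _] := resT.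
have e1 : eqae (Hk_minus_i H k f) (wscale (x%:C%C - 'i%C) f).
  apply: eqae_trans (eqaeB ef (eqae_refl _)) _.
  by apply: filterS (eqae_refl f) => r _ s j; rewrite /wsub /wscale mulrBl.
have e2 : eqae (T (wscale (x%:C%C - 'i%C) f)) f.
  by apply: resolvent_unique => //; exact: L2perZ.
have p0 := @L2per_zero R N.
have e3 : eqae (T (wadd (wscale (x%:C%C - 'i%C) f) (@wzero R N)))
               (wadd (wscale (x%:C%C - 'i%C) (T f)) (T (@wzero R N))).
  exact: resolvent_linear.
have T0 : eqae (T (@wzero R N)) (@wzero R N).
  have [[c cT'] _] := cT; have [pT hT] := cT' _ p0.
  apply: nrm_eq0 => //; apply/eqP; rewrite eq_le nrm_ge0 andbT.
  by move: hT; rewrite nrm_wzero mulr0.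
have e4 : wadd (wscale (x%:C%C - 'i%C) f) (@wzero R N) = wscale (x%:C%C - 'i%C) f.
  by apply: waveP => r s j; rewrite /wadd /wzero addr0.
move: e3; rewrite e4 => e3.
have e5 := eqae_trans (eqae_sym e2) (eqae_trans e3 (eqaeD (eqae_refl _) T0)).
apply: filterS e5 => r + s j => /(_ s j); rewrite /wadd /wscale /wzero addr0 => ->.
by rewrite mulrA mulVf ?mul1r // i_real_neq0.
Qed.
End Resolvent.

(** * Zero modes near a gapped point *)

Section Gap.
Variables (R : realType) (N M : nat).
Local Notation C := R[i].
Local Notation W := (wave R N).
Variables (D : set W) (H : W -> W) (eps : int -> R * R -> R) (Psi u : int -> R * R -> W).
Variable Res : R * R -> W -> W.
Hypothesis HH : hamiltonian D H.
Hypothesis eigenpairs : bloch_eigenpairs D H eps Psi.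
Hypothesis resolventRes : forall k, is_resolvent D H k (Res k).
Hypothesis compactRes : forall k, compact_op (Res k).
Hypothesis analyticRes : op_analytic Res.
Hypothesis HY : symmetry_assumption D H eps M.
Hypothesis Hu : gauge M Psi u.
Implicit Types (f g : W) (k q : R * R) (m n : band M).
Local Notation ub n k := (u (band_index n) k).
Local Notation P := (Pi M u).

Let wave_L2per := L2per_u eigenpairs Hu.

Lemma eigenpair_Hk k (a : int) : OmegaStar k -> a != 0 ->
  dom_Hk D k (phase (- k) (Psi a k)) /\
  eqae (Hk H k (phase (- k) (Psi a k))) (wscale (eps a k)%:C%C (phase (- k) (Psi a k))).
Proof.
move=> kO a0; have [ev [pe _ _] _ _] := eigenpairs kO; have [dP eP _] := ev a a0.
split; first by split; [exact: pe|rewrite phaseK].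
by rewrite /Hk phaseK -phaseZ; exact: eqae_phase.
Qed.

Lemma flat_eps n k : OmegaStar k -> eps (band_index n) k = 0.
Proof.
move=> kO; have [_ _ _ flat] := HY.
suff : flat_bands eps (band_index n) by case=> _; apply.
by rewrite flat; split; [exact: band_index_neq0|exact: band_index_le].
Qed.

Lemma flat_zero_mode n k : zero_mode D H k (ub n k).
Proof.
have [a [b kO]] := OmegaStar_cover k.
have e0 : phase k (ub n k) = phase (k + gammaS R a b) (ub n (k + gammaS R a b)).
  by rewrite (u_shift Hu k a b) phaseD.
have [ev _ _ _] := eigenpairs kO; have [ue _ _ _ _] := Hu.
set k' := k + gammaS R a b in kO e0 ev; have [dP eP _] := ev _ (band_index_neq0 n).
have e1 : eqae (Psi (band_index n) k') (phase k (ub n k)).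
  rewrite e0; apply: eqae_sym.
  by apply: eqae_trans (eqae_phase k' (ue n _ kO)) _; rewrite phaseK; exact: eqae_refl.
have [_ Hae _ _] := HH.
have mu : measurable_wave (phase k (ub n k)).
  by apply: measurable_phase; have [] := wave_L2per n k.
have [d e] := Hae _ _ dP mu e1; split; first by split => //; exact: wave_L2per.
have e2 : eqae (H (phase k (ub n k))) (@wzero R N).
  apply: eqae_trans (eqae_sym e) _; apply: eqae_trans eP _; rewrite flat_eps //.
  by apply: filterS (eqae_refl (@wzero R N)) => r _ s j; rewrite /wscale mul0r.
apply: eqae_trans (eqae_phase (- k) e2) _.
by apply: filterS (eqae_refl (@wzero R N)) => r _ s j; rewrite /phase /wzero mulr0.
Qed.

(** Band M + 1 is not flat, so it is nonzero at some [k0]; the ordering of the bands and the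
    symmetry of the spectrum then keep all other nonflat bands at least as far from zero. *)
Lemma spectral_gap : exists (k0 : R * R) (E : R), [/\ OmegaStar k0, 0 < E &
  forall a : int, (M < `|a|)%N -> E <= `|eps a k0|].
Proof.
have [_ _ epsN flat] := HY.
have [k0 kO e0] : exists2 k0, OmegaStar k0 & eps M.+1%:Z k0 != 0.
  apply: contrapT => h; have : flat_bands eps M.+1%:Z.
    split=> // k kO; apply: contrapT => /eqP e; apply: h; by exists k.
  by rewrite flat => -[_] /=; rewrite ltnn.
have [_ _ /andP[_ e1] mono] := eigenpairs kO.
have incr (b : nat) : 0 <= eps b.+1%:Z k0 /\ (M <= b)%N -> eps M.+1%:Z k0 <= eps b.+1%:Z k0.
  move=> [_]; elim: b => [|b IHb]; first by rewrite leqn0 => /eqP ->.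
  rewrite leq_eqVlt => /orP[/eqP <- //|]; rewrite ltnS => /IHb h; apply: le_trans h _.
  have -> : b.+2%:Z = b.+1%:Z + 1 by lia.
  by have [] := mono b.+1%:Z isT.
have pos (b : nat) : 0 <= eps b.+1%:Z k0.
  elim: b => // b IHb; apply: le_trans IHb _.
  have -> : b.+2%:Z = b.+1%:Z + 1 by lia.
  by have [] := mono b.+1%:Z isT.
have E0 : 0 < eps M.+1%:Z k0 by rewrite lt_def e0 pos.
exists k0, (eps M.+1%:Z k0); split => // -[] [|b] //=; rewrite ltnS => Mb.
- by rewrite ger0_norm // incr.
- by rewrite NegzE epsN // normrN ger0_norm // incr.
- by rewrite NegzE epsN // normrN ger0_norm // incr.
Qed.

(** A zero mode gives the resolvent the eigenvalue 1 / (0 - i) = i, and |1 / (x - i) - i|^2 = x^2 /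
    (x^2 + 1) increases with |x|. *)
Lemma resolvent_gap (x E : R) : 0 < E -> E <= `|x| ->
  E ^+ 2 / (E ^+ 2 + 1) <= normc ((x%:C%C - 'i%C)^-1 - 'i%C) ^+ 2.
Proof.
move=> E0 Ex.
have e : ((x%:C%C - 'i%C)^-1 - 'i%C) * (x%:C%C - 'i%C) = - ('i%C * x%:C%C).
  rewrite mulrBl mulVf ?i_real_neq0 // mulrBr -expr2 sqr_i; ring.
have e2 : normc ((x%:C%C - 'i%C)^-1 - 'i%C) ^+ 2 * (x ^+ 2 + 1) = x ^+ 2.
  have <- : normc (x%:C%C - 'i%C) ^+ 2 = x ^+ 2 + 1 by rewrite normc2 /=; ring.
  by rewrite -exprMn -ComplexField.Normc.normcM e normc2 /=; ring.
have xE : E ^+ 2 <= x ^+ 2 by rewrite -[x ^+ 2]sqr_norm_real lerXn2r ?nnegrE ?(ltW E0).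
have p0 : 0 < E ^+ 2 + 1 by rewrite ltr_wpDl ?sqr_ge0.
rewrite ler_pdivrMr //.
have := sqr_ge0 (normc ((x%:C%C - 'i%C)^-1 - 'i%C)).
have : normc ((x%:C%C - 'i%C)^-1 - 'i%C) ^+ 2 <= 1 by nra.
move: (normc _ ^+ 2) e2 => y; have := sqr_ge0 E; move: (E ^+ 2) (x ^+ 2) xE => a b; nra.
Qed.

Definition zlist (n : nat) : seq int := [seq a <- zrange n | a != 0].

Lemma uniq_zlist (n : nat) : uniq (zlist n). Proof. by rewrite filter_uniq // uniq_zrange. Qed.

Lemma mem_zlist (n : nat) (a : int) : (a \in zlist n) = (a != 0) && (`|a|%N <= n)%N.
Proof. by rewrite mem_filter mem_zrange. Qed.

(* Near a point where the other bands are away from 0, no zero mode of H_k is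
   orthogonal to the flat bands: its coefficients on the basis at k0 are
   controlled by Pi(k0) - Pi(k) for the flat bands and by the difference of the
   resolvents for the others. *)
Lemma zero_mode_stability : exists (k0 : R * R) (d : R), 0 < d /\ forall k,
  `|k.1 - k0.1| < d -> `|k.2 - k0.2| < d -> forall f, zero_mode D H k f ->
  (forall n, inner (ub n k) f = 0) -> eqae f (@wzero R N).
Proof.
have [k0 [E [kO E0 hE]]] := spectral_gap.
(* A lower bound for the squared distance to i of the resolvent eigenvalues of the nonflat bands at
   [k0]. *)
pose d2 := E ^+ 2 / (E ^+ 2 + 1).
have d20 : 0 < d2 by rewrite divr_gt0 ?exprn_gt0 // ltr_wpDl ?sqr_ge0.
have d21 : d2 <= 1 by rewrite ler_pdivrMr ?mul1r ?lerDl // ltr_wpDl ?sqr_ge0.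
have eta0 : 0 < d2 / 2 by rewrite divr_gt0.
have [ue aP _ _ _] := Hu.
have [d1 d10 c1] := op_analytic_continuous k0 analyticRes eta0.
have [d3 d30 c3] := op_analytic_continuous k0 aP eta0.
exists k0, (Num.min d1 d3); split; first by rewrite lt_min d10.
move=> k; rewrite !lt_min => /andP[k11 k13] /andP[k21 k23] f zf f0.
have pf : L2per f by case: zf => -[].
have {}c1 := c1 k k11 k21 f pf; have {}c3 := c3 k k13 k23 f pf.
have [_ [pe oe te] _ _] := eigenpairs kO.
pose e a := phase (- k0) (Psi a k0).
(* Since Pi(k) f = 0 and Res(k) f = i f, these are the increments of Pi f and Res f between k and
   [k0], so continuity makes both at most d2 / 2 times the norm of [f]. *)
pose h := P k0 f; pose g := wsub (Res k0 f) (wscale 'i%C f).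
have pR k' : L2per (Res k' f) by exact: op_analytic_L2per.
have pif : L2per (wscale 'i%C f) by exact: L2perZ.
have pg : L2per g by exact: L2perB.
have ph : L2per h by exact: (L2per_Pi eigenpairs Hu).
have hn : nrm h <= d2 / 2 * nrm f.
  have <- : nrm (wsub (P k f) (P k0 f)) = nrm h; last by [].
  rewrite nrm_subC //; try exact: (L2per_Pi eigenpairs Hu); congr nrm.
  apply: waveP => r s j; rewrite /wsub (PiE M u k) /wsum big1 ?subr0 // => n _.
  by rewrite f0 mul0r.
have ikf : eqae (Res k f) (wscale 'i%C f).
  have [df ef] := zf.
  have := resolvent_eigen HH (resolventRes k) (compactRes k) (x := 0) df.
  have -> : ((0 : R)%:C%C - 'i%C)^-1 = 'i%C :> C.
    by rewrite sub0r invrN invCi opprK.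
  apply; apply: eqae_trans ef _.
  by apply: filterS (eqae_refl f) => r _ s j; rewrite /wscale mul0r.
have gn : nrm g <= d2 / 2 * nrm f.
  rewrite /g (nrm_ae (eqaeB (eqae_refl (Res k0 f)) (eqae_sym ikf))) nrm_subC //.
have lu := uniq_zlist; pose A := [set a : int | a != 0].
have lS (m n : nat) : (m <= n)%N -> {subset zlist m <= zlist n}.
  by move=> mn a; rewrite !mem_zlist => /andP[-> /leq_trans]; apply.
have lA (n : nat) a : a \in zlist n -> A a by rewrite mem_zlist => /andP[].
have Al a : A a -> exists n : nat, a \in zlist n.
  by move=> a0; exists `|a|%N; rewrite mem_zlist leqnn andbT.
have [[c bR] _] := compactRes k0.
have ga a : A a -> inner (e a) g = ((eps a k0)%:C%C - 'i%C)^-1 * inner (e a) f - 'i%C * inner (e a) f.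
  move=> a0; rewrite innerBr //; try exact: pe.
  rewrite innerZr //; last exact: pe.
  congr (_ - _).
  apply: (inner_diagonal (lam := fun a =>
    ((eps a k0)%:C%C - 'i%C)^-1) lu lS lA Al pe oe te _ bR) => //.
    exact: (resolvent_linear HH (resolventRes k0) (compactRes k0)).
  move=> b b0; have [db eb] := eigenpair_Hk kO b0.
  exact: (resolvent_eigen HH (resolventRes k0) (compactRes k0)).
have ca a : A a -> normc (inner (e a) f) ^+ 2 <=
    normc (inner (e a) h) ^+ 2 + d2^-1 * normc (inner (e a) g) ^+ 2.
  move=> a0; have [aM|aM] := leqP `|a|%N M.
    have [n na] := band_indexP a0 aM.
    have -> : inner (e a) h = inner (e a) f.
      rewrite -na /e -(inner_ae (ue n _ kO) (eqae_refl _)) (inner_Pi eigenpairs Hu).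
      by rewrite (inner_ae (ue n _ kO) (eqae_refl _)).
    by rewrite lerDl mulr_ge0 ?sqr_ge0 // invr_ge0 ltW.
  rewrite ga // -mulrBl ComplexField.Normc.normcM exprMn mulrA.
  apply: le_trans (_ : _ <= d2^-1 * normc (((eps a k0)%:C%C - 'i%C)^-1 - 'i%C) ^+ 2 * normc (inner (e a) f) ^+ 2) _; last by rewrite lerDr sqr_ge0.
  rewrite ler_peMl ?sqr_ge0 // ler_pdivlMl // mulr1.
  by apply: resolvent_gap E0 _; exact: hE.
(* The two contributions are d2^2 / 4 from [h] and (d2 / 2)^2 / d2 = d2 / 4 from [g]; together they
   are at most 1/2, as d2 <= 1. *)
have coef_le (n : nat) : \sum_(a <- zlist n) normc (inner (e a) f) ^+ 2 <= nrm f ^+ 2 / 2.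
  have b1 := bessel lu lS lA pe oe n ph; have b2 := bessel lu lS lA pe oe n pg.
  apply: le_trans (_ : _ <= \sum_(a <- zlist n) (normc (inner (e a) h) ^+ 2 +
    d2^-1 * normc (inner (e a) g) ^+ 2)) _.
    by rewrite big_seq [leRHS]big_seq; apply: ler_sum => a /lA; exact: ca.
  rewrite big_split -mulr_sumr.
  apply: le_trans (lerD b1 (ler_wpM2l _ b2)) _; first by rewrite invr_ge0 ltW.
  have hq : nrm h ^+ 2 <= (d2 / 2 * nrm f) ^+ 2 by rewrite lerXn2r ?nnegrE ?nrm_ge0 // mulr_ge0 ?nrm_ge0 ?(ltW eta0).
  have gq : nrm g ^+ 2 <= (d2 / 2 * nrm f) ^+ 2 by rewrite lerXn2r ?nnegrE ?nrm_ge0 // mulr_ge0 ?nrm_ge0 ?(ltW eta0).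
  have := ler_wpM2l (_ : 0 <= d2^-1) gq; rewrite invr_ge0 (ltW d20) => /(_ isT).
  have -> : d2^-1 * (d2 / 2 * nrm f) ^+ 2 = d2 / 4 * nrm f ^+ 2 by field; rewrite gt_eqF.
  move: hq; rewrite exprMn; have := sqr_ge0 (nrm f);
    move: (d2^-1 * _) (nrm h ^+ 2) (nrm f ^+ 2) => x y z z0 hq gq'.
  have : (d2 / 2) ^+ 2 <= 1 / 4 by nra.
  nra.
have := nrm_ge0 f; rewrite le0r => /orP[/eqP nf|nf]; first exact: nrm_eq0.
have nf2 : 0 < nrm f / 2 by rewrite divr_gt0.
(* A partial sum carries at most half of the square norm and this remainder at most a quarter, which
   is impossible for a nonzero [f]. *)
have [n0 /(_ n0 (leqnn _)) hr] := partial_cvg lu lS lA Al pe oe te pf nf2.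
have := nrm_residue lu lS lA pe oe n0 pf.
rewrite (nrm_partial lu lA pe oe).
have := coef_le n0; have : nrm (wsub f (partial zlist e n0 f)) ^+ 2 <= (nrm f / 2) ^+ 2.
  by rewrite lerXn2r ?nnegrE ?nrm_ge0 ?(ltW nf2).
move: (nrm (wsub _ _) ^+ 2) (\sum_(a <- _) _) => x y; nra.
Qed.
End Gap.

(** * Invariance of the flat bands under L *)

Section Reflection.
Variables (R : realType) (N M : nat).
Local Notation C := R[i].
Local Notation W := (wave R N).
Variables (D : set W) (H : W -> W) (eps : int -> R * R -> R) (Psi u : int -> R * R -> W).
Variable Res : R * R -> W -> W.
Hypothesis HH : hamiltonian D H.
Hypothesis eigenpairs : bloch_eigenpairs D H eps Psi.
Hypothesis resolventRes : forall k, is_resolvent D H k (Res k).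
Hypothesis compactRes : forall k, compact_op (Res k).
Hypothesis analyticRes : op_analytic Res.
Hypothesis HY : symmetry_assumption D H eps M.
Hypothesis Hu : gauge M Psi u.
Implicit Types (f g : W) (k q : R * R) (m n : band M) (s : bool).
Local Notation ub n k := (u (band_index n) k).
Local Notation P := (Pi M u).
Local Notation w n k := (opL (ub n (- k))).
Local Notation sigma := ((-1) ^+ N.+1 : C).

Let pu n k : L2per (ub n k). Proof. exact: (L2per_u eigenpairs Hu). Qed.
Let pw n k : L2per (w n k). Proof. exact: L2per_opL. Qed.
Let pP k f : L2per (P k f). Proof. exact: (L2per_Pi eigenpairs Hu). Qed.

Lemma reflected_zero_mode n k : zero_mode D H k (w n k).
Proof.
have [[_ du] eu] := flat_zero_mode HH eigenpairs HY Hu n (- k).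
have [_ [_ antiL] _ _] := HY; have [dL eL] := antiL _ du.
have e1 : opL (phase (- k) (ub n (- k))) = phase k (w n k) by rewrite phase_opL opprK.
split; first by split => //; rewrite -e1.
have e2 : eqae (H (phase (- k) (ub n (- k)))) (@wzero R N).
  have := eqae_phase (- k) eu; rewrite /Hk phaseK => e; apply: eqae_trans e _.
  by apply: filterS (eqae_refl (@wzero R N)) => r _ s j; rewrite /phase /wzero mulr0.
have e3 : eqae (H (phase k (w n k))) (@wzero R N).
  rewrite -e1; apply: eqae_trans eL _; apply: eqae_trans (eqaeZ _ (eqae_opL e2)) _.
  by apply: filterS (eqae_refl (@wzero R N)) => r _ s j; rewrite /wscale /opL /wzero !mulr0.
apply: eqae_trans (eqae_phase (- k) e3) _.
by apply: filterS (eqae_refl (@wzero R N)) => r _ s j; rewrite /phase /wzero mulr0.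
Qed.

Lemma opZ_reflected n k : eqae (opZ (w n k)) (wscale (signS R n.1) (w n k)).
Proof. by rewrite opZ_opL -opL_scale; apply: eqae_opL; exact: (opZ_u Hu). Qed.

Lemma reflected_orthonormal m n k : inner (w m k) (w n k) = (m == n)%:R.
Proof. by rewrite inner_opL // (u_orthonormal eigenpairs Hu). Qed.

Lemma inner_Pi_sum k f g : L2per f ->
  inner f (P k g) = \sum_(n : band M) inner f (ub n k) * inner (ub n k) g.
Proof.
by move=> pf; rewrite PiE inner_wsumr //; apply: eq_bigr => n _; rewrite mulrC.
Qed.

Lemma inner_Pil k f g : L2per f -> L2per g -> inner (P k f) g = inner f (P k g).
Proof.
move=> pf pg; rewrite inner_Pi_sum // PiE inner_wsuml //; apply: eq_bigr => n _.
by rewrite -inner_conj.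
Qed.

Lemma Pi_idem_inner k f g : L2per f -> L2per g -> inner (P k f) (P k g) = inner f (P k g).
Proof.
move=> pf pg; rewrite (inner_Pil k pf (pP k g)) (inner_Pi_sum k (P k g) pf) (inner_Pi_sum k g pf).
by apply: eq_bigr => n _; rewrite (inner_Pi eigenpairs Hu).
Qed.

Section Unitary.
Variable k : R * R.
Hypothesis wP : forall n, eqae (w n k) (P k (w n k)).

Definition overlap s : 'M[C]_M := \matrix_(a, b) inner (ub (s, a) k) (w (s, b) k).
Local Notation U := overlap.

Lemma reflected_expand s b :
  eqae (w (s, b) k) (wsum (index_enum 'I_M) (fun a => U s a b) (fun a => ub (s, a) k)).
Proof.
apply: eqae_trans (wP (s, b)) _; apply: filterS (eqae_refl (w (s, b) k)) => r _ s' j.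
rewrite PiE /wsum (sum_band (fun n => inner (ub n k) (w (s, b) k) * ub n k r s' j)).
rewrite (bigD1 s) //= -[RHS]addr0; congr (_ + _); first by apply: eq_bigr => a _; rewrite mxE.
rewrite big1 // => t ts; rewrite big1 // => a _.
rewrite (inner_sector (pu (t, a) k) (pw (s, b) k) _ _ ts) ?mul0r //.
  exact: (opZ_u Hu).
exact: opZ_reflected.
Qed.

Lemma overlap_unitary s : map_mx (@conjc R) (U s)^T *m U s = 1%:M.
Proof.
apply/matrixP => a b; have := reflected_orthonormal (s, a) (s, b) k.
rewrite (inner_ae (reflected_expand s a) (eqae_refl _)) inner_wsuml //.
rewrite !mxE xpair_eqE eqxx /= => <-; apply: eq_bigr => l _.
by rewrite !mxE.
Qed.

Lemma overlap_trace s (B : 'M[C]_M) : \tr (map_mx (@conjc R) (U s)^T *m B *m U s) = \tr B.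
Proof.
by rewrite mxtrace_mulC mulmxA (mulmx1C (overlap_unitary s)) mul1mx.
Qed.

(** The trace of a sesquilinear form is the same in any two orthonormal bases of a space. [B] is a
    bare function, so sesquilinearity is only requested on the expansions at hand. *)
Lemma reflected_trace s (B : W -> W -> C) :
  (forall a b, B (w (s, a) k) (w (s, b) k) =
    \sum_l \sum_l' (U s l a)^*%C * U s l' b * B (ub (s, l) k) (ub (s, l') k)) ->
  \sum_(a < M) B (w (s, a) k) (w (s, a) k) = \sum_(a < M) B (ub (s, a) k) (ub (s, a) k).
Proof.
move=> hB; pose A : 'M[C]_M := \matrix_(a, b) B (ub (s, a) k) (ub (s, b) k).
transitivity (\tr A); last by apply: eq_bigr => a _; rewrite mxE.
rewrite -(overlap_trace s A); apply: eq_bigr => a _; rewrite hB [RHS]mxE exchange_big.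
apply: eq_bigr => l' _; rewrite [X in _ = X * _]mxE big_distrl; apply: eq_bigr => l _.
rewrite mulrAC; congr (_ * _ * _).
  by rewrite [RHS]mxE [X in _ = X^*%C]mxE.
by rewrite [RHS]mxE.
Qed.

Lemma reflected_projector f g : L2per f -> L2per g ->
  \sum_(n : band M) inner f (w n k) * inner (w n k) g = \sum_(n : band M) inner f (ub n k) * inner (ub n k) g.
Proof.
move=> pf pg; rewrite !sum_band; apply: eq_bigr => s _.
apply: (reflected_trace (B := fun x y => inner f y * inner x g)) => a b.
rewrite (inner_ae (eqae_refl f) (reflected_expand s b)) inner_wsumr //.
rewrite (inner_ae (reflected_expand s a) (eqae_refl g)) inner_wsuml //.
rewrite mulrC big_distrlr; apply: eq_bigr => l _; apply: eq_bigr => l' _.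
by rewrite /=; ring.
Qed.

Lemma reflected_form (c d : int) :
  \sum_(a < M) inner (w (true, a) k) (phase (- gammaS R c d) (w (true, a) k)) =
  \sum_(a < M) inner (ub (true, a) k) (phase (- gammaS R c d) (ub (true, a) k)).
Proof.
apply: (reflected_trace (B := fun x y => inner x (phase (- gammaS R c d) y))) => a b.
have ph n : L2per (phase (- gammaS R c d) (ub n k)) by rewrite -gammaSN; exact: L2per_phase.
rewrite (inner_ae (reflected_expand _ a) (eqae_phase _ (reflected_expand _ b))).
have -> : phase (- gammaS R c d) (wsum (index_enum 'I_M) (fun a => U true a b) (fun a =>
  ub (true, a) k))
  = wsum (index_enum 'I_M) (fun a => U true a b) (fun a => phase (- gammaS R c d) (ub (true, a) k)).
  by apply: waveP => r s j; rewrite /phase /wsum big_distrr; apply: eq_bigr => l _; rewrite mulrCA.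
rewrite inner_wsuml //; last by apply: L2per_wsum.
apply: eq_bigr => l _; rewrite inner_wsumr // big_distrr; apply: eq_bigr => l' _.
by rewrite /= mulrA.
Qed.
End Unitary.

Lemma sigma2 : sigma * sigma = 1.
Proof. by rewrite -expr2 -exprM mulnC exprM sqrrN expr1n expr1n. Qed.

(** L preserves inner products and squares to [sigma]; each of the two factors picks up this sign,
    and the signs cancel. *)
Lemma inner_reflected_Pi k f g : L2per f -> L2per g ->
  inner (opL f) (P (- k) (opL g)) = \sum_(n : band M) inner f (w n k) * inner (w n k) g.
Proof.
move=> pf pg; have pLf := L2per_opL pf; have pLg := L2per_opL pg.
rewrite inner_Pi_sum //; apply: eq_bigr => n _.
rewrite -(inner_opL (L2per_opL pf) (pu n (- k))) -(inner_opL (pu n (- k)) (L2per_opL pg)).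
by rewrite !opLK innerZl // innerZr // signC_real mulrACA sigma2 mul1r.
Qed.

(** The component of a reflected Bloch function outside the flat span is a zero mode orthogonal to
    the flat bands at k, and [zero_mode_stability] excludes nonzero ones. *)
Lemma reflected_stable_near : exists (k0 : R * R) (d : R), 0 < d /\ forall k,
  `|k.1 - k0.1| < d -> `|k.2 - k0.2| < d -> forall n, eqae (w n k) (P k (w n k)).
Proof.
have [k0 [d [d0 hd]]] := zero_mode_stability HH eigenpairs resolventRes compactRes analyticRes HY Hu.
exists k0, d; split => // k k1 k2 n.
have h : eqae (wsub (w n k) (P k (w n k))) (@wzero R N).
  apply: (hd k k1 k2) => [|m].
    apply: (zero_mode_wsum HH) => [|m]; first exact: reflected_zero_mode.
    exact: (flat_zero_mode HH eigenpairs HY Hu).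
  by rewrite innerBr // (inner_Pi eigenpairs Hu) subrr.
by apply: filterS h => r + s j => /(_ s j); rewrite /wsub /wzero => /subr0_eq.
Qed.

(* The identity holds near a point where the flat bands are isolated; both sides
   are real-analytic in k, so it holds everywhere. *)
Lemma Pi_reflection k f g : L2per f -> L2per g ->
  inner f (P k g) = inner (opL f) (P (- k) (opL g)).
Proof.
move=> pf pg; have [k0 [d [d0 hd]]] := reflected_stable_near.
have pLf := L2per_opL pf; have pLg := L2per_opL pg; have [_ aP _ _ _] := Hu.
have near q : `|q.1 - k0.1| < d -> `|q.2 - k0.2| < d ->
  inner f (P q g) = inner (opL f) (P (- q) (opL g)).
  move=> q1 q2; rewrite inner_reflected_Pi // reflected_projector ?inner_Pi_sum //.
  exact: hd.
have Rer (r : R) (z : C) : complex.Re (r%:C%C * z) = r * complex.Re z by rewrite ReM /= mul0r subr0.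
have Imr (r : R) (z : C) : complex.Im (r%:C%C * z) = r * complex.Im z by rewrite ImM /= mul0r addr0.
apply: eqC; apply/eqP; rewrite -subr_eq0; apply/eqP.
  apply: (analytic2_eq0 (f := fun k => complex.Re (inner f (P k g)) -
     complex.Re (inner (opL f) (P (- k) (opL g)))) (k0 := k0) _ d0) => [|q q1 q2]; last first.
    by rewrite near // subrr.
  apply: analytic2B; last apply: (analytic2_opp (f := fun k =>
    complex.Re (inner (opL f) (P k (opL g)))));
    by apply: (analytic2_inner (p := @complex.Re R)) => //; [exact: ReD|exact: Re_le_normc].
apply: (analytic2_eq0 (f := fun k => complex.Im (inner f (P k g)) -
   complex.Im (inner (opL f) (P (- k) (opL g)))) (k0 := k0) _ d0) => [|q q1 q2]; last first.
  by rewrite near // subrr.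
apply: analytic2B; last apply: (analytic2_opp (f := fun k =>
  complex.Im (inner (opL f) (P k (opL g)))));
  by apply: (analytic2_inner (p := @complex.Im R)) => //; [exact: ImD|exact: Im_le_normc].
Qed.

(** Applying L again returns the flat band function at -k up to sign, so the reflection identity
    gives <w, Pi(k) w> = 1 = |w|^2: the projection loses no norm. *)
Lemma reflected_stable k n : eqae (w n k) (P k (w n k)).
Proof.
have e1 : inner (w n k) (P k (w n k)) = 1.
  rewrite Pi_reflection // opLK inner_Pi_sum; last exact: L2perZ.
  rewrite (bigD1 n) //= big1 ?addr0 => [|m mn];
    rewrite innerZr // innerZl // !(u_orthonormal eigenpairs Hu).
    by rewrite eqxx !mulr1 signC_real sigma2.
  by rewrite (negbTE mn) !mulr0.
have pS : L2per (wsub (w n k) (P k (w n k))) by exact: L2perB.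
apply: nrm_subr0 => //; apply/eqP; rewrite -sqrf_eq0; apply/eqP.
have : (nrm (wsub (w n k) (P k (w n k))) ^+ 2)%:C%C = 0 :> C.
  rewrite -inner_nrm // innerBr // !innerBl // Pi_idem_inner // inner_Pil // e1.
  by rewrite reflected_orthonormal eqxx !subrr.
by move=> /(congr1 (@complex.Re R)).
Qed.

(** The trace at k may be computed in the reflected basis. There L turns the phase of frequency -G
    into that of frequency G, and moving it across the inner product conjugates the trace at -k. *)
Lemma trace_form_block_opp k (a b : int) :
  \tr (form_block M u k (gammaS R a b)) =
  (\tr (form_block M u (- k) (gammaS R a b)))^*%C.
Proof.
have [_ _ _ _ uG] := Hu; set G := gammaS R a b.
have F q : \tr (form_block M u q G) =
    \sum_(c < M) inner (ub (true, c) q) (phase (- G) (ub (true, c) q)).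
  by apply: eq_bigr => c _; rewrite mxE (form_factorE eigenpairs Hu) uG.
apply: etrans (F k) (etrans _ (congr1 (@conjc R) (esym (F (- k))))).
apply: etrans (esym (reflected_form (@reflected_stable k) a b)) _.
rewrite -/G rmorph_sum.
apply: eq_bigr => c _.
have pG : L2per (phase (- G) (ub (true, c) (- k))) by rewrite -gammaSN; exact: L2per_phase.
have pG' : L2per (phase G (ub (true, c) (- k))) by exact: L2per_phase.
rewrite -phase_opL inner_opL //.
by apply: etrans (inner_conj (pu (true, c) (- k)) pG); rewrite inner_phasel opprK.
Qed.
End Reflection.

Lemma conjD (R : realType) (z w : R[i]) : (z + w)^*%C = z^*%C + w^*%C.
Proof. exact: rmorphD. Qed.

Lemma conj_sum (R : realType) (I : Type) (r : seq I) (P : pred I) (F : I -> R[i]) :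
  (\sum_(a <- r | P a) F a)^*%C = \sum_(a <- r | P a) (F a)^*%C.
Proof. exact: rmorph_sum. Qed.

(** * Determinants in Fock space *)

Section FermionicFock.
Variables (R : realType) (T : finType).
Local Notation C := R[i].
Local Notation fock := (fock R T).
Implicit Types (psi phi chi : fock) (t : T) (S : {set T}) (x y : T -> C).

(** In product form, adding or removing an occupied mode splits off one factor, which is all the
    anticommutation relations need. *)
Lemma jw_signE t S :
  jw_sign R t S = \prod_(t' in S) (-1) ^+ (enum_rank t' < enum_rank t)%N.
Proof.
rewrite /jw_sign prodrXr; congr (_ ^+ _).
by rewrite -sum1_card big_mkcond [RHS]big_mkcond; apply: eq_bigr => t' _; rewrite inE;
  case: (t' \in S); case: (_ < _)%N.
Qed.

Lemma jw_signU1 t (t' : T) S : t' \notin S ->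
  jw_sign R t (t' |: S)%SET = (-1) ^+ (enum_rank t' < enum_rank t)%N * jw_sign R t S.
Proof. by move=> tS; rewrite !jw_signE big_setU1. Qed.

Lemma jw_signD1 t (t' : T) S : t' \in S ->
  jw_sign R t S = (-1) ^+ (enum_rank t' < enum_rank t)%N * jw_sign R t (S :\ t')%SET.
Proof. by move=> tS; rewrite !jw_signE (big_setD1 t'). Qed.

Lemma jw_sign_sqr t S : jw_sign R t S * jw_sign R t S = 1.
Proof. by rewrite /jw_sign -expr2 -exprM mulnC exprM sqrrN expr1n expr1n. Qed.

Lemma jw_sign_conj t S : (jw_sign R t S)^*%C = jw_sign R t S.
Proof. exact: signC_real. Qed.

Lemma sign_anti t (t' : T) : t != t' ->
  (-1) ^+ (enum_rank t < enum_rank t')%N = - (-1) ^+ (enum_rank t' < enum_rank t)%N :> C.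
Proof.
move=> tt'; have : enum_rank t != enum_rank t' :> nat.
  by apply: contra tt' => /eqP/val_inj/enum_rank_inj ->.
by case: ltngtP => // _ _; rewrite ?expr0 ?expr1 ?opprK.
Qed.

Lemma create_annihilate t (t' : T) psi :
  create t (annihilate t' psi) + annihilate t' (create t psi) = fscale (t == t')%:R psi.
Proof.
apply/ffunP => S; rewrite !ffunE.
have [<-|tt'] := eqVneq t t'.
  rewrite !inE eqxx mul1r /=; have [tS|tS] := boolP (t \in S).
    rewrite addr0 mulrA {1}(jw_signD1 t tS) ltnn expr0 mul1r jw_sign_sqr mul1r.
    by rewrite finset.setD1K.
  rewrite add0r mulrA (jw_signU1 t tS) ltnn expr0 mul1r jw_sign_sqr mul1r.
  by rewrite finset.setU1K.
rewrite mul0r !inE (negbTE tt') /= eq_sym (negbTE tt') /=.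
have [tS|tS] := boolP (t \in S); last by case: (t' \in S); rewrite ?mulr0 addr0.
have [t'S|t'S] := boolP (t' \in S); first by rewrite mulr0 addr0.
rewrite (jw_signU1 t t'S) (jw_signD1 t' tS) (sign_anti tt').
have -> : ((t' |: S) :\ t = t' |: (S :\ t))%SET.
  apply/setP => z; rewrite !inE; have [->|//] := eqVneq z t.
  by rewrite (negbTE tt').
by case: (enum_rank t' < enum_rank t)%N; rewrite ?expr1 ?expr0; ring.
Qed.

Lemma create_create t (t' : T) psi : create t (create t' psi) = - create t' (create t psi).
Proof.
apply/ffunP => S; rewrite !ffunE !inE.
have [<-|tt'] := eqVneq t t'; first by rewrite /= ?eqxx /=; case: ifP => _; rewrite ?mulr0 oppr0.
rewrite /=; case: ifP => tS; case: ifP => t'S; rewrite ?mulr0 ?oppr0 //.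
rewrite (jw_signD1 t t'S) (jw_signD1 t' tS) (sign_anti tt') finset.setDDl finset.setUC -finset.setDDl.
by ring.
Qed.

Lemma annihilate_annihilate t (t' : T) psi :
  annihilate t (annihilate t' psi) = - annihilate t' (annihilate t psi).
Proof.
apply/ffunP => S; rewrite !ffunE !inE.
have [<-|tt'] := eqVneq t t'; first by rewrite /= ?eqxx /=; case: ifP => _; rewrite ?mulr0 oppr0.
rewrite /=; have [tS|tS] := boolP (t \in S); first by case: ifP => _; rewrite ?mulr0 oppr0.
have [t'S|t'S] := boolP (t' \in S); first by rewrite mulr0 oppr0.
rewrite (jw_signU1 t t'S) (jw_signU1 t' tS) (sign_anti tt') finset.setUCA.
by ring.
Qed.

Lemma annihilate_vac t : annihilate t (vac R T) = 0.
Proof.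
apply/ffunP => S; rewrite !ffunE; case: ifP => // _.
by rewrite (negbTE (_ : t |: S != finset.set0)%SET) ?mulr0 //; apply/set0Pn; exists t;
  rewrite !inE eqxx.
Qed.

Lemma create_linear t (c : C) psi phi :
  create t (fscale c psi + phi) = fscale c (create t psi) + create t phi.
Proof. by apply/ffunP => S; rewrite !ffunE; case: ifP => _; ring. Qed.

Lemma annihilate_linear t (c : C) psi phi :
  annihilate t (fscale c psi + phi) = fscale c (annihilate t psi) + annihilate t phi.
Proof. by apply/ffunP => S; rewrite !ffunE; case: ifP => _; ring. Qed.

Lemma fscale0 psi : fscale 0 psi = 0.
Proof. by apply/ffunP => S; rewrite !ffunE mul0r. Qed.

Lemma fscaler0 (c : C) : fscale c (0 : fock) = 0.
Proof. by apply/ffunP => S; rewrite !ffunE mulr0. Qed.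

Lemma fscale1 psi : fscale 1 psi = psi.
Proof. by apply/ffunP => S; rewrite !ffunE mul1r. Qed.

Lemma fscaleA (c d : C) psi : fscale c (fscale d psi) = fscale (c * d) psi.
Proof. by apply/ffunP => S; rewrite !ffunE mulrA. Qed.

Lemma fscaleDr (c : C) psi phi : fscale c (psi + phi) = fscale c psi + fscale c phi.
Proof. by apply/ffunP => S; rewrite !ffunE mulrDr. Qed.

Lemma fscaleDl (c d : C) psi : fscale (c + d) psi = fscale c psi + fscale d psi.
Proof. by apply/ffunP => S; rewrite !ffunE mulrDl. Qed.

Lemma fscaleN1 psi : fscale (-1) psi = - psi.
Proof. by apply/ffunP => S; rewrite !ffunE mulN1r. Qed.

Lemma fscale_sumr (I : Type) (r : seq I) (F : I -> fock) (c : C) :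
  fscale c (\sum_(i <- r) F i) = \sum_(i <- r) fscale c (F i).
Proof. by elim/big_rec2: _ => [|i x y _ <-]; [exact: fscaler0|rewrite fscaleDr]. Qed.

Lemma fscale_suml (I : Type) (r : seq I) (F : I -> C) psi :
  fscale (\sum_(i <- r) F i) psi = \sum_(i <- r) fscale (F i) psi.
Proof. by elim/big_rec2: _ => [|i x y _ <-]; [exact: fscale0|rewrite fscaleDl]. Qed.

Definition flinear (A : fock -> fock) := forall (c : C) psi phi,
  A (fscale c psi + phi) = fscale c (A psi) + A phi.

Lemma flinear0 A : flinear A -> A 0 = 0.
Proof. by move=> h; have := h (-1) 0 0; rewrite fscaler0 addr0 fscaleN1 addNr. Qed.

Lemma flinearD A psi phi : flinear A -> A (psi + phi) = A psi + A phi.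
Proof. by move=> h; have := h 1 psi phi; rewrite !fscale1. Qed.

Lemma flinearZ A (c : C) psi : flinear A -> A (fscale c psi) = fscale c (A psi).
Proof. by move=> h; have := h c psi 0; rewrite (flinear0 h) !addr0. Qed.

Lemma flinear_sum A (I : Type) (r : seq I) (F : I -> fock) : flinear A ->
  A (\sum_(i <- r) F i) = \sum_(i <- r) A (F i).
Proof. by move=> h; elim/big_rec2: _ => [|i x y _ <-]; [exact: flinear0|exact: flinearD]. Qed.

(** Creation and annihilation of an orbital with given amplitudes. [cann] is the adjoint of [cdag],
    whence the conjugate, and [ip] is the value of their anticommutator. *)
Definition cdag x psi : fock := \sum_t fscale (x t) (create t psi).
Definition cann y psi : fock := \sum_t fscale (y t)^*%C (annihilate t psi).
Definition ip y x : C := \sum_t (y t)^*%C * x t.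

Lemma cdag_linear x : flinear (cdag x).
Proof.
move=> c psi phi; rewrite /cdag fscale_sumr -big_split; apply: eq_bigr => t _.
by rewrite create_linear fscaleDr !fscaleA mulrC.
Qed.

Lemma cann_linear x : flinear (cann x).
Proof.
move=> c psi phi; rewrite /cann fscale_sumr -big_split; apply: eq_bigr => t _.
by rewrite annihilate_linear fscaleDr !fscaleA mulrC.
Qed.

Lemma cann_cdag y x psi : cann y (cdag x psi) = fscale (ip y x) psi - cdag x (cann y psi).
Proof.
apply/eqP; rewrite eq_sym subr_eq; apply/eqP.
have aL t : flinear (annihilate t) by exact: annihilate_linear.
have cL t : flinear (create t) by exact: create_linear.
rewrite /cann /cdag fscale_suml.
transitivity (\sum_t \sum_t' (fscale ((y t)^*%C * x t') (create t' (annihilate t psi)) +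
    fscale ((y t)^*%C * x t') (annihilate t (create t' psi)))).
  apply: eq_bigr => t _; transitivity (\sum_t' fscale ((y t)^*%C * x t') (fscale (t' == t)%:R psi)).
    rewrite (bigD1 t) //= big1 ?addr0 => [|t' /negbTE ->]; last by rewrite fscale0 fscaler0.
    by rewrite eqxx fscale1.
  by apply: eq_bigr => t' _; rewrite -create_annihilate fscaleDr.
under eq_bigr do rewrite big_split; rewrite big_split /= [LHS]addrC; congr (_ + _).
  apply: eq_bigr => t _; rewrite (flinear_sum _ _ (aL t)) fscale_sumr; apply: eq_bigr => t' _.
  by rewrite (flinearZ _ _ (aL t)) fscaleA.
rewrite exchange_big; apply: eq_bigr => t' _; rewrite (flinear_sum _ _ (cL t')) fscale_sumr.
by apply: eq_bigr => t _; rewrite (flinearZ _ _ (cL t')) fscaleA mulrC.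
Qed.

Lemma cdag_cdag x y psi : cdag x (cdag y psi) = - cdag y (cdag x psi).
Proof.
have cL t : flinear (create t) by exact: create_linear.
have e z w : cdag z (cdag w psi) = \sum_t \sum_t' fscale (z t * w t') (create t (create t' psi)).
  apply: eq_bigr => t _; rewrite (flinear_sum _ _ (cL t)) fscale_sumr.
  by apply: eq_bigr => t' _; rewrite (flinearZ _ _ (cL t)) fscaleA.
rewrite !e exchange_big -sumrN; apply: eq_bigr => t _; rewrite -sumrN; apply: eq_bigr => t' _.
by rewrite create_create -!fscaleN1 !fscaleA mulrN1 mulN1r mulrC.
Qed.

Lemma cdag_sqr x psi : cdag x (cdag x psi) = 0.
Proof.
apply/ffunP => S; have /ffunP/(_ S) := cdag_cdag x x psi; rewrite !ffunE => /eqP.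
by rewrite -addr_eq0 -mulr2n mulrn_eq0 /= => /eqP.
Qed.

Lemma cann_vac y : cann y (vac R T) = 0.
Proof. by rewrite /cann big1 // => t _; rewrite annihilate_vac fscaler0. Qed.

Lemma fdotDr psi phi chi : fdot psi (phi + chi) = fdot psi phi + fdot psi chi.
Proof. by rewrite /fdot -big_split; apply: eq_bigr => S _; rewrite ffunE mulrDr. Qed.

Lemma fdotZr (c : C) psi phi : fdot psi (fscale c phi) = c * fdot psi phi.
Proof. by rewrite /fdot big_distrr; apply: eq_bigr => S _; rewrite ffunE mulrCA. Qed.

Lemma fdot_conj psi phi : (fdot psi phi)^*%C = fdot phi psi.
Proof.
by rewrite /fdot conj_sum; apply: eq_bigr => S _; rewrite conjM conjcK mulrC.
Qed.

Lemma fdotZl (c : C) psi phi : fdot (fscale c psi) phi = c^*%C * fdot psi phi.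
Proof. by rewrite -fdot_conj fdotZr conjM fdot_conj. Qed.

Lemma fdotDl psi phi chi : fdot (psi + phi) chi = fdot psi chi + fdot phi chi.
Proof. by rewrite -fdot_conj fdotDr conjD !fdot_conj. Qed.

Lemma fdot0r psi : fdot psi 0 = 0.
Proof. by rewrite /fdot big1 // => S _; rewrite ffunE mulr0. Qed.

Lemma fdot_sumr psi (I : Type) (r : seq I) (F : I -> fock) :
  fdot psi (\sum_(i <- r) F i) = \sum_(i <- r) fdot psi (F i).
Proof. by elim/big_rec2: _ => [|i x y _ <-]; [exact: fdot0r|rewrite fdotDr]. Qed.

Lemma fdot_suml psi (I : Type) (r : seq I) (F : I -> fock) :
  fdot (\sum_(i <- r) F i) psi = \sum_(i <- r) fdot (F i) psi.
Proof.
by rewrite -fdot_conj fdot_sumr conj_sum; apply: eq_bigr => a _; exact: fdot_conj.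
Qed.

Lemma fdot_create t psi phi : fdot (create t psi) phi = fdot psi (annihilate t phi).
Proof.
rewrite /fdot (bigID (fun S : {set T} => t \in S)) /= [X in _ + X]big1 ?addr0; last first.
  by move=> S /negbTE tS; rewrite ffunE tS conjc0 mul0r.
rewrite [RHS](bigID (fun S : {set T} => t \in S)) /= [X in _ = X + _]big1 ?add0r; last first.
  by move=> S tS; rewrite ffunE tS mulr0.
rewrite (reindex_onto (fun S => t |: S)%SET (fun S => S :\ t)%SET) /=; last first.
  by move=> S tS; rewrite finset.setD1K.
apply: eq_big => [S|S tS].
  rewrite !inE eqxx /=; apply/eqP/idP => [<-|tS]; first by rewrite !inE eqxx.
  by rewrite finset.setU1K.
have {}tS : t \notin S.
  by move: tS => /andP[_ /eqP <-]; rewrite !inE eqxx.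
rewrite !ffunE !inE eqxx (negbTE tS) /= finset.setU1K // conjM jw_sign_conj (jw_signU1 t tS).
by rewrite ltnn expr0 mul1r mulrCA mulrA.
Qed.

Lemma fdot_annihilate t psi phi : fdot (annihilate t psi) phi = fdot psi (create t phi).
Proof. by rewrite -fdot_conj -fdot_create fdot_conj. Qed.

Lemma fdot_cdag x psi phi : fdot (cdag x psi) phi = fdot psi (cann x phi).
Proof.
by rewrite /cdag /cann fdot_suml fdot_sumr; apply: eq_bigr => t _;
  rewrite fdotZl fdotZr fdot_create.
Qed.

Lemma fdot_vac : fdot (vac R T) (vac R T) = 1.
Proof.
rewrite /fdot (bigD1 finset.set0) //= big1 ?addr0 => [|S S0]; rewrite ffunE.
  by rewrite eqxx conjc1 mul1r.
by rewrite (negbTE S0) conjc0 mul0r.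
Qed.

Lemma fdot_norm psi : fdot psi psi = (\sum_S ComplexField.Normc.normc (psi S) ^+ 2)%:C%C.
Proof. by rewrite rmorph_sum; apply: eq_bigr => S _; rewrite normc_sqr_conj. Qed.

Section Determinant.
Variables (I : eqType) (X : I -> T -> C).
Hypothesis oX : forall a b, ip (X a) (X b) = (a == b)%:R.

Definition determinant_state (r : seq I) : fock :=
  foldr (fun a psi => cdag (X a) psi) (vac R T) r.

Lemma cann_determinant y r : (forall a, a \in r -> ip y (X a) = 0) ->
  cann y (determinant_state r) = 0.
Proof.
elim: r => [|a r IHr] h; first exact: cann_vac.
rewrite /= cann_cdag h ?mem_head // fscale0 sub0r IHr ?(flinear0 (cdag_linear _)) ?oppr0 //.
by move=> b br; apply: h; rewrite inE br orbT.
Qed.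

Lemma cdag_determinant a r : a \in r -> cdag (X a) (determinant_state r) = 0.
Proof.
elim: r => // b r IHr; rewrite inE => /orP[/eqP <-|/IHr h] /=; first exact: cdag_sqr.
by rewrite cdag_cdag h (flinear0 (cdag_linear _)) oppr0.
Qed.

Lemma determinant_norm r : uniq r -> fdot (determinant_state r) (determinant_state r) = 1.
Proof.
elim: r => [|a r IHr] /=; first by rewrite fdot_vac.
move=> /andP[ar /IHr h]; rewrite fdot_cdag cann_cdag oX eqxx fscale1.
rewrite cann_determinant => [|b br]; last by rewrite oX; case: eqP ar => // ->; rewrite br.
by rewrite (flinear0 (cdag_linear _)) subr0.
Qed.
End Determinant.

(** The second quantization of the matrix [A]. *)
Definition one_body (A : T -> T -> C) psi : fock :=
  \sum_t \sum_t' fscale (A t t') (create t (annihilate t' psi)).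

Lemma fdot_one_body (A : T -> T -> C) psi phi :
  fdot psi (one_body A phi) = fdot (one_body (fun t t' => (A t' t)^*%C) psi) phi.
Proof.
transitivity (\sum_t \sum_t' A t t' * fdot psi (create t (annihilate t' phi))).
  rewrite /one_body fdot_sumr; apply: eq_bigr => t _; rewrite fdot_sumr.
  by apply: eq_bigr => t' _; rewrite fdotZr.
rewrite exchange_big /one_body fdot_suml; apply: eq_bigr => t' _; rewrite fdot_suml.
by apply: eq_bigr => t _; rewrite fdotZl conjcK -fdot_annihilate -fdot_create.
Qed.

Definition mode_vector t : T -> C := fun t' => (t' == t)%:R.

Lemma cdag_mode t psi : cdag (mode_vector t) psi = create t psi.
Proof.
rewrite /cdag (bigD1 t) //= big1 ?addr0 /mode_vector => [|t' /negbTE ->]; last by rewrite fscale0.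
by rewrite eqxx fscale1.
Qed.

Lemma cann_mode t psi : cann (mode_vector t) psi = annihilate t psi.
Proof.
rewrite /cann (bigD1 t) //= big1 ?addr0 /mode_vector => [|t' /negbTE ->];
  last by rewrite conjc0 fscale0.
by rewrite eqxx conjc1 fscale1.
Qed.

Lemma ip_mode y t : ip y (mode_vector t) = (y t)^*%C.
Proof.
rewrite /ip (bigD1 t) //= big1 ?addr0 /mode_vector => [|t' /negbTE ->]; last by rewrite mulr0.
by rewrite eqxx mulr1.
Qed.

(** The commutator [c(y), O_A] is c(A^dag y): passing the creator leaves a contraction, and in the
    other term the two anticommutation signs cancel. *)
Lemma cann_one_body y (A : T -> T -> C) psi :
  cann y (one_body A psi) =
  cann (fun t' => \sum_t (A t t')^*%C * y t) psi + one_body A (cann y psi).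
Proof.
have aL t : flinear (annihilate t) by exact: annihilate_linear.
have cL t : flinear (create t) by exact: create_linear.
have cyc t phi : cann y (create t phi) = fscale (y t)^*%C phi - create t (cann y phi).
  by rewrite -!cdag_mode cann_cdag ip_mode.
have cya t phi : cann y (annihilate t phi) = - annihilate t (cann y phi).
  rewrite /cann (flinear_sum _ _ (aL t)) -sumrN; apply: eq_bigr => t' _.
  by rewrite annihilate_annihilate (flinearZ _ _ (aL t)) -!fscaleN1 !fscaleA mulrC.
have cNy t phi : create t (- phi) = - create t phi.
  by rewrite -fscaleN1 (flinearZ _ _ (cL t)) fscaleN1.
transitivity (\sum_t \sum_t' (fscale (A t t' * (y t)^*%C) (annihilate t' psi) +
    fscale (A t t') (create t (annihilate t' (cann y psi))))).
  rewrite /one_body (flinear_sum _ _ (cann_linear y)); apply: eq_bigr => t _.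
  rewrite (flinear_sum _ _ (cann_linear y)); apply: eq_bigr => t' _.
  rewrite (flinearZ _ _ (cann_linear y)) cyc cya cNy opprK fscaleDr fscaleA.
  by [].
under eq_bigr do rewrite big_split; rewrite big_split /=; congr (_ + _).
rewrite exchange_big; apply: eq_bigr => t' _; rewrite conj_sum fscale_suml.
by apply: eq_bigr => t _; rewrite conjM conjcK.
Qed.

Lemma one_body_linear (A : T -> T -> C) : flinear (one_body A).
Proof.
move=> c psi phi; rewrite /one_body fscale_sumr -big_split; apply: eq_bigr => t _.
rewrite fscale_sumr -big_split; apply: eq_bigr => t' _.
by rewrite annihilate_linear create_linear fscaleDr !fscaleA mulrC.
Qed.

(* If (O_A - kappa) psi = 0 then, for y orthogonal to the orbitals, also
   c(A^dag y) psi = [c(y), O_A] psi = 0, so A^dag y is orthogonal to the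
   orbitals. *)
Lemma one_body_kernel (I : eqType) (X : I -> T -> C) (r : seq I) (A : T -> T -> C) (kappa : C) y a :
  (forall b c, ip (X b) (X c) = (b == c)%:R) -> uniq r ->
  one_body A (determinant_state X r) = fscale kappa (determinant_state X r) ->
  (forall b, b \in r -> ip y (X b) = 0) -> a \in r ->
  \sum_t \sum_t' (y t)^*%C * A t t' * X a t' = 0.
Proof.
set psi := determinant_state X r => oX ur e yX ar.
have y0 : cann y psi = 0 by exact: cann_determinant.
pose z t' := \sum_t (A t t')^*%C * y t.
have z0 : cann z psi = 0.
  have := cann_one_body y A psi; rewrite e (flinearZ _ _ (cann_linear y)) y0 fscaler0.
  by rewrite (flinear0 (one_body_linear A)) addr0 => <-.
(* The orbital [X a] is already occupied, so creating it again gives 0; annihilating [z] afterwards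
   leaves only the contraction <z, X a> psi. *)
have := cann_cdag z (X a) psi; rewrite (cdag_determinant X ar) z0.
rewrite (flinear0 (cann_linear z)) (flinear0 (cdag_linear _)) subr0 => /esym e2.
have : ip z (X a) * fdot psi psi = 0 by rewrite -fdotZr e2 fdot0r.
rewrite (determinant_norm oX ur) mulr1; apply: etrans; rewrite /ip exchange_big;
  apply: eq_bigr => t' _.
rewrite conj_sum big_distrl; apply: eq_bigr => t _.
by rewrite /= conjM conjcK; congr (_ * _); rewrite mulrC.
Qed.

(** The span condition makes creation of any mode of [S0] vanish, and the support condition does the
    same for annihilation of any other mode. Only the amplitude of [S0] survives, and normalization
    makes it a phase. *)
Lemma determinant_sector (I : eqType) (X : I -> T -> C) (r : seq I) (S0 : {set T}) :
  (forall b c, ip (X b) (X c) = (b == c)%:R) -> uniq r ->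
  (forall t, t \in S0 -> exists c : I -> C, mode_vector t = fun t' => \sum_(a <- r) c a * X a t') ->
  (forall t a, t \notin S0 -> a \in r -> X a t = 0) ->
  exists2 c : C, normc c = 1 & determinant_state X r = [ffun S => c * (S == S0)%:R].
Proof.
set psi := determinant_state X r => oX ur span zero.
have cr t : t \in S0 -> create t psi = 0.
  move=> /span[c e]; rewrite -cdag_mode e /cdag.
  transitivity (\sum_(a <- r) fscale (c a) (cdag (X a) psi)).
    under eq_bigr do rewrite fscale_suml; rewrite exchange_big; apply: eq_bigr => a _.
    by rewrite /cdag fscale_sumr; apply: eq_bigr => t' _; rewrite fscaleA.
  by rewrite big_seq big1 // => a ar; rewrite (cdag_determinant X ar) fscaler0.
have an t : t \notin S0 -> annihilate t psi = 0.
  move=> tS; rewrite -cann_mode; apply: cann_determinant => a ar.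
  rewrite /ip (bigD1 t) //= big1 ?addr0 /mode_vector => [|t' /negbTE ->];
    last by rewrite conjc0 mul0r.
  by rewrite (zero t) // mulr0.
have jw0 t S : jw_sign R t S != 0.
  by apply/eqP => e; have := jw_sign_sqr t S; rewrite e mul0r => /esym/eqP; rewrite oner_eq0.
have psi0 S : S != S0 -> psi S = 0.
  move=> SS0; have [/fintype.subsetP sub|/fintype.subsetPn[t tS0 tS]] := boolP (S0 \subset S)%SET.
    have [t tS tS0] : exists2 t, t \in S & t \notin S0.
      apply/fintype.subsetPn; apply: contra SS0 => sub'.
      by rewrite finset.eqEsubset sub'; apply/fintype.subsetP.
    have /ffunP/(_ (S :\ t)%SET) := an t tS0; rewrite !ffunE !inE eqxx /= finset.setD1K // => /eqP.
    by rewrite mulf_eq0 (negbTE (jw0 _ _)) => /eqP.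
  have /ffunP/(_ (t |: S)%SET) := cr t tS0; rewrite !ffunE !inE eqxx /= finset.setU1K // => /eqP.
  by rewrite mulf_eq0 (negbTE (jw0 _ _)) => /eqP.
exists (psi S0).
  have := determinant_norm oX ur; rewrite -/psi fdot_norm (bigD1 S0) //= big1 ?addr0.
    move=> /(congr1 (@complex.Re R)) /= /eqP; rewrite sqrf_eq1 => /orP[/eqP //|/eqP e].
    by have := normc_ge0 (psi S0); rewrite e; lra.
  by move=> S /psi0 ->; rewrite ComplexField.Normc.normc0 expr0n.
apply/ffunP => S; rewrite ffunE; have [->|/psi0 ->] := eqVneq S S0; by rewrite ?mulr1 ?mulr0.
Qed.

Lemma determinant_scale (I : eqType) (X : I -> T -> C) (z : C) (r : seq I) :
  determinant_state (fun a t => z * X a t) r = fscale (z ^+ size r) (determinant_state X r).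
Proof.
elim: r => [|a r IHr] /=; first by rewrite expr0 fscale1.
rewrite IHr (flinearZ _ _ (cdag_linear _)) exprSr -fscaleA; congr fscale.
by rewrite /cdag fscale_sumr; apply: eq_bigr => t _; rewrite fscaleA.
Qed.
End FermionicFock.

(** * Commutants of the form factors *)

Section Schur.
Import spectral.
Local Open Scope sesquilinear_scope.
Variable C : numClosedFieldType.
Local Notation conjC := (@Num.conj C).

Lemma dagM (m n p : nat) (A : 'M[C]_(m, n)) (B : 'M[C]_(n, p)) : (A *m B)^t* = B^t* *m A^t*.
Proof. by rewrite trmx_mul map_mxM. Qed.

Definition has_no_invariant_projector n (I : Type) (A : I -> 'M[C]_n) :=
  forall P : 'M[C]_n, P *m P = P -> P^t* = P -> P != 0 -> P != 1%:M ->
  exists i, (1%:M - P) *m A i *m P != 0.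

(** The hypothesis excludes invariant orthogonal projectors, so [T] is taken Hermitian: its spectral
    projectors are orthogonal and commute with every [A i], and a nonzero one must be the
    identity. *)
Lemma schur_hermitian n (I : Type) (A : I -> 'M[C]_n) (T : 'M[C]_n) :
  has_no_invariant_projector A -> T^t* = T ->
  (forall i, T *m A i = A i *m T) -> exists c, T = c%:M.
Proof.
case: n A T => [|n] A T irr hT cT; first by exists 0; rewrite [T]flatmx0 [RHS]flatmx0.
have nT : T \is normalmx by apply/normalmxP; rewrite hT.
pose U := spectralmx T; have UU : U \is unitarymx := spectral_unitarymx T.
have UUt : U *m U^t* = 1%:M := unitarymxP UU.
have UtU : U^t* *m U = 1%:M := mulmx1C UUt.
pose d := spectral_diag T.
have eT : T = U^t* *m diag_mx d *m U.
  by rewrite {1}(orthomx_spectralP nT) (invmx_unitary UU).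
(* [e] selects the eigenspace of an eigenvalue that occurs, so the spectral projector [P] built on
   it is not zero. *)
pose l := d 0 0; pose e : 'rV[C]_n.+1 := \row_j (d 0 j == l)%:R.
have eE j : e 0 j = (d 0 j == l)%:R by rewrite mxE.
pose P := U^t* *m diag_mx e *m U.
have conjP X : U *m (U^t* *m X *m U) *m U^t* = X.
  by rewrite !mulmxA UUt mul1mx -mulmxA UUt mulmx1.
have mulP X Y : (U^t* *m X *m U) *m (U^t* *m Y *m U) = U^t* *m (X *m Y) *m U.
  by rewrite !mulmxA -[_ *m U *m U^t*]mulmxA UUt mulmx1.
have PP : P *m P = P.
  rewrite mulP mulmx_diag; congr (_ *m diag_mx _ *m _); apply/rowP => j; rewrite !mxE.
  by case: eqP; rewrite ?mulr1 ?mulr0.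
have hP : P^t* = P.
  rewrite /P !dagM trmxCK mulmxA; congr (_ *m _ *m _); apply/matrixP => a b; rewrite !mxE.
  have [->|_] := eqVneq a b; last by rewrite !mulr0n rmorph0.
  by rewrite !mulr1n; case: eqP => _; rewrite (rmorph1, rmorph0).
have cP i : P *m A i = A i *m P.
  pose B := U *m A i *m U^t*.
  have eA : A i = U^t* *m B *m U.
    by rewrite /B !mulmxA UtU mul1mx -mulmxA UtU mulmx1.
  have cB : diag_mx d *m B = B *m diag_mx d.
    have := cT i; rewrite eT eA !mulP => /(congr1 (fun X => U *m X *m U^t*)).
    by rewrite !conjP.
  rewrite {1}/P /P eA !mulP; congr (_ *m _ *m _); apply/matrixP => a b.
  have h : d 0 a * B a b = B a b * d 0 b.
    by have /matrixP/(_ a b) := cB; rewrite mul_diag_mx mul_mx_diag [LHS]mxE [RHS]mxE.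
  rewrite mul_diag_mx mul_mx_diag [LHS]mxE [RHS]mxE !eE.
  have [dab|dab] := eqVneq (d 0 a) (d 0 b); first by rewrite dab mulrC.
  have -> : B a b = 0.
    apply/eqP; have /eqP : (d 0 a - d 0 b) * B a b = 0 by rewrite mulrBl h mulrC subrr.
    by rewrite mulf_eq0 subr_eq0 (negbTE dab).
  by rewrite mulr0 mul0r.
have P0 : P != 0.
  apply/eqP => /(congr1 (fun X => U *m X *m U^t*)); rewrite conjP mulmx0 mul0mx => /matrixP/(_ 0 0).
  by rewrite !mxE !eqxx mulr1n => /eqP; rewrite oner_eq0.
have P1 : P = 1%:M.
  apply/eqP; apply: contraT => P1; have [a] := irr P PP hP P0 P1.
  by rewrite mulmxBl mul1mx mulmxBl cP -mulmxA PP subrr eqxx.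
exists l; have e1 : diag_mx e = 1%:M.
  by rewrite -(conjP (diag_mx e)) -/P P1 mulmx1 UUt.
have dl j : d 0 j = l.
  have /matrixP/(_ j j) := e1; rewrite !mxE !eqxx mulr1n; case: eqP => // _ /eqP.
  by rewrite eq_sym oner_eq0.
rewrite eT; have -> : diag_mx d = l%:M by apply/matrixP => a b; rewrite !mxE dl.
by rewrite mul_mx_scalar -scalemxAl UtU scalemx1.
Qed.

Lemma mul_dag_eq0 m n (X : 'M[C]_(m, n)) : X *m X^t* = 0 -> X = 0.
Proof.
move=> h; apply/matrixP => a b; have /matrixP/(_ a a) := h; rewrite !mxE => /eqP.
rewrite psumr_eq0 => [/allP/(_ b (mem_index_enum _)) /=|j _].
  by rewrite !mxE -normCK sqrf_eq0 normr_eq0 => /eqP.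
by rewrite !mxE -normCK exprn_ge0.
Qed.

Lemma unit_of_scalar n (X : 'M[C]_n) c : X *m X^t* = c%:M -> X != 0 -> X \in unitmx.
Proof.
move=> h X0; have c0 : c != 0.
  by apply: contra X0 => /eqP c0; apply/eqP/mul_dag_eq0; rewrite h c0 raddf0.
have : X *m (c^-1 *: X^t*) = 1%:M by rewrite -scalemxAr h scale_scalar_mx mulVf.
by case/mulmx1_unit.
Qed.

(* [X; Y] spans the occupied orbitals in the two sectors. Invariance of its range
   under diag(A, conj A) makes X Y^* intertwine A with conj A. *)
Lemma sector_dichotomy n (I : Type) (neg : I -> I) (A : I -> 'M[C]_n) (X Y : 'M[C]_n) :
  (forall i, A (neg i) = (A i)^t*) ->
  X^t* *m X + Y^t* *m Y = 1%:M ->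
  (forall i (V W : 'M[C]_n), V *m X + W *m Y = 0 ->
     V *m A i *m X + W *m map_mx conjC (A i) *m Y = 0) ->
  (exists i, (\tr (A i))^* != \tr (A i)) ->
  has_no_invariant_projector A -> X = 0 \/ Y = 0.
Proof.
move=> Aneg XY ker [i0 tr0] irr.
(* The columns of [X; Y] are orthonormal, and [Z i] is the compression of diag(A i, B i) to their
   span. *)
pose B i := map_mx conjC (A i); pose Z i := X^t* *m A i *m X + Y^t* *m B i *m Y.
have Bneg i : B (neg i) = (B i)^t*.
  by rewrite /B Aneg; apply/matrixP => a b; rewrite !mxE.
have AX i : A i *m X = X *m Z i.
  (* The first block row of the projector onto the unoccupied space; the second block row serves for
     [BY]. *)
  have := ker i (1%:M - X *m X^t*) (- (X *m Y^t*)).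
  rewrite !mulmxBl !mul1mx !mulNmx => /(_ _);
    rewrite -!mulmxA -addrA -opprD -mulmxDr XY mulmx1 subrr.
  move=> /(_ erefl) /eqP; rewrite -addrA -opprD -mulmxDr subr_eq0 => /eqP ->.
  by rewrite /Z !mulmxA.
have BY i : B i *m Y = Y *m Z i.
  have := ker i (- (Y *m X^t*)) (1%:M - Y *m Y^t*).
  rewrite !mulmxBl !mul1mx !mulNmx => /(_ _);
    rewrite -!mulmxA addrCA -opprD -mulmxDr XY mulmx1 subrr.
  move=> /(_ erefl) /eqP; rewrite addrCA -opprD -mulmxDr subr_eq0 => /eqP ->.
  by rewrite /Z !mulmxA.
have Zneg i : Z (neg i) = (Z i)^t*.
  rewrite /Z Aneg Bneg raddfD /= map_mxD !dagM !trmxCK !mulmxA; congr (_ + _).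
have XA i : X^t* *m A i = Z i *m X^t*.
  by rewrite -[LHS]trmxCK dagM trmxCK -Aneg AX dagM Zneg trmxCK.
have YB i : Y^t* *m B i = Z i *m Y^t*.
  by rewrite -[LHS]trmxCK dagM trmxCK -Bneg BY dagM Zneg trmxCK.
have [X0|X0] := eqVneq X 0; first by left.
have [Y0|Y0] := eqVneq Y 0; first by right.
have [c hc] : exists c, X *m X^t* = c%:M.
  apply: (schur_hermitian irr) => [|i]; first by rewrite dagM trmxCK.
  by rewrite -mulmxA XA !mulmxA -AX.
(* The block of [Y] commutes with the conjugates of the [A i]; conjugating it entrywise makes it
   commute with the [A i] themselves. *)
have [c' hc'] : exists c, map_mx conjC (Y *m Y^t*) = c%:M.
  apply: (schur_hermitian irr) => [|i].
    have h : (Y *m Y^t*)^t* = Y *m Y^t* by rewrite dagM trmxCK.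
    by rewrite -{2}h; apply/matrixP => a b; rewrite !mxE.
  have h : Y *m Y^t* *m B i = B i *m (Y *m Y^t*) by rewrite -mulmxA YB !mulmxA -BY.
  have AB : A i = map_mx conjC (B i) by apply/matrixP => a b; rewrite !mxE conjCK.
  by rewrite AB -!map_mxM h.
have Xu := unit_of_scalar hc X0.
have Yu : Y \in unitmx.
  apply: (@unit_of_scalar _ Y c'^*) => //; apply/matrixP => a b.
  have /matrixP/(_ a b) := hc'; rewrite mxE => /(congr1 conjC); rewrite conjCK => ->.
  by rewrite !mxE; case: eqP => _; rewrite ?mulr1n ?mulr0n ?rmorph0.
exfalso; move/negP: tr0; apply.
have Tu : X *m Y^t* \in unitmx.
  rewrite unitmx_mul Xu /=; have := Yu; rewrite !unitmxE det_map_mx det_tr.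
  by rewrite !unitfE fmorph_eq0.
have inter : A i0 *m (X *m Y^t*) = X *m Y^t* *m B i0 by rewrite mulmxA AX -!mulmxA YB.
have <- : \tr (B i0) = (\tr (A i0))^*.
  by rewrite rmorph_sum; apply: eq_bigr => a _; rewrite mxE.
apply/eqP; rewrite -[A i0](mulmxK Tu) inter mxtrace_mulC mulmxA.
by rewrite mulVmx // mul1mx.
Qed.
End Schur.

(** * The energy of a Slater state *)

Section SquareSums.
Variable R : realType.
Local Notation C := R[i].
Implicit Types (F G : int -> int -> C) (f : int -> int -> R).

Definition rsum f (n : nat) : R := \sum_(a <- zrange n) \sum_(b <- zrange n) f a b.

(** [csum] has a value even for a divergent family. This predicate records convergence over squares,
    and [csumE] recovers the value. *)
Definition csum_to F (z : C) := forall e : R, 0 < e ->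
  exists n0, forall n, (n0 <= n)%N -> normc (z - sqsum F n) <= e.

Lemma sqsumE F n : sqsum F n = \sum_(a <- zrange n) \sum_(b <- zrange n) F a b.
Proof. by rewrite big_zrange; apply: eq_bigr => a _; rewrite big_zrange. Qed.

Lemma zrange_sub (m n : nat) : (m <= n)%N -> {subset zrange m <= zrange n}.
Proof. by move=> mn a; rewrite !mem_zrange => /leq_trans; apply. Qed.

Lemma ler_sum_uniq (I : eqType) (l l' : seq I) (g : I -> R) : uniq l -> uniq l' ->
  {subset l <= l'} -> (forall a, 0 <= g a) -> \sum_(a <- l) g a <= \sum_(a <- l') g a.
Proof.
move=> ul ul' ll' g0; rewrite [leRHS](bigID (fun a => a \in l)) /=.
have -> : \sum_(a <- l) g a = \sum_(a <- l' | a \in l) g a.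
  rewrite -[RHS]big_filter (perm_big [seq a <- l' | a \in l]) //.
  apply: uniq_perm => //; first exact: filter_uniq.
  by move=> a; rewrite mem_filter; case: (boolP (a \in l)) => // /ll' ->.
by rewrite lerDl sumr_ge0.
Qed.

Lemma rsum_nondecreasing f : (forall a b, 0 <= f a b) -> nondecreasing_seq (rsum f).
Proof.
move=> f0 m n mn; rewrite /rsum.
apply: le_trans (_ : _ <= \sum_(a <- zrange m) \sum_(b <- zrange n) f a b) _.
  by apply: ler_sum => a _; apply: ler_sum_uniq; rewrite ?uniq_zrange //; exact: zrange_sub.
apply: ler_sum_uniq; rewrite ?uniq_zrange //; first exact: zrange_sub.
by move=> a; apply: sumr_ge0.
Qed.

Lemma rsum_esum f : (forall a b, 0 <= f a b) ->
  (\esum_(q in [set: int * int]) (f q.1 q.2)%:E < +oo)%E ->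
  exists B : R, forall n, rsum f n <= B.
Proof.
move=> f0 h; exists (fine (\esum_(q in [set: int * int]) (f q.1 q.2)%:E)) => n.
have e0 : (0 <= \esum_(q in [set: int * int]) (f q.1 q.2)%:E)%E.
  by apply: esum_ge0 => q _; rewrite lee_fin.
rewrite -lee_fin fineK ?ge0_fin_numE //.
pose l := [seq (a, b) | a <- zrange n, b <- zrange n].
have ul : uniq l by rewrite allpairs_uniq ?uniq_zrange // => -[? ?] [? ?] _ _ [-> ->].
apply: esum_ge; exists [set` l]; first by split => //; exact: finite_seq.
rewrite -(fsbig_seq _ _ ul) /= sumEFin lee_fin /l big_allpairs.
exact: lexx.
Qed.

(** The family is the difference of the nonnegative families g + f and g, whose square sums are
    monotone and bounded. *)
Lemma bounded_rsum_cvg f (g : int -> int -> R) (B : R) : (forall a b, `|f a b| <= g a b) ->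
  (forall n, rsum g n <= B) -> cvgn (rsum f).
Proof.
move=> fg gB; have g0 a b : 0 <= g a b := le_trans (normr_ge0 _) (fg a b).
have c1 : cvgn (rsum g).
  apply: nondecreasing_is_cvgn; first exact: rsum_nondecreasing.
  by exists B => _ [n _ <-]; exact: gB.
have h0 a b : 0 <= g a b + f a b by have := fg a b; rewrite ler_norml; lra.
have hD n : rsum (fun a b => g a b + f a b) n = rsum g n + rsum f n.
  by rewrite /rsum -big_split; apply: eq_bigr => a _; rewrite -big_split.
have fle n : rsum f n <= rsum g n.
  by apply: ler_sum => a _; apply: ler_sum => b _; apply: le_trans (ler_norm _) (fg a b).
have c2 : cvgn (rsum (fun a b => g a b + f a b)).
  apply: nondecreasing_is_cvgn; first exact: rsum_nondecreasing.
  by exists (B + B) => _ [n _ <-]; rewrite hD lerD // (le_trans (fle n)).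
have -> : rsum f = (fun n => rsum (fun a b => g a b + f a b) n - rsum g n).
  by apply/funext => n; rewrite hD addrC addKr.
exact: is_cvgB.
Qed.

Lemma Re_sum (I : Type) (l : seq I) (F : I -> C) :
  complex.Re (\sum_(a <- l) F a) = \sum_(a <- l) complex.Re (F a).
Proof. by elim/big_rec2: _ => // a x y _ <-; rewrite ReD. Qed.

Lemma Im_sum (I : Type) (l : seq I) (F : I -> C) :
  complex.Im (\sum_(a <- l) F a) = \sum_(a <- l) complex.Im (F a).
Proof. by elim/big_rec2: _ => // a x y _ <-; rewrite ImD. Qed.

Lemma normc_le_ReIm (z : C) : normc z <= `|complex.Re z| + `|complex.Im z|.
Proof.
have h : 0 <= `|complex.Re z| + `|complex.Im z| by rewrite addr_ge0.
rewrite -(@ler_pXn2r _ 2) ?nnegrE ?normc_ge0 // normc2 sqrrD !sqr_norm_real.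
by rewrite -addrA [_ *+ 2 + _]addrC addrA lerDl mulrn_wge0 // mulr_ge0.
Qed.

Lemma summable_csum_to F :
  (\esum_(q in [set: int * int]) (normc (F q.1 q.2))%:E < +oo)%E -> exists z, csum_to F z.
Proof.
move=> h; have [B hB] := rsum_esum (fun a b => normc_ge0 (F a b)) h.
have cR := bounded_rsum_cvg (fun a b => Re_le_normc (F a b)) hB.
have cI := bounded_rsum_cvg (fun a b => Im_le_normc (F a b)) hB.
exists (limn (rsum (fun a b => complex.Re (F a b))) +i* limn (rsum (fun a b =>
  complex.Im (F a b))))%C.
move=> e e0; have e20 : 0 < e / 2 by rewrite divr_gt0.
have /cvgrPdist_le/(_ _ e20)[n1 _ h1] := cR.
have /cvgrPdist_le/(_ _ e20)[n2 _ h2] := cI.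
exists (maxn n1 n2) => n; rewrite geq_max => /andP[/h1 /= {}h1 /h2 /= {}h2].
apply: le_trans (normc_le_ReIm _) _; rewrite !CE sqsumE Re_sum Im_sum /=.
rewrite [e]splitr; apply: lerD.
  by under eq_bigr do rewrite Re_sum; exact: h1.
by under eq_bigr do rewrite Im_sum; exact: h2.
Qed.

Lemma sqsum_linear (c : C) F G n :
  sqsum (fun a b => c * F a b + G a b) n = c * sqsum F n + sqsum G n.
Proof.
rewrite !sqsumE big_distrr -big_split; apply: eq_bigr => a _.
by rewrite /= big_distrr -big_split.
Qed.

Lemma csum_to_linear (c : C) F G z w : csum_to F z -> csum_to G w ->
  csum_to (fun a b => c * F a b + G a b) (c * z + w).
Proof.
move=> hF hG e e0; have d0 : 0 < 2 * (normc c + 1) by rewrite mulr_gt0 // ltr_wpDl ?normc_ge0.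
have e20 : 0 < e / 2 by rewrite divr_gt0.
have [n1 h1] := hF _ (divr_gt0 e0 d0); have [n2 h2] := hG _ e20.
exists (maxn n1 n2) => n; rewrite geq_max => /andP[/h1 {}h1 /h2 {}h2].
rewrite sqsum_linear.
have -> : c * z + w - (c * sqsum F n + sqsum G n) = c * (z - sqsum F n) + (w - sqsum G n) by ring.
apply: le_trans (le_normcD _ _) _; rewrite ComplexField.Normc.normcM.
have := ler_wpM2l (normc_ge0 c) h1; have := normc_ge0 c.
have -> : normc c * (e / (2 * (normc c + 1))) = e / 2 * (normc c / (normc c + 1)).
  by field; rewrite gt_eqF // ltr_wpDl ?normc_ge0.
move=> c0 h; rewrite [e]splitr; apply: lerD => //; apply: le_trans h _.
by rewrite ler_piMr ?(ltW e20) // ler_pdivrMr ?ltr_wpDl // mul1r lerDl.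
Qed.

Lemma csum_to_sum (I : Type) (l : seq I) (c : I -> C) (F : I -> int -> int -> C) (z : I -> C) :
  (forall j, csum_to (F j) (z j)) ->
  csum_to (fun a b => \sum_(j <- l) c j * F j a b) (\sum_(j <- l) c j * z j).
Proof.
move=> hF; elim: l => [|j l IHl].
  move=> e e0; exists 0%N => n _; rewrite big_nil sub0r normcN.
  rewrite /sqsum big1 => [|a _]; first by rewrite ComplexField.Normc.normc0 ltW.
  by rewrite big1 // => b _; rewrite big_nil.
rewrite big_cons; have := csum_to_linear (c j) (hF j) IHl; congr csum_to.
by apply/funext => a; apply/funext => b; rewrite big_cons.
Qed.

(** The bound by a single term serves twice: it makes the energy nonnegative, and for a state of
    zero energy it makes every term vanish. *)
Lemma csum_to_ge f z : (forall a b, 0 <= f a b) -> csum_to (fun a b => (f a b)%:C%C) z ->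
  forall a b, f a b <= complex.Re z.
Proof.
move=> f0 hz a b; rewrite -subr_le0; apply: complex_real_le_eps => e e0.
have [n0 h] := hz e e0; pose n := maxn n0 (maxn `|a| `|b|).
have {}h := h n (leq_maxl _ _).
have an : a \in zrange n by rewrite mem_zrange /n; lia.
have bn : b \in zrange n by rewrite mem_zrange /n; lia.
have le1 : f a b <= rsum f n.
  rewrite /rsum (big_rem a an) /= (big_rem b bn) /= -addrA lerDl addr_ge0 // sumr_ge0 // => c _.
  by rewrite sumr_ge0.
have := le_trans (Re_le_normc _) h; rewrite !CE sqsumE Re_sum.
have -> : \sum_(c <- zrange n) complex.Re (\sum_(d <- zrange n) (f c d)%:C%C) = rsum f n.
  by apply: eq_bigr => c _; rewrite Re_sum.
rewrite ler_norml; lra.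
Qed.
End SquareSums.

(** * Arithmetic of the momentum grid *)

Section Grid.
Variables (R : realType) (nx ny : nat).
Implicit Types (k : grid nx ny) (a b c d : int).
Local Notation gridpt := (gridpt R nx ny).
Local Notation kvec := (@kvec R nx ny).

Lemma grid_gt0 k : (0 < nx)%N /\ (0 < ny)%N.
Proof. by case: k => [[i1 h1] [i2 h2]]; split;
  [apply: leq_ltn_trans h1|apply: leq_ltn_trans h2]. Qed.

(** The residue lies in the range of the ordinal type, so the default value of [insubd] never
    occurs. *)
Lemma val_modz (n : nat) (x : 'I_n) (a : int) : (0 < n)%N ->
  (insubd x `|((x%:Z + a) %% n%:Z)%Z|%N)%:Z = ((x%:Z + a) %% n%:Z)%Z.
Proof.
move=> n0; have nz : n%:Z != 0 by rewrite -lt0n.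
have ge0 := modz_ge0 (x%:Z + a) nz.
have lt : (`|((x%:Z + a) %% n%:Z)%Z| < n)%N.
  by rewrite -ltz_nat gez0_abs // ltz_pmod // ltz_nat.
by rewrite val_insubd lt gez0_abs.
Qed.

Lemma gridshift_val k a b :
  (gridshift k a b).1%:Z = ((k.1%:Z + a) %% nx%:Z)%Z /\
  (gridshift k a b).2%:Z = ((k.2%:Z + b) %% ny%:Z)%Z.
Proof. by have [nx0 ny0] := grid_gt0 k; split; exact: val_modz. Qed.

Lemma gridP k k' : k.1%:Z = k'.1%:Z -> k.2%:Z = k'.2%:Z -> k = k'.
Proof. by case: k k' => [k1 k2] [k1' k2'] /= [/val_inj ->] [/val_inj ->]. Qed.

Lemma gridshiftD k a b c d : gridshift (gridshift k a b) c d = gridshift k (a + c) (b + d).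
Proof.
have [e1 e2] := gridshift_val k a b; have [f1 f2] := gridshift_val (gridshift k a b) c d.
have [h1 h2] := gridshift_val k (a + c) (b + d).
by apply: gridP; rewrite ?f1 ?f2 ?h1 ?h2 ?e1 ?e2 modzDml addrA.
Qed.

Lemma gridshift0 k : gridshift k 0 0 = k.
Proof.
have [e1 e2] := gridshift_val k 0 0; apply: gridP; rewrite ?e1 ?e2 addr0 modz_small //=;
  by rewrite ltz_nat ltn_ord.
Qed.

Lemma gridshiftK k a b : gridshift (gridshift k a b) (- a) (- b) = k.
Proof. by rewrite gridshiftD !subrr gridshift0. Qed.

Lemma gridptD a b c d : gridpt (a + c) (b + d) = gridpt a b + gridpt c d.
Proof.
by rewrite /gridpt /lin2 !intrD; congr (_, _) => /=; ring.
Qed.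

Lemma gridptN a b : gridpt (- a) (- b) = - gridpt a b.
Proof.
by rewrite /gridpt /lin2 !intrN; congr (_, _) => /=; ring.
Qed.

Lemma gridpt_gammaS k c d : gridpt (c * nx%:Z) (d * ny%:Z) = gammaS R c d.
Proof.
have [nx0 ny0] := grid_gt0 k; rewrite /gridpt /gammaS !intrM.
by rewrite !mulfK // pnatr_eq0 -lt0n.
Qed.

Lemma kvec_gridshift k a b : exists c d,
  kvec k + gridpt a b = kvec (gridshift k a b) + gammaS R c d.
Proof.
have [e1 e2] := gridshift_val k a b.
exists ((k.1%:Z + a) %/ nx%:Z)%Z, ((k.2%:Z + b) %/ ny%:Z)%Z.
rewrite -(gridpt_gammaS k) /kvec -!gridptD e1 e2; congr gridpt.
  by rewrite [LHS](divz_eq _ nx%:Z) addrC.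
by rewrite [LHS](divz_eq _ ny%:Z) addrC.
Qed.

Lemma lin2_injective (s t s' t' : R) :
  lin2 s t g1 g2 = lin2 s' t' g1 g2 -> s = s' /\ t = t'.
Proof.
rewrite /lin2 /=; have h3 := @sqrt3_neq0 R; move: (Num.sqrt 3) h3 => z h3 [e1 e2].
have h1 : (t - s) * z = (t' - s') * z by lra.
have {}h1 := mulIf h3 h1; split; lra.
Qed.

(** Membership in the reciprocal lattice amounts to divisibility of the integer coordinates by nx
    and ny, which any grid point detects. *)
Lemma in_GammaS_gridshift k a b : in_GammaS (gridpt a b) = (gridshift k a b == k).
Proof.
have [nx0 ny0] := grid_gt0 k; have nxz : nx%:Z != 0 by rewrite -lt0n.
have nyz : ny%:Z != 0 by rewrite -lt0n.
apply/asboolP/eqP => [[c [d e]]|e].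
  have [/esym e1 /esym e2] := lin2_injective e.
  have nxr : (nx%:R : R) != 0 by rewrite pnatr_eq0 -lt0n.
  have nyr : (ny%:R : R) != 0 by rewrite pnatr_eq0 -lt0n.
  have ea : a = c * nx%:Z by apply/eqP; rewrite -(eqr_int R) intrM e1 divfK.
  have eb : b = d * ny%:Z by apply/eqP; rewrite -(eqr_int R) intrM e2 divfK.
  have [f1 f2] := gridshift_val k a b; apply: gridP;
    rewrite ?f1 ?f2 ?ea ?eb addrC modzMDl modz_small //=;
    by rewrite ltz_nat ltn_ord.
have [c [d]] := kvec_gridshift k a b; rewrite e => /addrI ->.
by exists c, d.
Qed.

Lemma kvec_opp k : exists c d,
  - kvec k = kvec (gridshift k (- (k.1%:Z + k.1%:Z)) (- (k.2%:Z + k.2%:Z))) + gammaS R c d.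
Proof.
have [c [d e]] := kvec_gridshift k (- (k.1%:Z + k.1%:Z)) (- (k.2%:Z + k.2%:Z)).
by exists c, d; rewrite -e gridptN gridptD /kvec opprD addrA subrr sub0r.
Qed.

(** The grid point congruent to -k, obtained as the shift of k by -2 k so that the lemmas on
    [gridshift] apply. *)
Definition gridopp k : grid nx ny := gridshift k (- (k.1%:Z + k.1%:Z)) (- (k.2%:Z + k.2%:Z)).

Lemma gridopp_inj : injective gridopp.
Proof.
move=> k k' e.
have [e1 e2] := gridshift_val k (- (k.1%:Z + k.1%:Z)) (- (k.2%:Z + k.2%:Z)).
have [e1' e2'] := gridshift_val k' (- (k'.1%:Z + k'.1%:Z)) (- (k'.2%:Z + k'.2%:Z)).
move: e1 e2; rewrite -/(gridopp k) e e1' e2' => e1 e2.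
have simp (x : int) : x + - (x + x) = - x by ring.
rewrite !simp in e1 e2.
have small (n : nat) (x y : 'I_n) : ((- x%:Z) %% n%:Z = (- y%:Z) %% n%:Z)%Z -> x%:Z = y%:Z.
  move=> h; have : modz (x%:Z + y%:Z + - x%:Z) n = modz (x%:Z + y%:Z + - y%:Z) n.
    by rewrite -modzDmr h modzDmr.
  by rewrite addrK addrAC subrr add0r !modz_small ?ltz_nat ?ltn_ord.
by apply: gridP; apply: small.
Qed.
End Grid.

(** * The density operators and the energy *)

Section Density.
Variables (R : realType) (N M nx ny : nat).
Local Notation C := R[i].
Local Notation W := (wave R N).
Variables (D : set W) (H : W -> W) (eps : int -> R * R -> R) (Psi u : int -> R * R -> W).
Hypothesis eigenpairs : bloch_eigenpairs D H eps Psi.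
Hypothesis Hu : gauge M Psi u.
Local Notation grid := (grid nx ny).
Local Notation mode := (mode M nx ny).
Local Notation fock := (fock R mode).
Local Notation gridpt := (gridpt R nx ny).
Local Notation kvec := (@kvec R nx ny).
Local Notation rho := (@rho R N M nx ny u).
Implicit Types (k : grid) (a b : int) (psi phi : fock) (m n : band M).

Definition rho_matrix a b (t t' : mode) : C :=
  form_factor u (kvec t.2) (gridpt a b) t.1 t'.1 * (t'.2 == gridshift t.2 a b)%:R.

Definition rho_background a b : C :=
  \sum_(k : grid) \sum_(m : band M) \sum_(n : band M)
    form_factor u (kvec k) (gridpt a b) m n * (2^-1 * ((m == n) && in_GammaS (gridpt a b))%:R).

Lemma sum_mode (V : nmodType) (F : mode ->
  V) : \sum_t F t = \sum_(k : grid) \sum_(m : band M) F (m, k).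
Proof. by rewrite exchange_big pair_bigA; apply: eq_bigr => -[]. Qed.

Lemma rho_one_body a b psi :
  rho a b psi = one_body (rho_matrix a b) psi - fscale (rho_background a b) psi.
Proof.
rewrite /rho /one_body /rho_background -fscaleN1 fscaleA mulN1r -sumrN fscale_suml.
rewrite (sum_mode (fun t => \sum_t' fscale (rho_matrix a b t t') (create t (annihilate t' psi)))).
rewrite -big_split; apply: eq_bigr => k _; rewrite -sumrN fscale_suml -big_split.
apply: eq_bigr => m _; rewrite -sumrN fscale_suml.
rewrite (sum_mode (fun t' =>
  fscale (rho_matrix a b (m, k) t') (create (m, k) (annihilate t' psi)))).
rewrite (bigD1 (gridshift k a b)) //= [X in _ + X + _]big1 ?addr0; last first.
  by move=> k' kk'; rewrite big1 // => n _; rewrite /rho_matrix /= (negbTE kk') mulr0 fscale0.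
rewrite -big_split; apply: eq_bigr => n _ /=.
by rewrite /rho_matrix /= eqxx mulr1 fscaleDr -fscaleN1 !fscaleA mulN1r mulrN.
Qed.

(** Swapping the two Bloch functions of an inner product conjugates the form factor; folding k + q
    back into the grid costs a reciprocal vector, under which form factors are periodic. Hence the
    adjoint of rho(q) is rho(-q). *)
Lemma rho_matrix_conj a b (t t' : mode) :
  rho_matrix (- a) (- b) t' t = (rho_matrix a b t t')^*%C.
Proof.
rewrite /rho_matrix conjM.
have -> : (t.2 == gridshift t'.2 (- a) (- b)) = (t'.2 == gridshift t.2 a b).
  apply/eqP/eqP => ->; last by rewrite gridshiftK.
  by have := gridshiftK t'.2 (- a) (- b); rewrite !opprK.
have [->|_] := eqVneq t'.2 (gridshift t.2 a b); last by rewrite conjc0 !mulr0.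
rewrite conjc1 !mulr1 gridptN -(form_factor_conj eigenpairs Hu).
have [c [d ->]] := kvec_gridshift R t.2 a b.
by rewrite (form_factor_periodic eigenpairs Hu).
Qed.

Lemma rho_background_conj a b : rho_background (- a) (- b) = (rho_background a b)^*%C.
Proof.
rewrite /rho_background conj_sum; apply: eq_bigr => k _; rewrite conj_sum.
apply: eq_bigr => m _; rewrite conj_sum; apply: eq_bigr => n _; rewrite conjM.
have -> : in_GammaS (gridpt (- a) (- b)) = in_GammaS (gridpt a b).
  rewrite !(in_GammaS_gridshift _ k); apply/eqP/eqP => e; last by rewrite -{1}e gridshiftK.
  by have := gridshiftK k (- a) (- b); rewrite e !opprK.
have -> : (2^-1 * ((m == n) && in_GammaS (gridpt a b))%:R : C)^*%C =
    2^-1 * ((m == n) && in_GammaS (gridpt a b))%:R.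
  by rewrite conjM rmorphV ?unitfE ?pnatr_eq0 // !rmorph_nat.
have [/asboolP[c [d e]]|] := boolP (in_GammaS (gridpt a b)); last by rewrite andbF !mulr0.
have [->|] := eqVneq m n; last by rewrite !mulr0.
congr (_ * _); rewrite gridptN -(form_factor_conj eigenpairs Hu) e.
by rewrite (form_factor_periodic eigenpairs Hu).
Qed.

Lemma rho_linear a b : flinear (rho a b).
Proof.
move=> c psi phi; rewrite !rho_one_body one_body_linear.
by apply/ffunP => S; rewrite !ffunE; ring.
Qed.

Lemma fdot_rho a b psi phi : fdot psi (rho a b phi) = fdot (rho (- a) (- b) psi) phi.
Proof.
rewrite !rho_one_body fdotDr fdotDl fdot_one_body -!fscaleN1 !fscaleA fdotZr fdotZl.
rewrite rho_background_conj; congr (fdot _ _ + _ * _); last first.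
  by rewrite conjM conjcK (rmorphN1 (@conjc R)).
congr one_body; apply/funext => t; apply/funext => t'.
by rewrite -rho_matrix_conj.
Qed.
End Density.

Section States.
Variables (R : realType) (N M nx ny : nat).
Local Notation C := R[i].
Local Notation W := (wave R N).
Variables (D : set W) (H : W -> W) (eps : int -> R * R -> R) (Psi u : int -> R * R -> W).
Variable Vhat : R * R -> R.
Hypothesis eigenpairs : bloch_eigenpairs D H eps Psi.
Hypothesis Hu : gauge M Psi u.
Hypothesis Vpos : forall q, 0 < Vhat q.
Hypothesis Vconv : HFBI_convergent M nx ny u Vhat.
Hypothesis traceopp : forall k a b,
  \tr (form_block M u k (gammaS R a b)) = (\tr (form_block M u (- k) (gammaS R a b)))^*%C.
Local Notation grid := (grid nx ny).
Local Notation mode := (mode M nx ny).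
Local Notation fock := (fock R mode).
Local Notation gridpt := (gridpt R nx ny).
Local Notation kvec := (@kvec R nx ny).
Local Notation rho := (@rho R N M nx ny u).
Local Notation energy := (@energy R N M nx ny u Vhat).
Implicit Types (k : grid) (a b : int) (psi phi : fock) (m n : band M) (s : bool).

Let prefactor : R := ((nx * ny)%:R * areaOmega R)^-1.

Definition norm2 psi : R := \sum_S normc (psi S) ^+ 2.

(** The adjoint of rho(q) is rho(-q), so the expectation value is a convergent series of nonnegative
    terms and dominates each of them. *)
Lemma energy_ge psi a b : fdot psi psi = 1 ->
  prefactor * (Vhat (gridpt a b) * norm2 (rho (- a) (- b) psi)) <= energy psi.
Proof.
move=> psi1; pose t S a b := HFBI_term u Vhat a b psi S.
(* Convergence is known amplitude by amplitude; the expectation value is a finite combination of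
   these series. *)
have /choice[z hz] : forall S, exists z, csum_to (t S) z.
  by move=> S; apply: summable_csum_to; exact: Vconv.
pose Z := \sum_S (psi S)^*%C * z S.
have hZ : csum_to (fun a b => (Vhat (gridpt a b) * norm2 (rho (- a) (- b) psi))%:C%C) Z.
  have := csum_to_sum (index_enum {set mode}) (fun S => (psi S)^*%C) hz; congr csum_to.
  apply/funext => a'; apply/funext => b'; rewrite rmorphM /= /norm2 -fdot_norm.
  transitivity (fdot psi (HFBI_term u Vhat a' b' psi)); first by [].
  apply: etrans (fdotZr _ _ _) _; apply: (congr1 (fun z => _ * z)).
  exact: (fdot_rho eigenpairs Hu).
have e : energy psi = prefactor * complex.Re Z.
  rewrite /energy psi1 divr1.
  have -> : fdot psi (HFBI u Vhat psi) = prefactor%:C%C * Z.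
    rewrite /Z big_distrr; apply: eq_bigr => S _; rewrite ffunE.
    have -> : csum (fun a b => HFBI_term u Vhat a b psi S) = z S by apply: csumE; exact: hz.
    by rewrite /= mulrCA.
  by rewrite ReM /= mul0r subr0.
rewrite e ler_wpM2l ?invr_ge0 ?mulr_ge0 ?ler0n ?(ltW (areaOmega_gt0 R)) //.
apply: (csum_to_ge _ hZ) => a' b'.
by rewrite mulr_ge0 ?(ltW (Vpos _)) // sumr_ge0 // => S _; exact: sqr_ge0.
Qed.

Lemma energy_eq0 psi : (forall a b, rho a b psi = 0) -> energy psi = 0.
Proof.
move=> h; suff e : HFBI u Vhat psi = 0 by rewrite /energy e fdot0r mul0r.
apply/ffunP => S; rewrite !ffunE.
have -> : csum (fun a b => HFBI_term u Vhat a b psi S) = 0; last by rewrite mulr0.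
apply: csumE => e e0; exists 0%N => n _; rewrite sub0r normcN /sqsum big1 => [|a _].
  by rewrite ComplexField.Normc.normc0 ltW.
rewrite big1 // => b _; rewrite /HFBI_term h (flinear0 (rho_linear u _ _)) fscaler0.
by rewrite ffunE.
Qed.

(** The grid point [k] makes the grid nonempty, so that the prefactor of the Hamiltonian is
    positive. *)
Lemma rho_eq0 k psi : fdot psi psi = 1 -> energy psi <= 0 -> forall a b, rho a b psi = 0.
Proof.
move=> psi1 E0 a b; have := le_trans (energy_ge (- a) (- b) psi1) E0.
have [nx0 ny0] := grid_gt0 k.
have p0 : 0 < prefactor.
  by rewrite invr_gt0 mulr_gt0 ?areaOmega_gt0 // ltr0n muln_gt0 nx0.
rewrite pmulr_rle0 // pmulr_rle0 ?Vpos // !opprK => h.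
have {}h : norm2 (rho a b psi) = 0.
  by apply/eqP; rewrite eq_le h sumr_ge0 // => S _; exact: sqr_ge0.
apply/ffunP => S; move/eqP: h; rewrite psumr_eq0 => [/allP/(_ S (mem_index_enum _))|S' _];
  last exact: sqr_ge0.
by rewrite sqrf_eq0 ffunE => /eqP/ComplexField.Normc.eq0_normc.
Qed.

Definition sector_modes s : {set mode} := [set t | t.1.1 == s]%SET.

Lemma tr_form_block (k q : R * R) :
  \tr (form_block M u k q) = \sum_(l < M) form_factor u k q (true, l) (true, l).
Proof. by apply: eq_bigr => l _; rewrite mxE. Qed.

(** Modulo Gamma^* the grid is stable under k -> -k, and this reindexing conjugates the summands. *)
Lemma sum_trace_real a b :
  let x := \sum_(k : grid) \tr (form_block M u (kvec k) (gammaS R a b)) in x^*%C = x.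
Proof.
move=> x; rewrite /x conj_sum [RHS](reindex_inj (@gridopp_inj nx ny)); apply: eq_bigr => k _.
apply: (etrans (y := \tr (form_block M u (- kvec k) (gammaS R a b)))).
  exact: etrans (congr1 (@conjc R) (traceopp (kvec k) a b)) (conjcK _).
have [c [d e]] := kvec_opp R k; rewrite e;
  apply: etrans (tr_form_block _ _) (etrans _ (esym (tr_form_block _ _))).
apply: eq_bigr => l _; exact: (form_factor_periodic eigenpairs Hu).
Qed.

Lemma sum_band_trace s (k q : R * R) : \sum_(l < M) form_factor u k q (s, l) (s, l) =
  if s then \tr (form_block M u k q) else (\tr (form_block M u k q))^*%C.
Proof.
rewrite tr_form_block; case: s => //.
rewrite conj_sum; apply: eq_bigr => l _;
  exact: (form_factor_negb eigenpairs Hu k q (true, l) (true, l)).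
Qed.

(** The sector is completely filled and the form factor has no entries between sectors, so the
    one-body part acts as the sum of its diagonal entries over the sector, which is zero unless q
    lies in Gamma^* . The background is the mean of the sums over both sectors. These are conjugate
    to each other and real, hence equal. *)
Lemma rho_sector_state s (c : C) a b :
  rho a b [ffun S => c * (S == sector_modes s)%:R] = 0.
Proof.
set psi := [ffun S => _] : fock; rewrite rho_one_body.
have cr t : t \in sector_modes s -> create t psi = 0.
  move=> ts; apply/ffunP => S; rewrite !ffunE; case: ifP => // _.
  case: eqP => [e|]; last by rewrite !mulr0.
  by move: ts; rewrite -e !inE eqxx.
have an t : t \notin sector_modes s -> annihilate t psi = 0.
  move=> ts; apply/ffunP => S; rewrite !ffunE; case: ifP => // _.
  case: eqP => [e|]; last by rewrite !mulr0.
  by move: ts; rewrite -e !inE eqxx.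
have -> : one_body (rho_matrix u a b) psi =
    fscale (\sum_(t in sector_modes s) rho_matrix u a b t t) psi.
  rewrite [X in fscale X]big_mkcond fscale_suml /one_body; apply: eq_bigr => t _.
  have L t' : t' \notin sector_modes s -> create t (annihilate t' psi) = 0.
    by move=> /an ->; apply: flinear0; exact: create_linear.
  have L2 t' : t' \in sector_modes s -> t \notin sector_modes s -> rho_matrix u a b t t' = 0.
    rewrite !inE => /eqP e ts; rewrite /rho_matrix (form_factor_sector eigenpairs Hu) ?mul0r //.
    by rewrite e.
  have [ts|ts] := boolP (t \in sector_modes s); last first.
    rewrite big1 ?fscale0 // => t' _; have [t's|/L ->] := boolP (t' \in sector_modes s);
      last exact: fscaler0.
    by rewrite L2 // fscale0.
  have ca t' : create t (annihilate t' psi) = fscale (t == t')%:R psi.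
    rewrite -create_annihilate (cr t ts) (flinear0 (@annihilate_linear _ _ t')) addr0 //.
  rewrite (bigD1 t) //= big1 ?addr0 => [|t' tt']; rewrite ca.
    by rewrite eqxx fscale1.
  by rewrite eq_sym (negbTE tt') fscale0 fscaler0.
suff -> : \sum_(t in sector_modes s) rho_matrix u a b t t = rho_background M nx ny u a b by rewrite subrr.
have -> : \sum_(t in sector_modes s) rho_matrix u a b t t =
    \sum_(k : grid) \sum_(l < M) form_factor u (kvec k) (gridpt a b) (s, l) (s,
      l) * (in_GammaS (gridpt a b))%:R.
  rewrite big_mkcond (sum_mode (fun t => if t \in sector_modes s then rho_matrix u a b t t else 0)).
  apply: eq_bigr => k _.
  transitivity (\sum_(t : bool) \sum_(l < M) if ((t, l), k) \in sector_modes s then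
     rho_matrix u a b ((t, l), k) ((t, l), k) else 0).
    exact: sum_band.
  rewrite (bigD1 s isT) -[RHS]addr0; congr (_ + _).
    apply: eq_bigr => l _; rewrite inE eqxx /rho_matrix (in_GammaS_gridshift _ k).
    by rewrite [gridshift k a b == k]eq_sym.
  rewrite big1 // => t ts; rewrite big1 // => l _.
  by rewrite inE -[_.1.1]/t (negbTE ts).
have -> : rho_background M nx ny u a b = \sum_(k : grid) (2^-1 * (in_GammaS (gridpt a b))%:R) *
   (\sum_(l < M) form_factor u (kvec k) (gridpt a b) (true, l) (true, l) +
    \sum_(l < M) form_factor u (kvec k) (gridpt a b) (false, l) (false, l)).
  apply: eq_bigr => k _.
  transitivity (\sum_(m : band M) form_factor u (kvec k) (gridpt a b) m m * (2^-1 * (in_GammaS (gridpt a b))%:R)).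
    apply: eq_bigr => m _; rewrite (bigD1 m) //= big1 ?addr0 => [|n nm]; first by rewrite eqxx.
    by rewrite eq_sym (negbTE nm) /= !mulr0.
  rewrite -big_distrl [LHS]mulrC; congr (_ * _).
  transitivity (\sum_(t : bool) \sum_(l < M) form_factor u (kvec k) (gridpt a b) (t, l) (t, l)).
    exact: sum_band.
  by rewrite big_bool.
have [/asboolP[c' [d e]]|_] := boolP (in_GammaS (gridpt a b)); last first.
  by rewrite big1 => [|k _]; [rewrite big1 // => k _; rewrite mulr0 mul0r|rewrite big1 // => l _;
    rewrite mulr0].
pose T k := \tr (form_block M u (kvec k) (gammaS R c' d)).
have L (t : bool) k : \sum_(l < M) form_factor u (kvec k) (gridpt a b) (t, l) (t, l) =
    if t then T k else (T k)^*%C.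
  by rewrite e; exact: sum_band_trace.
transitivity (\sum_k if s then T k else (T k)^*%C).
  apply: eq_bigr => k _; apply: etrans _ (L s k); apply: eq_bigr => l _; exact: mulr1.
apply: esym; transitivity (\sum_k 2^-1 * (T k + (T k)^*%C)).
  apply: eq_bigr => k _; apply: (congr2 (fun x y => x * y)); first exact: mulr1.
  exact: (congr2 (fun x y => x + y) (L true k) (L false k)).
rewrite -mulr_sumr big_split /= -conj_sum; have hT := sum_trace_real c' d.
rewrite /= in hT; rewrite [X in _ +
  X]hT -mulr2n -[X in _ * X]mulr_natl mulrA mulVf ?pnatr_eq0 // mul1r.
by case: (s) => //; rewrite -conj_sum; exact: esym hT.
Qed.
End States.

Lemma big_comp_foldr (I T : Type) (r : seq I) (F : I -> T -> T) (x : T) :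
  (\big[comp/id]_(a <- r) F a) x = foldr F x r.
Proof. by elim: r => [|a r IHr]; rewrite ?big_nil // big_cons /= IHr. Qed.

Lemma foldr_allpairs (I J T : Type) (r : seq I) (r' : seq J) (F : I * J -> T -> T) (x : T) :
  foldr F x [seq (a, b) | a <- r, b <- r'] =
  foldr (fun a y => foldr (fun b z => F (a, b) z) y r') x r.
Proof. by elim: r => //= a r IHr; rewrite foldr_cat foldr_map IHr. Qed.

Lemma norm_normc (R : realType) (z : R[i]) : `|z| = (normc z)%:C%C.
Proof. by rewrite normc_def; case: z. Qed.

(** * Slater determinants and the two ferromagnetic states *)

Section SlaterStates.
Variables (R : realType) (M nx ny : nat).
Local Notation C := R[i].
Local Notation grid := (grid nx ny).
Local Notation mode := (mode M nx ny).
Implicit Types (k : grid) (m n : band M) (s : bool) (Xi : grid -> band M -> 'I_M -> C).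

Definition orthonormal_orbitals Xi := forall k (l j : 'I_M),
  \sum_(n : band M) (Xi k n l)^*%C * Xi k n j = (l == j)%:R.

Definition orbital Xi (p : 'I_M * grid) (t : mode) : C := Xi p.2 t.1 p.1 * (t.2 == p.2)%:R.

Definition orbital_list : seq ('I_M * grid) :=
  [seq (l, k) | l <- index_enum 'I_M, k <- index_enum grid].

Lemma uniq_orbital_list : uniq orbital_list.
Proof. by rewrite allpairs_uniq ?index_enum_uniq // => -[? ?] [? ?] _ _ [-> ->]. Qed.

Lemma mem_orbital_list p : p \in orbital_list.
Proof. by case: p => l k; apply: allpairs_f; rewrite mem_index_enum. Qed.

Lemma slater_determinant Xi :
  slater Xi = determinant_state (orbital Xi) orbital_list.
Proof.
rewrite /slater big_comp_foldr /determinant_state foldr_allpairs.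
congr (foldr _ _ _); apply/funext => l; apply/funext => psi.
rewrite big_comp_foldr; congr (foldr _ _ _); apply/funext => k; apply/funext => phi.
rewrite /bdag /cdag sum_mode (bigD1 k) //= [X in _ + X]big1 ?addr0.
  by apply: eq_bigr => n _; rewrite /orbital /= eqxx mulr1.
move=> k' k'k; rewrite big1 // => n _.
by rewrite /orbital /= (negbTE k'k) mulr0 fscale0.
Qed.

Lemma ip_orbital (w : band M -> C) k Xi p :
  ip (fun t => w t.1 * (t.2 == k)%:R) (orbital Xi p) =
  (\sum_(m : band M) (w m)^*%C * Xi k m p.1) * (p.2 == k)%:R.
Proof.
rewrite /ip sum_mode (bigD1 k) //= [X in _ + X]big1 ?addr0; last first.
  by move=> k' k'k; rewrite big1 // => m _; rewrite (negbTE k'k) mulr0 conjc0 mul0r.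
rewrite big_distrl; apply: eq_bigr => m _; rewrite /orbital /= eqxx mulr1.
by have [->|_] := eqVneq p.2 k; rewrite ?eqxx ?mulr1 ?mulr0.
Qed.

Lemma orbital_orthonormal Xi : orthonormal_orbitals Xi ->
  forall p q, ip (orbital Xi p) (orbital Xi q) = (p == q)%:R.
Proof.
move=> oX [l k] [j k']; rewrite (ip_orbital (fun n => Xi k n l)) oX xpair_eqE /= [k' == k]eq_sym.
by case: (l == j); rewrite ?mul1r ?mul0r.
Qed.

Lemma slater_norm Xi : orthonormal_orbitals Xi -> fdot (slater Xi) (slater Xi) = 1.
Proof.
move=> oX; rewrite slater_determinant; apply: determinant_norm uniq_orbital_list.
exact: orbital_orthonormal.
Qed.

Definition in_sector s k Xi := forall l j, Xi k (~~ s, l) j = 0.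

(** Restricted to the sector, each Xi(k) is a square isometry, hence unitary, so its columns span
    all modes of the sector at k. *)
Lemma slater_sector Xi s : orthonormal_orbitals Xi -> (forall k, in_sector s k Xi) ->
  exists2 c : C, normc c = 1 & slater Xi = [ffun S => c * (S == sector_modes M nx ny s)%:R].
Proof.
move=> oX sX; rewrite slater_determinant.
have sectorE (F : band M -> C) : \sum_n F n = \sum_(l < M) F (s, l) + \sum_(l < M) F (~~ s, l).
  by rewrite sum_band big_bool; case: s {sX} => //; rewrite addrC.
have complete k (l j : 'I_M) : \sum_(b < M) (Xi k (s, l) b)^*%C * Xi k (s, j) b = (j == l)%:R.
  pose A : 'M[C]_M := \matrix_(a, b) Xi k (s, a) b.
  have : map_mx (@conjc R) A^T *m A = 1%:M.
    apply/matrixP => a b; rewrite !mxE -(oX k) sectorE [X in _ = _ + X]big1 ?addr0.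
      by apply: eq_bigr => c _; rewrite !mxE.
    by move=> c _; rewrite sX conjc0 mul0r.
  move/mulmx1C/matrixP/(_ j l); rewrite !mxE => <-; apply: eq_bigr => b _.
  by rewrite !mxE mulrC.
apply: determinant_sector uniq_orbital_list _ _; first exact: orbital_orthonormal.
  move=> [[s' l] k]; rewrite inE => /= /eqP ->.
  exists (fun p => (Xi k (s, l) p.1)^*%C * (p.2 == k)%:R); apply/funext => -[[s'' j] k'].
  rewrite big_allpairs /=.
  transitivity (\sum_(b < M) (Xi k (s, l) b)^*%C * Xi k (s'', j) b * (k' == k)%:R).
    rewrite -big_distrl /=; have [->|s''s] := eqVneq s'' s.
      rewrite complete /mode_vector !xpair_eqE eqxx /=.
      by case: (j == l); case: (k' == k); rewrite ?mul1r ?mul0r.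
    rewrite big1 ?mul0r => [|b _]; first by rewrite /mode_vector !xpair_eqE (negbTE s''s).
    have -> : s'' = ~~ s by case: (s) (s'') s''s => [] [].
    by rewrite sX mulr0.
  apply: eq_bigr => b _; rewrite (bigD1 k) //= [X in _ + X]big1 ?addr0.
    by rewrite /orbital /= eqxx mulr1 mulrA.
  by move=> k'' kk; rewrite (negbTE kk) mulr0 mul0r.
move=> [[s' l] k] p; rewrite inE => /= s's _; rewrite /orbital /=.
have -> : s' = ~~ s by case: (s) (s') s's => [] [].
by rewrite sX mul0r.
Qed.

Definition sector_orbitals s : grid -> band M -> 'I_M -> C := fun _ n j => (n == (s, j))%:R.

Lemma scaled_sector_orthonormal s (z : C) : z^*%C * z = 1 ->
  orthonormal_orbitals (fun k n j => z * sector_orbitals s k n j).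
Proof.
move=> z1 k l j; rewrite (bigD1 (s, l)) //= big1 ?addr0 => [|n nl]; rewrite /sector_orbitals.
  by rewrite conjM mulrACA z1 mul1r eqxx conjc1 mul1r xpair_eqE eqxx.
by rewrite (negbTE nl) mulr0 conjc0 mul0r.
Qed.

Lemma sector_orbitals_orthonormal s : orthonormal_orbitals (sector_orbitals s).
Proof.
have := @scaled_sector_orthonormal s 1; rewrite conjc1 mul1r => /(_ erefl).
by congr orthonormal_orbitals; apply/funext => k; apply/funext => n; apply/funext => j;
  rewrite mul1r.
Qed.

Lemma in_sector_orbitals s k : in_sector s k (sector_orbitals s).
Proof. by move=> l j; rewrite /sector_orbitals xpair_eqE; case: s. Qed.

(** A Slater state has no free prefactor. The phase is produced by multiplying each of the n
    orbitals by an n-th root of c / c0, where c0 is the phase of the reference determinant; this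
    needs n > 0. *)
Lemma sector_slater_state s (c : C) : normc c = 1 -> (0 < M)%N -> grid ->
  slater_states [ffun S : {set mode} => c * (S == sector_modes M nx ny s)%:R].
Proof.
move=> c1 M0 k.
have [c0 c01 e] := slater_sector (sector_orbitals_orthonormal s) (@in_sector_orbitals s).
pose n := size orbital_list; have n0 : (0 < n)%N.
  have := mem_orbital_list (Ordinal M0, k); rewrite /n; by case: orbital_list.
pose z := n.-root (c / c0); have zn : z ^+ n = c / c0 by rewrite rootCK.
have c0n : c0 != 0 by apply/eqP => c00; move: c01; rewrite c00 ComplexField.Normc.normc0; lra.
have z1 : z^*%C * z = 1.
  have : `|z| ^+ n = 1.
    by rewrite -normrX zn normrM normfV !norm_normc c1 c01 invr1 mulr1.
  move/eqP; rewrite pexpr_eq1 // => /eqP h; rewrite normc_sqr_conj.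
  by move: h; rewrite norm_normc => -[->]; rewrite expr1n.
exists (fun k n j => z * sector_orbitals s k n j); split.
  by move=> k' l j; exact: (scaled_sector_orthonormal s z1).
rewrite slater_determinant; move: e; rewrite slater_determinant => e.
have -> : orbital (fun k n j => z * sector_orbitals s k n j) = fun p t =>
  z * orbital (sector_orbitals s) p t.
  by apply/funext => p; apply/funext => t; rewrite /orbital mulrA.
rewrite determinant_scale e -/n zn; apply/ffunP => S; rewrite !ffunE mulrA.
by rewrite divfK.
Qed.

(** The order of creation differs from that of [slater]. It affects only the phase, whose value
    [determinant_sector] leaves undetermined. *)
Lemma ferromagnet_sector s :
  exists2 c : C, normc c = 1 & ferromagnet R M nx ny s = [ffun S =>
    c * (S == sector_modes M nx ny s)%:R].
Proof.
pose X (p : grid * 'I_M) : mode -> C := mode_vector R ((s, p.2), p.1).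
pose r := [seq (k, l) | k <- index_enum grid, l <- index_enum 'I_M].
have ur : uniq r by rewrite allpairs_uniq ?index_enum_uniq // => -[? ?] [? ?] _ _ [-> ->].
have oX p q : ip (X p) (X q) = (p == q)%:R.
  case: p q => [k l] [k' l']; rewrite /X ip_mode /mode_vector !xpair_eqE eqxx /= andbC.
  by rewrite [k' == k]eq_sym [l' == l]eq_sym; case: (_ && _); rewrite ?conjc0 ?conjc1.
have -> : ferromagnet R M nx ny s = determinant_state X r.
  rewrite /ferromagnet big_comp_foldr /determinant_state foldr_allpairs.
  congr (foldr _ _ _); apply/funext => k; apply/funext => psi.
  rewrite big_comp_foldr; congr (foldr _ _ _); apply/funext => l; apply/funext => phi.
  by rewrite cdag_mode.
apply: determinant_sector oX ur _ _.
  move=> [[s' l] k]; rewrite inE => /= /eqP ->.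
  exists (fun p => ((p.1 == k) && (p.2 == l))%:R).
  apply/funext => t; rewrite /r big_allpairs (bigD1 k) //= [X in _ = _ + X]big1 ?addr0; last first.
    by move=> k' k'k; rewrite big1 // => l' _; rewrite (negbTE k'k) mul0r.
  rewrite (bigD1 l) //= [X in _ = _ + X]big1 ?addr0 ?eqxx ?mul1r // => l' l'l.
  by rewrite (negbTE l'l) andbF mul0r.
move=> [[s' l] k] p; rewrite inE => /= s's _; rewrite /X /mode_vector !xpair_eqE.
by rewrite (negbTE s's).
Qed.
End SlaterStates.

(** * Slater states annihilated by all density operators *)

Section ZeroEnergy.
Variables (R : realType) (N M nx ny : nat).
Local Notation C := R[i].
Local Notation W := (wave R N).
Variables (D : set W) (H : W -> W) (eps : int -> R * R -> R) (Psi u : int -> R * R -> W).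
Hypothesis eigenpairs : bloch_eigenpairs D H eps Psi.
Hypothesis Hu : gauge M Psi u.
Local Notation grid := (grid nx ny).
Local Notation kvec := (@kvec R nx ny).
Local Notation gridpt := (gridpt R nx ny).
Variable Xi : grid -> band M -> 'I_M -> C.
Hypothesis oX : orthonormal_orbitals Xi.
Hypothesis rho0 : forall a b, rho u a b (slater Xi) = 0.
Implicit Types (k : grid) (s : bool).

(** With [w] running over the complement of the occupied orbitals at k, this is (1 - P(k))
    Lambda_k(q) P(k + q) = 0. It is [one_body_kernel] for a test vector supported at the single
    momentum k. *)
Lemma orbital_invariance k (a b : int) (w : band M -> C) :
  (forall l, \sum_n (w n)^*%C * Xi k n l = 0) -> forall l,
  \sum_m \sum_n (w m)^*%C * form_factor u (kvec k) (gridpt a b) m n *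
    Xi (gridshift k a b) n l = 0.
Proof.
move=> w0 l.
pose y (t : mode M nx ny) : C := w t.1 * (t.2 == k)%:R.
have yX p : p \in orbital_list M nx ny -> ip y (orbital Xi p) = 0.
  by move=> _; rewrite ip_orbital w0 mul0r.
have e : one_body (rho_matrix u a b) (determinant_state (orbital Xi) (orbital_list M nx ny)) =
    fscale (rho_background M nx ny u a b) (determinant_state (orbital Xi) (orbital_list M nx ny)).
  by have := rho0 a b; rewrite rho_one_body slater_determinant => /eqP; rewrite subr_eq0 => /eqP.
have := one_body_kernel (orbital_orthonormal oX) (uniq_orbital_list M nx ny) e yX
  (mem_orbital_list (l, gridshift k a b)).
apply: etrans; rewrite sum_mode (bigD1 k) //= [X in _ = _ + X]big1 ?addr0; last first.
  move=> k' k'k; rewrite big1 // => m _; rewrite big1 // => t' _.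
  by rewrite /y /= (negbTE k'k) mulr0 conjc0 !mul0r.
apply: eq_bigr => m _; rewrite sum_mode (bigD1 (gridshift k a b)) //= [X in _ = _ + X]big1 ?addr0.
  apply: eq_bigr => n _; rewrite /y /rho_matrix /orbital /= !eqxx !mulr1.
  by [].
move=> k' k'k; rewrite big1 // => n _; rewrite /rho_matrix /= (negbTE k'k).
by rewrite mulr0 mulr0 mul0r.
Qed.

(** The basis vectors of the empty sector at k are orthogonal to the occupied orbitals. Invariance
    then says that the form factor block of that sector kills the corresponding components at k',
    and this block is injective. *)
Lemma in_sector_step s k k' : in_sector s k Xi ->
  opnorm_lt1 (opsub (Pi M u (kvec k')) (Pi M u (kvec k))) -> in_sector s k' Xi.
Proof.
move=> sk lt1 l j.
pose a : int := k'.1%:Z - k.1%:Z; pose b : int := k'.2%:Z - k.2%:Z.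
have kk' : gridshift k a b = k'.
  have [e1 e2] := gridshift_val k a b; apply: gridP; rewrite ?e1 ?e2 addrC subrK modz_small //=;
    by rewrite ltz_nat ltn_ord.
have q : gridpt a b = kvec k' - kvec k.
  by rewrite /a /b gridptD gridptN.
apply: (form_factor_injective eigenpairs Hu (s := ~~ s) (x := fun l => Xi k' (~~ s, l) j) lt1) =>
  l'.
pose w (n : band M) : C := (n == (~~ s, l'))%:R.
have w0 i : \sum_n (w n)^*%C * Xi k n i = 0.
  rewrite (bigD1 (~~ s, l')) //= big1 ?addr0 => [|n nl]; first by rewrite sk mulr0.
  by rewrite /w (negbTE nl) conjc0 mul0r.
have := orbital_invariance a b w0 j; rewrite kk' q; apply: etrans; symmetry.
rewrite (bigD1 (~~ s, l')) //= [X in _ + X]big1 ?addr0; last first.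
  by move=> m ml; rewrite big1 // => n _; rewrite /w (negbTE ml) conjc0 !mul0r.
rewrite sum_band (bigD1 (~~ s) isT) -[RHS]addr0; congr (_ + _).
  by apply: eq_bigr => i _; rewrite /w eqxx conjc1 mul1r.
rewrite big1 // => t ts; rewrite big1 // => i _.
rewrite (form_factor_sector eigenpairs Hu) ?mulr0 ?mul0r //.
by rewrite eq_sym.
Qed.

Lemma in_sector_all s k0 : grid_assumption M nx ny u -> in_sector s k0 Xi ->
  forall k, in_sector s k Xi.
Proof.
move=> HG s0 k; have [L [p [p0 pL step]]] := HG k0 k; rewrite -pL.
have : (L <= L)%N by []; elim: {1 3}L => [|i IHi] iL; first by rewrite p0.
exact: in_sector_step (IHi (ltnW iL)) (step i iL).
Qed.

Lemma sum_form_factor (k q : R * R) m (z : C) (x : band M -> C) :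
  \sum_n z * form_factor u k q m n * x n =
  z * \sum_(l < M) form_factor u k q m (m.1, l) * x (m.1, l).
Proof.
rewrite sum_band (bigD1 m.1 isT) -[RHS]addr0 big_distrr; congr (_ + _).
  by apply: eq_bigr => l _; rewrite /= mulrA.
rewrite big1 // => t tm; rewrite big1 // => l _.
by rewrite (form_factor_sector eigenpairs Hu) ?mulr0 ?mul0r // eq_sym.
Qed.

Lemma in_sector_base k0 :
  (exists a b : int, complex.Im (\tr (form_block M u (kvec k0) (gammaS R a b))) != 0) ->
  (forall P : 'M[R[i]]_M, is_orthogonal_projector P -> P != 0 -> P != 1%:M ->
    exists a b : int, (1%:M - P) *m form_block M u (kvec k0) (gammaS R a b) *m P != 0) ->
  exists s, in_sector s k0 Xi.
Proof.
move=> [a0 [b0 im0]] irr.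
pose A (q : int * int) := form_block M u (kvec k0) (gammaS R q.1 q.2).
pose X s : 'M[C]_M := \matrix_(l, j) Xi k0 (s, l) j.
have dich : X true = 0 \/ X false = 0.
  apply: (sector_dichotomy (neg := fun q : int * int => (- q.1, - q.2)) (A := A)).
  (* The family is closed under adjoints: A_k(-G) is the adjoint of A_k(G), by periodicity of the
     form factor in k. *)
  - move=> [a b]; apply/matrixP => i j; rewrite /A /= !mxE gammaSN.
    rewrite -(form_factor_periodic eigenpairs Hu _ _ a b).
    exact: (form_factor_conj eigenpairs Hu).
  - apply/matrixP => i j; rewrite [RHS]mxE -(oX k0) sum_band big_bool mxE.
    by congr (_ + _); rewrite mxE; apply: eq_bigr => l _; rewrite !mxE.
  - move=> [a b] V Y VY; apply/matrixP => r j.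
    pose w (n : band M) : C := (if n.1 then V r n.2 else Y r n.2)^*%C.
    have w0 i : \sum_n (w n)^*%C * Xi k0 n i = 0.
      have /matrixP/(_ r i) := VY; rewrite [RHS]mxE; apply: etrans; rewrite sum_band big_bool mxE.
      by congr (_ + _); rewrite mxE; apply: eq_bigr => l _; rewrite /w /= conjcK mxE.
    have := orbital_invariance (a * nx%:Z) (b * ny%:Z) w0 j.
    have -> : gridshift k0 (a * nx%:Z) (b * ny%:Z) = k0.
      apply/eqP; rewrite -(in_GammaS_gridshift R) (gridpt_gammaS R k0); apply/asboolP.
      by exists a, b.
    rewrite (gridpt_gammaS R k0) => h; rewrite [RHS]mxE; apply: etrans _ h.
    rewrite sum_band big_bool mxE; congr (_ + _).
      rewrite -mulmxA mxE; apply: eq_bigr => l _; rewrite sum_form_factor /w /= conjcK mxE.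
      by congr (_ * _); apply: eq_bigr => i _; rewrite /A !mxE.
    rewrite -mulmxA mxE; apply: eq_bigr => l _; rewrite sum_form_factor /w /= conjcK mxE.
    congr (_ * _); apply: eq_bigr => i _; rewrite !mxE.
    by rewrite (form_factor_negb eigenpairs Hu _ _ (true, l) (true, i)).
  - exists (a0, b0); apply: contra im0 => /eqP /(congr1 (@complex.Im R)).
    rewrite Imconj /A /= => e; apply/eqP; lra.
  - move=> P PP hP P0 P1; have [a [b h]] := irr P (conj PP hP) P0 P1.
    by exists (a, b).
have zero s : X s = 0 -> exists s', in_sector s' k0 Xi.
  move=> /matrixP X0; exists (~~ s) => l j; have := X0 l j; rewrite !mxE negbK.
  by [].
by case: dich; exact: zero.
Qed.
End ZeroEnergy.

Theorem theorem4 (R : realType) (N M nx ny : nat)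
  (D : set (wave R N)) (H : wave R N -> wave R N)
  (eps : int -> R * R -> R) (Psi u : int -> R * R -> wave R N)
  (Vhat : R * R -> R)
  (HH : hamiltonian D H)
  (HS : spectral_assumption D H eps Psi)
  (HY : symmetry_assumption D H eps M)
  (Hu : gauge M Psi u)
  (HG : grid_assumption M nx ny u)
  (Vpos : forall q, 0 < Vhat q)
  (Vradial : forall q q', dotp q q = dotp q' q' -> Vhat q = Vhat q')
  (Vconv : HFBI_convergent M nx ny u Vhat)
  (Hcond : exists k : grid nx ny,
     (exists a b : int,
        complex.Im (\tr (form_block M u (kvec R k) (gammaS R a b))) != 0) /\
     (forall P : 'M[R[i]]_M, is_orthogonal_projector P -> P != 0 -> P != 1%:M ->
        exists a b : int,
          (1%:M - P) *m form_block M u (kvec R k) (gammaS R a b) *m P != 0)) :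
  forall psi : fock R (mode M nx ny),
    HF_ground_state u Vhat psi <->
    exists c : R[i], `|c| = 1 /\
      (psi = fscale c (ferromagnet R M nx ny true) \/
       psi = fscale c (ferromagnet R M nx ny false)).
Proof.
have [_ eigenpairs [Res [rR cR aR]] _] := HS.
have traceopp := trace_form_block_opp HH eigenpairs rR cR aR HY Hu.
have [k0 [im irr]] := Hcond.
(* For M = 0 the trace in condition (1) would be an empty sum. *)
have M0 : (0 < M)%N.
  have [a [b]] := im; rewrite lt0n; apply: contra => /eqP M0.
  have -> : \tr (form_block M u (kvec R k0) (gammaS R a b)) = 0 by rewrite /mxtrace big1 // => l;
    have := ltn_ord l; rewrite {2}M0.
  by rewrite eqxx.
have sector_energy s (c : R[i]) : energy u Vhat [ffun S =>
  c * (S == sector_modes M nx ny s)%:R] = 0.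
  apply: energy_eq0 => a b; exact: (rho_sector_state nx ny eigenpairs Hu traceopp s c a b).
have fscale_sector s (c d : R[i]) : fscale c [ffun S => d * (S == sector_modes M nx ny s)%:R] =
    [ffun S => (c * d) * (S == sector_modes M nx ny s)%:R].
  by apply/ffunP => S; rewrite !ffunE mulrA.
have slater_energy (phi : fock R (mode M nx ny)) : slater_states phi -> 0 <= energy u Vhat phi.
  move=> [Xi [oX ->]]; have := energy_ge eigenpairs Hu Vpos Vconv 0 0 (slater_norm oX);
    apply: le_trans.
  rewrite mulr_ge0 ?invr_ge0 ?mulr_ge0 ?ler0n ?(ltW (areaOmega_gt0 R)) ?(ltW (Vpos _)) //.
  by apply: sumr_ge0 => S _; exact: sqr_ge0.
move=> psi; split=> [[[Xi [oX ->]] ground]|[c [c1 e]]].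
  (* A filled sector is a competitor of zero energy, so a minimizer cannot have positive energy. *)
  have E0 : energy u Vhat (slater Xi) <= 0.
    rewrite -(sector_energy true 1); apply: ground; apply: sector_slater_state => //.
    exact: ComplexField.Normc.normc1.
  have rho0 := rho_eq0 eigenpairs Hu Vpos Vconv k0 (slater_norm oX) E0.
  have [s s0] := in_sector_base eigenpairs Hu oX rho0 im irr.
  have [c c1 e] := slater_sector oX (in_sector_all eigenpairs Hu oX rho0 HG s0).
  have [d d1 f] := ferromagnet_sector R M nx ny s.
  have d0 : d != 0 by apply/eqP => d00; move: d1; rewrite d00 ComplexField.Normc.normc0; lra.
  exists (c / d); split.
    by rewrite normrM normfV !norm_normc c1 d1 invr1 mulr1.
  have -> : slater Xi = fscale (c / d) (ferromagnet R M nx ny s).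
    by rewrite f fscale_sector divfK.
  by case: (s); [left|right].
have [s ->] : exists s, psi = fscale c (ferromagnet R M nx ny s).
  by case: e => ->; [exists true|exists false].
have [d d1 ->] := ferromagnet_sector R M nx ny s; rewrite fscale_sector.
split=> [|phi /slater_energy]; last by rewrite sector_energy.
apply: sector_slater_state => //; rewrite ComplexField.Normc.normcM d1 mulr1.
by move: c1; rewrite norm_normc => -[].
Qed.
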